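(* Let $(\gamma_n)_{n\ge 0}$ be a sequence of i.i.d. random variables with $\mathcal{C}^1$ density function supported on $\mathbb{R}_+$. For $n\ge 1$ put $$X_n=\prod_{i=0}^{n-1}\gamma_i,\qquad Z_n=\sum_{k=0}^{n-1}\Big(\prod_{i=0}^{k-1}\gamma_i^{-1}\Big)\Big(\prod_{j=k+1}^{n-1}\gamma_j\Big).$$ Then there exists a Markov kernel $\Lambda$ on $(0,+\infty)$ (not depending on $n$) such that for all $n\ge 1$, $$\mathbb{P}(X_n\in dx\mid Z_n,\dots,Z_1)=\Lambda(Z_n,dx)\quad\text{a.s.}$$ if and only if there are $a>0$ and $\lambda\in\mathbb{R}$ such that the $\gamma_n$ are distributed according to the law $GIG(\lambda,a,a)$.
   Context: Empty products equal $1$; thus $X_1=\gamma_0$ and $Z_1=1$. For $a>0$ and $\lambda\in\mathbb{R}$, $GIG(\lambda,a,a)$ (Generalized Inverse Gaussian) is the probability law on $(0,+\infty)$ with density $x\mapsto \frac{1}{2K_\lambda(a^2)}x^{\lambda-1}e^{-\frac{a^2}{2}(x+\frac1x)}$, where $K_\lambda(z)=\frac12\int_0^{+\infty}x^{\lambda-1}e^{-\frac z2(x+\frac1x)}dx$ for $z>0$ is the Macdonald function (modified Bessel function of the second kind). A Markov kernel $\Lambda$ on $(0,+\infty)$ is a map $(z,A)\mapsto\Lambda(z,A)$ such that $\Lambda(z,\cdot)$ is a Borel probability measure on $(0,+\infty)$ for each $z>0$ and $\Lambda(\cdot,A)$ is measurable for each Borel set $A$. *)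

(* Defs.v *)
From HB Require Import structures.
From mathcomp Require Import all_boot all_order all_algebra.
From mathcomp Require Import all_classical all_reals all_analysis.
From mathcomp Require Import measurable_realfun.

Set Implicit Arguments.
Unset Strict Implicit.
Unset Printing Implicit Defensive.

Import Order.TTheory GRing.Theory Num.Theory.
Import numFieldNormedType.Exports.

Local Open Scope classical_set_scope.
Local Open Scope ring_scope.

Definition mutually_independent (d : measure_display) (T : measurableType d)
    (R : realType) (P : probability T R) (X : nat -> {RV P >-> R}) : Prop :=
  forall (s : seq nat) (B : nat -> set R), uniq s ->
    (forall i, measurable (B i)) ->
    P (\big[setI/setT]_(i <- s) (X i @^-1` B i)) =
      (\prod_(i <- s) P (X i @^-1` B i))%E.

Definition identically_distributed (d : measure_display)
    (T : measurableType d) (R : realType) (P : probability T R)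
    (X : nat -> {RV P >-> R}) : Prop :=
  forall (m n : nat) (A : set R), measurable A ->
    distribution P (X m) A = distribution P (X n) A.

Definition iid (d : measure_display) (T : measurableType d) (R : realType)
    (P : probability T R) (X : nat -> {RV P >-> R}) : Prop :=
  mutually_independent X /\ identically_distributed X.

Definition has_density (d : measure_display) (T : measurableType d)
    (R : realType) (P : probability T R) (X : {RV P >-> R}) (f : R -> R)
    : Prop :=
  [/\ measurable_fun setT f,
      forall x, 0 <= f x &
      forall A : set R, measurable A ->
        distribution P X A =
          (\int[@lebesgue_measure R]_(x in A) (f x)%:E)%E].

(* [C1] is required on the open half-line only, so that a density with a jump
   at 0 (or unbounded near 0) is allowed. *)
Definition C1_supported_on_Rplus (R : realType) (f : R -> R) : Prop :=
  [/\ forall x, x < 0 -> f x = 0,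
      {in `]0, +oo[, forall x, derivable f x 1} &
      {in `]0, +oo[, continuous (derive1 f)}].

Definition macdonald (R : realType) (lambda z : R) : R :=
  2^-1 * (\int[@lebesgue_measure R]_(x in `]0, +oo[)
            (x `^ (lambda - 1) * expR (- (z / 2) * (x + x^-1))))%R.

Definition gig_pdf (R : realType) (lambda a x : R) : R :=
  if 0 < x then
    (2 * macdonald lambda (a ^+ 2))^-1 * x `^ (lambda - 1) *
      expR (- (a ^+ 2 / 2) * (x + x^-1))
  else 0.

(* A Markov kernel on the open half-line, represented by a kernel on the whole
   line whose values at z <= 0 are irrelevant: any kernel on the half-line
   extends measurably, e.g. by a Dirac mass at 1. *)
Definition kernel_on_pos (R : realType)
    (L : R.-pker (measurableTypeR R) ~> (measurableTypeR R)) : Prop :=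
  forall z : R, 0 < z -> L z `]0, +oo[%classic = 1%E.

Definition sigma_gen (d : measure_display) (T : measurableType d)
    (R : realType) (Z : nat -> T -> R) (n : nat) : set (set T) :=
  \bigcup_(i in [set i | (1 <= i <= n)%N])
    preimage_set_system setT (Z i) measurable.

(* [Y] is a version of the conditional probability of the event [E] given the
   sigma-algebra generated by [G]. *)
Definition is_cond_prob (d : measure_display) (T : measurableType d)
    (R : realType) (P : probability T R) (G : set (set T)) (E : set T)
    (Y : T -> \bar R) : Prop :=
  measurable_fun setT (Y : g_sigma_algebraType G -> \bar R) /\
  forall B : set T, <<s G >> B -> (\int[P]_(w in B) Y w)%E = P (E `&` B).

Definition Xprod (T : Type) (R : realType) (g : nat -> T -> R) (n : nat)
    (w : T) : R :=
  \prod_(0 <= i < n) g i w.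

Definition Zsum (T : Type) (R : realType) (g : nat -> T -> R) (n : nat)
    (w : T) : R :=
  \sum_(0 <= k < n)
    ((\prod_(0 <= i < k) (g i w)^-1) * (\prod_(k.+1 <= j < n) g j w)).

(* Main.v *)
(* Only if.  With [X_(n+1) = gamma_n X_n] and
   [Z_(n+1) = gamma_n Z_n + 1 / X_n], the vector [(X_3, Z_3, Z_2)] has an
   explicit density [q(x, y, z)].  If the law of [X_3] given [(Z_3, Z_2)] depends
   on [Z_3] only, then [q(x, y, z) q(x', y, z') = q(x', y, z) q(x, y, z')].  For
   [theta(t) = t^2 f'(t) / f(t)] this says that
   [(b c)^2 theta(a) + c^2 theta(b) + theta(c)] depends only on [a b c] and
   [b c + c / a + 1 / (a b)].  This forces [theta] to be differentiable, then to
   satisfy a differential equation whose solutions are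
   [k (t^2 - 1) - alpha t].  Hence [f(t) = C t^(- alpha) exp(k (t + 1 / t))]
   wherever [f > 0], which is everywhere on the half-line by continuity, and
   integrability gives [k < 0].

   If.  Take for [Lambda z] the law with density proportional to
   [x^(lambda - 1) exp(- (a^2 / (2 z)) (x + 1 / x))].  When [u] has law
   [Lambda z] and [g] is an independent GIG variable, the density of
   [(x, y) = (g u, g z + 1 / u)] is that of [Lambda y] at [x] times a function
   of [y], so [Lambda] intertwines with the recursion, and the claim follows by
   induction on [n]. *)

Require Import Defs.
From HB Require Import structures.
From mathcomp Require Import all_boot all_order all_algebra finmap.
From mathcomp Require Import all_classical all_reals all_analysis.
From mathcomp Require Import measurable_realfun.
From mathcomp Require Import ring lra.

Set Implicit Arguments.
Unset Strict Implicit.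
Unset Printing Implicit Defensive.

Import Order.TTheory GRing.Theory Num.Theory.
Import numFieldNormedType.Exports.

Local Open Scope classical_set_scope.
Local Open Scope ring_scope.

(** * Integration as a monotone functional *)

Section monotone_functional.
Local Open Scope ereal_scope.
Context d (S : measurableType d) (R : realType).

(** The case n = 3 is the smallest that constrains the law: Z_1 is the constant 1, so for n = 2
    alone any regular conditional law of X_2 given Z_2 would serve.

    Three obstacles shape the only-if direction. The kernel identity holds only almost everywhere
    and the kernel is not known to have a density; integrated over small boxes it becomes an
    identity between numbers at almost every y, which the continuity of f squeezes to a pointwise
    one. Since f is only C^1, theta is merely continuous and its invariance cannot be
    differentiated; integrated over a free parameter, the invariance writes theta through
    primitives. Finally theta makes sense only where f > 0, so the solution is first found on an
    interval of positivity; its explicit form has positive limits at the ends, and f cannot reach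
    zero there.

    In the if direction the weight is multiplicative in the right way: with x = g u and y = g z + 1
    / u one has (u + 1 / u) / z + g + 1 / g = (x + 1 / x) / y + y / z + (z + 1 / z) / y, where x
    occurs in one term only. *)

Record monotone_functional (I : (S -> \bar R) -> \bar R) : Prop := {
  functional0 : I (cst 0) = 0 ;
  functional_ge0 : forall F, (forall x, 0 <= F x) -> 0 <= I F ;
  functionalD : forall F G, (forall x, 0 <= F x) -> (forall x, 0 <= G x) ->
    measurable_fun setT F -> measurable_fun setT G ->
    I (fun x => F x + G x) = I F + I G ;
  functionalZ : forall (c : R) F, (0 <= c)%R -> (forall x, 0 <= F x) ->
    measurable_fun setT F -> I (fun x => c%:E * F x) = c%:E * I F ;
  functional_lim : forall F : (S -> \bar R)^nat,
    (forall n x, 0 <= F n x) -> (forall n, measurable_fun setT (F n)) ->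
    (forall x, nondecreasing_seq (F ^~ x)) ->
    I (fun x => limn (F ^~ x)) = limn (fun n => I (F n)) }.

Variables (I : (S -> \bar R) -> \bar R) (hI : monotone_functional I).

Lemma functional_sum (J : Type) (s : seq J) (F : J -> S -> \bar R) :
  (forall i x, 0 <= F i x) -> (forall i, measurable_fun setT (F i)) ->
  I (fun x => \sum_(i <- s) F i x) = \sum_(i <- s) I (F i).
Proof.
move=> F0 mF; elim: s => [|i s IH].
  rewrite big_nil -[RHS](functional0 hI); congr I.
  by apply/funext => x; rewrite big_nil.
rewrite big_cons -IH -(functionalD hI)//.
- by congr I; apply/funext => x; rewrite big_cons.
- by move=> x; apply: sume_ge0.
- exact: emeasurable_sum.
Qed.

(** The proof is an argument so that the measure structure declared below can be attached to the
    functional. *)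
Definition functional_measure (_ : monotone_functional I) (A : set S) : \bar R :=
  I (EFin \o \1_A).

Let m := functional_measure hI.

Let m0 : m set0 = 0.
Proof.
rewrite /m /functional_measure -[RHS](functional0 hI); congr I.
by apply/funext => x; rewrite /= indic0.
Qed.

Let m_ge0 A : 0 <= m A.
Proof. by apply: (functional_ge0 hI) => x /=; rewrite lee_fin. Qed.

Let m_sigma_additive : semi_sigma_additive m.
Proof.
move=> F mF tF mUF.
have mFi n : measurable_fun setT (EFin \o \1_(F n) : S -> \bar R).
  exact/measurable_EFinP/measurable_indic.
have hs n x : 0 <= (EFin \o \1_(F n) : S -> \bar R) x by rewrite lee_fin.
have -> : m (\bigcup_n F n) = limn (fun n => \sum_(0 <= i < n) m (F i)).
  rewrite [LHS](_ : _ = I (fun x => limn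
      (fun n => \sum_(0 <= i < n) (EFin \o \1_(F i)) x))); last first.
    rewrite /m /functional_measure; congr I; apply/funext => x /=.
    by rewrite indic_bigcup.
  rewrite (functional_lim hI) //.
  - by congr (limn _); apply/funext => n; rewrite functional_sum.
  - by move=> n x; apply: sume_ge0.
  - by move=> n; exact: emeasurable_sum.
  - by move=> x a b ab; apply: lee_sum_nneg_natr.
by apply: is_cvg_nneseries.
Qed.

HB.instance Definition _ := isMeasure.Build _ _ _ (functional_measure hI)
  m0 m_ge0 m_sigma_additive.

Import HBNNSimple.

(** Simple functions approximate [F] from below and both sides commute with increasing limits, so
    agreement on indicators is enough. Push-forwards, densities and kernels are all instances of
    such functionals. *)
Lemma integral_functional (mu : {measure set S -> \bar R}) (F : S -> \bar R) :
  (forall A, measurable A -> I (EFin \o \1_A) = mu A) ->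
  (forall x, 0 <= F x) -> measurable_fun setT F ->
  I F = \int[mu]_x F x.
Proof.
move=> Imu F0 mF.
pose f_ := nnsfun_approx measurableT mF.
have fF x : F x = limn (fun n => (f_ n x)%:E).
  by apply/esym/cvg_lim => //; exact: (cvg_nnsfun_approx measurableT mF).
have fn0 n x : 0 <= (f_ n x)%:E by rewrite lee_fin.
have mfn n : measurable_fun setT (EFin \o f_ n) by exact/measurable_EFinP.
have ndf x : nondecreasing_seq (fun n => (f_ n x)%:E).
  by move=> a b ab; rewrite lee_fin; exact/lefP/nd_nnsfun_approx.
transitivity (limn (fun n => I (EFin \o f_ n))).
  by rewrite -(functional_lim hI)//; congr I; apply/funext.
transitivity (limn (fun n => \int[mu]_x (f_ n x)%:E)); last first.
  by rewrite -monotone_convergence//; apply: eq_integral => x _.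
congr (limn _); apply/funext => n.
rewrite integralT_nnsfun sintegralE fsbig_finite//=.
rewrite [LHS](_ : _ = I (fun x => \sum_(k <- fset_set (range (f_ n)))
    (k * \1_(f_ n @^-1` [set k]) x)%:E)); last first.
  congr I; apply/funext => x /=.
  by rewrite [X in X%:E = _](fimfunE (f_ n)) fsbig_finite//= sumEFin.
rewrite functional_sum => [|k x|k]; last 2 first.
- by rewrite EFinM nnfun_muleindic_ge0.
- exact/measurable_EFinP/measurable_funM.
(* Homogeneity is available for nonnegative scalars only; a negative [k] has empty preimage under a
   nonnegative simple function. *)
apply: eq_bigr => k _; have [k0|k0] := leP 0%R k.
  rewrite -Imu//= -(functionalZ hI)//.
  - by move=> x; rewrite /= lee_fin.
  - exact/measurable_EFinP/measurable_indic.
rewrite preimage_nnfun0// measure0 mule0 -[RHS](functional0 hI); congr I.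
by apply/funext => x; rewrite indic0 mulr0.
Qed.

Lemma integral_functional_unique (mu : {measure set S -> \bar R})
    (G : set (set S)) (g : (set S)^nat) (F : S -> \bar R) :
  measurable = <<s G >> -> setI_closed G -> (forall i, G (g i)) ->
  \bigcup_k (g k) = setT -> (forall k, mu (g k) < +oo) ->
  (forall A, G A -> I (EFin \o \1_A) = mu A) ->
  (forall x, 0 <= F x) -> measurable_fun setT F ->
  I F = \int[mu]_x F x.
Proof.
move=> mG GI Gg gT mug IG F0 mF; apply: integral_functional => // A mA.
apply/esym.
apply: (measure_unique G g mG GI Gg gT mu (functional_measure hI)) => //.
by move=> B GB; rewrite -IG.
Qed.

End monotone_functional.

(** [J] itself is turned into a measure, with which [I] is then compared on the generating
    pi-system. *)
Lemma eq_monotone_functional d (S : measurableType d) (R : realType)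
    (I J : (S -> \bar R) -> \bar R) (G : set (set S)) (g : (set S)^nat)
    (F : S -> \bar R) :
  monotone_functional I -> monotone_functional J ->
  measurable = <<s G >> -> setI_closed G -> (forall i, G (g i)) ->
  \bigcup_k (g k) = setT -> (forall k, J (EFin \o \1_(g k)) < +oo)%E ->
  (forall A, G A -> I (EFin \o \1_A) = J (EFin \o \1_A)) ->
  (forall x, 0 <= F x)%E -> measurable_fun setT F -> I F = J F.
Proof.
move=> hI hJ mG GI Gg gT Jg IJ F0 mF.
rewrite (integral_functional_unique hI (mu := functional_measure hJ) mG GI Gg)//.
by apply/esym/integral_functional.
Qed.

Lemma eq_monotone_functional_measurable d (S : measurableType d) (R : realType)
    (I J : (S -> \bar R) -> \bar R) (F : S -> \bar R) :
  monotone_functional I -> monotone_functional J ->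
  (forall A, measurable A -> I (EFin \o \1_A) = J (EFin \o \1_A)) ->
  (forall x, 0 <= F x)%E -> measurable_fun setT F -> I F = J F.
Proof.
move=> hI hJ IJ F0 mF.
rewrite (integral_functional hI (mu := functional_measure hJ))//.
by apply/esym/integral_functional.
Qed.

Lemma monotone_functional_integral d (S : measurableType d) (R : realType)
    (mu : {measure set S -> \bar R}) (D : set S) : measurable D ->
  monotone_functional (fun F => \int[mu]_(x in D) F x)%E.
Proof.
move=> mD; split.
- exact: integral0.
- by move=> F F0; apply: integral_ge0 => x _; exact: F0.
- by move=> F G F0 G0 mF mG; rewrite ge0_integralD//; exact: measurable_funTS.
- by move=> c F c0 F0 mF; rewrite ge0_integralZl//; exact: measurable_funTS.
- move=> F F0 mF ndF; rewrite -monotone_convergence//.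
  by move=> n; exact: measurable_funTS.
Qed.

Lemma monotone_functional_comp d d' (S : measurableType d)
    (T : measurableType d') (R : realType) (I : (S -> \bar R) -> \bar R)
    (phi : S -> T) :
  monotone_functional I -> measurable_fun setT phi ->
  monotone_functional (fun F => I (F \o phi)).
Proof.
move=> [I0 I_ge0 ID IZ Il] mphi; split => //.
- by move=> F F0; apply: I_ge0 => x; exact: F0.
- move=> F G F0 G0 mF mG; apply: (ID (F \o phi) (G \o phi)) => //;
    [by move=> x; exact: F0|by move=> x; exact: G0|exact: measurableT_comp..].
- move=> c F c0 F0 mF; apply: (IZ c (F \o phi)) => //;
    [by move=> x; exact: F0|exact: measurableT_comp].
- move=> F F0 mF ndF; apply: (Il (fun n => F n \o phi)) => //.
  + by move=> n x; exact: F0.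
  + by move=> n; exact: measurableT_comp.
  + by move=> x; exact: ndF.
Qed.

(** * Substitutions on the half-line *)

Section density.
Local Open Scope ereal_scope.
Context d (S : measurableType d) (R : realType).

Lemma monotone_functional_density (mu : {measure set S -> \bar R}) (p : S -> R) :
  (forall x, (0 <= p x)%R) -> measurable_fun setT p ->
  monotone_functional (fun F => \int[mu]_x (F x * (p x)%:E)).
Proof.
move=> p0 mp.
have mp' : measurable_fun setT (EFin \o p) by exact/measurable_EFinP.
have Ep0 x : 0 <= (p x)%:E by rewrite lee_fin.
split.
- by apply: integral0_eq => x _; rewrite mul0e.
- by move=> F F0; apply: integral_ge0 => x _; rewrite mule_ge0.
- move=> F G F0 G0 mF mG.
  under eq_integral do rewrite ge0_muleDl//.
  rewrite ge0_integralD//.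
  + by move=> x _; rewrite mule_ge0.
  + exact: emeasurable_funM.
  + by move=> x _; rewrite mule_ge0.
  + exact: emeasurable_funM.
- move=> c F c0 F0 mF.
  under eq_integral do rewrite -muleA.
  rewrite ge0_integralZl//.
  + exact: emeasurable_funM.
  + by move=> x _; rewrite mule_ge0.
- move=> F F0 mF ndF.
  rewrite -monotone_convergence//.
  + apply: eq_integral => x _; apply/esym/cvg_lim => //.
    by apply: cvgeZr => //; exact/ereal_nondecreasing_is_cvgn/ndF.
  + by move=> n; exact: emeasurable_funM.
  + by move=> n x _; rewrite mule_ge0.
  + by move=> x _ a b ab; rewrite lee_wpmul2r//; exact: ndF.
Qed.

Lemma integral_density (mu nu : {measure set S -> \bar R}) (p : S -> R)
    (F : S -> \bar R) :
  (forall x, (0 <= p x)%R) -> measurable_fun setT p ->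
  (forall A, measurable A -> nu A = \int[mu]_(x in A) (p x)%:E) ->
  (forall x, 0 <= F x) -> measurable_fun setT F ->
  \int[nu]_x F x = \int[mu]_x (F x * (p x)%:E).
Proof.
move=> p0 mp nuE F0 mF; apply/esym.
apply: (integral_functional (monotone_functional_density mu p0 mp)) => // A mA.
rewrite nuE// [RHS]integral_mkcond; apply: eq_integral => x _ /=.
by rewrite patchE indicE; case: (x \in A); rewrite ?mul1e ?mul0e.
Qed.

Lemma integral_mrestr (mu : {measure set S -> \bar R}) (D : set S)
    (mD : measurable D) (F : S -> \bar R) :
  (forall x, 0 <= F x) -> measurable_fun setT F ->
  \int[mrestr mu mD]_x F x = \int[mu]_(x in D) F x.
Proof.
move=> F0 mF; rewrite (@integral_density mu _ (\1_D))//.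
- rewrite [RHS]integral_mkcond; apply: eq_integral => x _.
  by rewrite patchE indicE; case: (x \in D); rewrite ?mule1 ?mule0.
- by move=> A mA; rewrite integral_indic// setIC.
Qed.

End density.

Lemma measurable_funV d (T : measurableType d) (R : realType) (f : T -> R) :
  measurable_fun setT f -> measurable_fun setT (fun x => (f x)^-1).
Proof.
move=> mf; apply: (@measurableT_comp _ _ _ _ _ _ (@GRing.inv R)) => //.
rewrite -(setUv [set 0 : R]); apply/measurable_funU => //.
  exact: measurableC.
split; first exact: measurable_fun_set1.
apply: open_continuous_measurable_fun; first exact/closed_openC/closed_eq.
by move=> x; rewrite inE => /= /eqP x0; exact: inv_continuous.
Qed.

Section halfline.
Local Open Scope ereal_scope.
Context (R : realType).
Notation mu := (@lebesgue_measure R).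
Notation D := (`]0%R, +oo[%classic : set R).

Lemma tonelli_pos (F : R -> R -> \bar R) :
  (forall x y, 0 <= F x y) ->
  measurable_fun setT (fun z : R * R => F z.1 z.2) ->
  \int[mu]_(x in D) \int[mu]_(y in D) F x y =
  \int[mu]_(y in D) \int[mu]_(x in D) F x y.
Proof.
move=> F0 mF; pose G := (fun z : R * R => F z.1 z.2) \_ (D `*` D).
have mG : measurable_fun setT G.
  have mDD : measurable (D `*` D) by exact: measurableX.
  by apply/(measurable_restrictT _ mDD); exact: measurable_funTS.
have G0 z : 0 <= G z by apply: erestrict_ge0.
have GE x y : G (x, y) = if (x \in D) && (y \in D) then F x y else 0.
  rewrite /G patchE; congr (if _ then _ else _).
  by apply/idP/andP; rewrite !inE.
have E : \int[mu]_x \int[mu]_y G (x, y) = \int[mu]_y \int[mu]_x G (x, y).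
  exact: (@fubini_tonelli _ _ _ _ _ mu mu G mG G0).
rewrite integral_mkcond [in RHS]integral_mkcond.
rewrite [LHS](_ : _ = \int[mu]_x \int[mu]_y G (x, y)); last first.
  apply: eq_integral => x _; rewrite patchE; case: ifPn => xD.
    rewrite integral_mkcond; apply: eq_integral => y _.
    by rewrite GE patchE xD.
  by rewrite integral0_eq// => y _; rewrite GE (negbTE xD).
rewrite E; apply: eq_integral => y _; rewrite patchE; case: ifPn => yD.
  rewrite [RHS]integral_mkcond; apply: eq_integral => x _.
  by rewrite GE patchE yD andbT.
by rewrite integral0_eq// => x _; rewrite GE (negbTE yD) andbF.
Qed.

(* A measure agreeing with Lebesgue measure on all the [ ]0, x[ ] is Lebesgue
   measure on the half-line; this covers any substitution at once. *)
Lemma integral_pos_pushforward (phi p : R -> R) (F : R -> \bar R) :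
  (forall x, (0 <= p x)%R) -> measurable_fun setT p ->
  measurable_fun setT phi ->
  (forall x, (x <= 0)%R -> p x = 0%R) ->
  (forall y, (0 < y)%R -> (0 < phi y)%R) ->
  (forall x : R, (0 < x)%R ->
    \int[mu]_(y in D `&` [set y | phi y < x]%R) (p y)%:E = x%:E) ->
  (forall x, 0 <= F x) -> measurable_fun setT F ->
  \int[mu]_(x in D) F x = \int[mu]_(y in D) (F (phi y) * (p y)%:E).
Proof.
move=> p0 mp mphi pN phi0 pE F0 mF.
have mD : measurable D by [].
have Hp := monotone_functional_density mu p0 mp.
have Hphi : monotone_functional
    (fun F : measurableTypeR R -> \bar R =>
       \int[mu]_y (F (phi y) * (p y)%:E)).
  exact: (@monotone_functional_comp _ _ (measurableTypeR R)
    (measurableTypeR R) R _ phi Hp mphi).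
have pD x : x \notin D -> p x = 0%R.
  by rewrite notin_setE/= in_itv/= andbT => /negP; rewrite -leNgt => /pN.
have -> : \int[mu]_(y in D) (F (phi y) * (p y)%:E) =
    \int[mu]_y (F (phi y) * (p y)%:E).
  rewrite integral_mkcond; apply: eq_integral => x _; rewrite patchE.
  by case: ifPn => // /pD ->; rewrite mule0.
(* The left side becomes an integral against Lebesgue measure restricted to the half-line, the right
   side a functional on the whole line; they are compared on the rays []-oo, x[], which generate the
   Borel sets. *)
apply: (etrans (esym (integral_mrestr mu mD F0 mF))); apply/esym.
have H := @integral_functional_unique _ _ _ _ Hphi (mrestr mu mD) (@RGenInftyO.G R)
  (fun n => `]-oo, n%:R[%classic) F.
refine (H _ _ _ _ _ _ _ _) => //.
- exact: RGenInftyO.measurableE.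
- move=> _ _ [a ->] [b ->]; exists (Num.min a b).
  by apply/seteqP; split => x /=; rewrite !in_itv/= lt_min => /andP.
- by move=> n; exists n%:R.
- rewrite -subTset => x _; exists (Num.truncn `|x|).+1 => //=.
  by rewrite in_itv/= (le_lt_trans (ler_norm x))// truncnS_gt.
- move=> k; rewrite -[X in X < _]/(mu (`]-oo, k%:R[ `&` D)).
  rewrite (_ : _ `&` _ = `]0%R, k%:R[%classic).
    by rewrite lebesgue_measure_itv/=; case: ifPn => _; rewrite ltry.
  by apply/seteqP; split => x /=; rewrite !in_itv/= andbT;
    [case=> -> ->|move=> /andP[-> ->]].
- move=> _ [x ->]; rewrite -[RHS]/(mu (`]-oo, x[ `&` D)).
  have -> : `]-oo, x[ `&` D = `]0%R, x[%classic.
    by apply/seteqP; split => y /=; rewrite !in_itv/= andbT;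
      [case=> -> ->|move=> /andP[-> ->]].
  rewrite lebesgue_measure_itv/= lte_fin.
  have -> : \int[mu]_y ((\1_(`]-oo, x[%classic) (phi y))%:E * (p y)%:E) =
      \int[mu]_(y in D `&` [set y | phi y < x]%R) (p y)%:E.
    rewrite [RHS]integral_mkcond; apply: eq_integral => y _.
    rewrite patchE indicE; have [yD|/[dup] yD /pD ->] := boolP (y \in D); last first.
      by rewrite mule0 if_same.
    have -> : (y \in D `&` [set y | (phi y < x)%R]) = (phi y < x)%R.
      apply/idP/idP; rewrite inE /=; first by case.
      by move=> h; split => //; rewrite inE in yD.
    have -> : (phi y \in `]-oo, x[%classic) = (phi y < x)%R.
      by apply/idP/idP; rewrite inE /= in_itv.
    by case: ifPn; rewrite ?mul1e ?mul0e.
  case: ifPn => x0; first by rewrite sube0 pE.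
  rewrite (_ : _ `&` _ = set0) ?integral_set0//.
  rewrite -subset0 => y /= [+ yx]; rewrite in_itv/= andbT => /phi0 y0.
  by move: x0; rewrite (lt_trans y0 yx).
Qed.

Lemma integral_pos_scale (u : R) (F : R -> \bar R) : (0 < u)%R ->
  (forall x, 0 <= F x) -> measurable_fun setT F ->
  \int[mu]_(g in D) F g = \int[mu]_(x in D) (F (x / u)%R * (u^-1)%:E).
Proof.
move=> u0 F0 mF.
rewrite (@integral_pos_pushforward (fun x => x / u)%R
  (fun x => u^-1 * \1_D x)%R)//.
- apply: eq_integral => x xD; rewrite indicE xD mulr1//.
- by move=> x; rewrite mulr_ge0// invr_ge0 ltW.
- by apply: measurable_funM => //; exact: measurable_indic.
- by apply: measurable_funM.
- by move=> x x0; rewrite indicE memNset ?mulr0//= in_itv/= andbT ltNge x0.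
- by move=> y y0; rewrite divr_gt0.
- move=> x x0.
  have -> : D `&` [set y | y / u < x]%R = `]0%R, (x * u)%R[%classic.
    apply/seteqP; split => y /=; rewrite !in_itv/= ?andbT ltr_pdivrMr//.
      by case=> -> ->.
    by move=> /andP[].
  rewrite [LHS](_ : _ = \int[mu]_(y in `]0%R, (x * u)%R[) (u^-1)%:E);
      last first.
    apply: eq_integral => y; rewrite inE/= in_itv/= => /andP[y0 _].
    by rewrite indicE mem_set ?mulr1//= in_itv/= y0.
  rewrite integral_cst//= lebesgue_measure_itv/= lte_fin mulr_gt0// sube0.
  by rewrite -EFinM mulrC mulfK// gt_eqF.
Qed.

(** The set where [k / y < x] is []k / x, +oo[], and [k / y ^+ 2], with primitive [- (k / y)],
    integrates over it to [x]. *)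
Lemma integral_pos_inv (k : R) (F : R -> \bar R) : (0 < k)%R ->
  (forall x, 0 <= F x) -> measurable_fun setT F ->
  \int[mu]_(u in D) F u = \int[mu]_(y in D) (F (k / y)%R * (k / y ^+ 2)%:E).
Proof.
move=> k0 F0 mF.
have m2 : measurable_fun [set: R] (fun x : R => k / x ^+ 2)%R.
  by apply: measurable_funM => //; apply: measurable_funV.
rewrite (@integral_pos_pushforward (fun x => k / x)%R
  (fun x => k / x ^+ 2 * \1_D x)%R)//.
- apply: eq_integral => x xD; rewrite indicE xD mulr1//.
- by move=> x; rewrite mulr_ge0// divr_ge0 ?sqr_ge0// ltW.
- by apply: measurable_funM => //; exact: measurable_indic.
- by apply: measurable_funM => //; exact: measurable_funV.
- by move=> x x0; rewrite indicE memNset ?mulr0//= in_itv/= andbT ltNge x0.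
- by move=> y y0; rewrite divr_gt0.
- move=> x x0; have kx : (0 < k / x)%R by rewrite divr_gt0.
  have -> : D `&` [set y | k / y < x]%R = `](k / x)%R, +oo[%classic.
    apply/seteqP; split => y /=; rewrite !in_itv/= ?andbT.
      by case=> y0; rewrite ltr_pdivrMr// ltr_pdivrMr// mulrC.
    move=> h; have y0 := lt_trans kx h; split => //.
    by move: h; rewrite ltr_pdivrMr// ltr_pdivrMr// mulrC.
  rewrite [LHS](_ : _ = \int[mu]_(y in `](k / x)%R, +oo[) (k / y ^+ 2)%:E);
      last first.
    apply: eq_integral =>  y; rewrite inE/= in_itv/= andbT => h.
    by rewrite indicE mem_set ?mulr1//= in_itv/= (lt_trans kx h).
  rewrite integral_itv_obnd_cbnd; last exact/measurable_EFinP/measurable_funTS.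
  have dF (y : R) : (0 < y)%R -> is_derive y 1%R (fun y : R => - (k / y))%R (k / y ^+ 2)%R.
    move=> hy0; have y0' : y != 0%R by rewrite gt_eqF.
    have h := is_deriveN (is_deriveM (is_derive_cst k y 1%R)
      (is_deriveV y0' (is_derive_id y 1%R))).
    apply: is_derive_eq; rewrite /GRing.scale/=.
    by field.
  have cF (y : R) : (0 < y)%R -> {for y, continuous ((fun z : R => - (k / z))%R : R -> R)}.
    move=> y0'; apply/differentiable_continuous/derivable1_diffP.
    by have [] := dF _ y0'.
  rewrite (@ge0_continuous_FTC2y _ _ (fun y : R => - (k / y))%R _ 0%R)//.
  + rewrite add0e -EFinN opprK; congr EFin; field.
    by rewrite !gt_eqF.
  + by move=> y hy; rewrite divr_ge0 ?ltW// exprn_gt0// (lt_le_trans kx).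
  + apply: continuous_in_subspaceT => y; rewrite inE/= in_itv/= andbT => hy.
    have y0 := lt_le_trans kx hy.
    apply: cvgM; first exact: cvg_cst.
    apply: cvgV; first by rewrite expf_neq0// gt_eqF.
    exact: exprn_continuous.
  + rewrite -oppr0; apply: cvgN; rewrite -(mulr0 k); apply: cvgM; first exact: cvg_cst.
    by apply/gtr0_cvgV0; [exact: nbhs_pinfty_gt|exact: cvg_id].
  + by move=> y hy; have [] := dF _ (lt_trans kx hy).
  + by apply/cvg_at_right_filter; exact: cF.
  + move=> y; rewrite in_itv/= andbT => hy.
    by rewrite derive1E; have [_ ->] := dF _ (lt_trans kx hy).
Qed.

Lemma measurable_uncurry d (T : measurableType d) (F : R -> R -> \bar R)
    (a b : T -> R) :
  measurable_fun setT (fun z : R * R => F z.1 z.2) ->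
  measurable_fun setT a -> measurable_fun setT b ->
  measurable_fun setT (fun t => F (a t) (b t)).
Proof.
move=> mF ma mb.
by apply: (measurableT_comp mF (measurable_fun_pair ma mb)).
Qed.

(* The map [(u, g) |-> (x, y) = (g u, g z + 1 / u)] that sends
   [(X_n, gamma_n)] to [(X_(n+1), Z_(n+1))] when [Z_n = z]. *)
Lemma integral_pos_subst (z : R) (F : R -> R -> \bar R) : (0 < z)%R ->
  (forall u g, 0 <= F u g) ->
  measurable_fun setT (fun w : R * R => F w.1 w.2) ->
  \int[mu]_(u in D) \int[mu]_(g in D) F u g =
  \int[mu]_(x in D) \int[mu]_(y in D)
    (F ((x * z + 1) / y)%R (x * y / (x * z + 1))%R * (y^-1)%:E).
Proof.
move=> z0 F0 mF.
(* First [g = x / u] at fixed [u], then, after exchanging the integrals, [u = (x z + 1) / y] at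
   fixed [x]. The absolute value keeps [H] nonnegative off the half-line, as [tonelli_pos] asks. *)
pose H (u x : R) := F u (x / u)%R * (`|u^-1|%R)%:E.
have H0 u x : 0 <= H u x by rewrite mule_ge0// lee_fin.
have mH : measurable_fun setT (fun w : R * R => H w.1 w.2).
  apply: emeasurable_funM.
    apply: measurable_uncurry => //; apply: measurable_funM => //.
    exact: measurable_funV.
  apply/measurable_EFinP; apply: measurableT_comp => //.
  exact: measurable_funV.
transitivity (\int[mu]_(u in D) \int[mu]_(x in D) H u x).
  apply: eq_integral => u; rewrite inE/= in_itv/= andbT => u0.
  rewrite (integral_pos_scale u0)//; last exact: measurable_uncurry.
  by apply: eq_integral => x _; rewrite /H ger0_norm// invr_ge0 ltW.
apply: (etrans (tonelli_pos H0 mH)).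
apply: eq_integral => x; rewrite inE/= in_itv/= andbT => x0.
have k0 : (0 < x * z + 1)%R by rewrite addr_gt0// mulr_gt0.
rewrite (@integral_pos_inv (x * z + 1)%R (H^~ x) k0)//; last first.
  exact: (measurable_uncurry mH).
apply: eq_integral => y; rewrite inE/= in_itv/= andbT => y0.
rewrite /H -muleA -EFinM ger0_norm ?invr_ge0 ?divr_ge0 ?ltW//.
have xz : (x * z + 1 != 0)%R by rewrite gt_eqF.
have yN0 : (y != 0)%R by rewrite gt_eqF.
by congr (F _ _ * _%:E); field; rewrite ?yN0 ?xz.
Qed.

End halfline.

(** * Disintegration along a kernel *)

Section disintegration.
Local Open Scope ereal_scope.
Context d d' d'' (T : measurableType d) (S : measurableType d')
  (Y : measurableType d'') (R : realType).
Variables (P : probability T R) (L : R.-pker S ~> Y).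
Variables (W : T -> S) (X : T -> Y).
Hypotheses (mW : measurable_fun setT W) (mX : measurable_fun setT X).

Lemma measurable_integral_kernel (F : S * Y -> \bar R) :
  (forall z, 0 <= F z) -> measurable_fun setT F ->
  measurable_fun setT (fun w => \int[L (W w)]_u F (W w, u)).
Proof.
move=> F0 mF.
apply: (measurableT_comp (f := fun s => \int[L s]_u F (s, u))) => //.
exact: (measurable_fun_integral_finite_kernel F L).
Qed.

Lemma monotone_functional_kernel (E : set T) : measurable E ->
  monotone_functional (fun F : S * Y -> \bar R =>
    \int[P]_(w in E) \int[L (W w)]_u F (W w, u)).
Proof.
move=> mE.
have mk F w : measurable_fun setT F ->
  measurable_fun setT (fun u : Y => F (W w, u) : \bar R).
  by move=> mF; exact: (measurableT_comp mF).
have [I0 I_ge0 ID IZ Il] := monotone_functional_integral P mE.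
split.
- by apply: integral0_eq => w _; exact: integral0.
- by move=> F F0; apply: I_ge0 => w; apply: integral_ge0 => u _; exact: F0.
- move=> F G F0 G0 mF mG; rewrite -ID.
  + apply: eq_integral => w _; rewrite ge0_integralD//; exact: mk.
  + by move=> w; apply: integral_ge0.
  + by move=> w; apply: integral_ge0.
  + exact: measurable_integral_kernel.
  + exact: measurable_integral_kernel.
- move=> c F c0 F0 mF; rewrite -IZ//.
  + apply: eq_integral => w _; rewrite ge0_integralZl//; exact: mk.
  + by move=> w; apply: integral_ge0.
  + exact: measurable_integral_kernel.
- move=> F F0 mF ndF; rewrite -Il.
  + apply: eq_integral => w _; rewrite monotone_convergence//.
    by move=> n; exact: mk.
  + by move=> n w; apply: integral_ge0.
  + by move=> n; exact: measurable_integral_kernel.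
  + move=> w a b ab; apply: ge0_le_integral => //.
    * exact: mk.
    * exact: mk.
    * by move=> u _; exact: ndF.
Qed.

(** Both sides are monotone functionals of [F], and on the indicator of a rectangle [B] times [A]
    their equality is the hypothesis on [P]; rectangles form a generating pi-system. *)
Lemma disintegration (E : set T) (F : S * Y -> \bar R) :
  measurable E ->
  (forall B A, measurable B -> measurable A ->
    P (E `&` (W @^-1` B `&` X @^-1` A)) =
    \int[P]_(w in E `&` W @^-1` B) L (W w) A) ->
  (forall z, 0 <= F z) -> measurable_fun setT F ->
  \int[P]_(w in E) F (W w, X w) =
  \int[P]_(w in E) \int[L (W w)]_u F (W w, u).
Proof.
move=> mE H F0 mF.
have mWX : measurable_fun setT (fun w => (W w, X w)).
  exact: measurable_fun_pair.
have hJ := monotone_functional_comp (monotone_functional_integral P mE) mWX.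
apply/esym.
apply: (eq_monotone_functional (monotone_functional_kernel mE) hJ
  (measurable_prod_measurableType _ _) _ (g := fun=> setT)) => //.
- move=> _ _ [A1 mA1 [B1 mB1 <-]] [A2 mA2 [B2 mB2 <-]].
  rewrite -setXI; exists (A1 `&` A2); first exact: measurableI.
  by exists (B1 `&` B2) => //; exact: measurableI.
- by move=> _; exists setT => //; exists setT => //; rewrite setXTT.
- by rewrite bigcup_const.
- move=> _; rewrite [ltLHS](_ : _ = \int[P]_(w in E) 1); last first.
    by apply: eq_integral => w _; rewrite /= indicT.
  by rewrite integral_cst// mul1e (le_lt_trans (probability_le1 P mE)) ?ltry.
- move=> _ [B mB [A mA <-]].
  have mWB : measurable (W @^-1` B) by rewrite -[X in measurable X]setTI; exact: mW.
  have mXA : measurable (X @^-1` A) by rewrite -[X in measurable X]setTI; exact: mX.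
  transitivity (\int[P]_(w in E `&` W @^-1` B) L (W w) A).
    rewrite [RHS]integral_mkcondr; apply: eq_integral => w _.
    rewrite patchE.
    have -> : (w \in W @^-1` B) = (W w \in B) by apply/idP/idP; rewrite !inE.
    case: ifPn => wB.
      transitivity (\int[L (W w)]_u (\1_A u)%:E).
        apply: eq_integral => u _ /=; rewrite !indicE in_setX/= wB//.
      by rewrite integral_indic// setIT.
    by rewrite integral0_eq// => u _; rewrite /= indicE in_setX/= (negbTE wB).
  rewrite -H//.
  transitivity (\int[P]_(w in E) (\1_(W @^-1` B `&` X @^-1` A) w)%:E).
    rewrite integral_indic//; last exact: measurableI.
    by rewrite setIC.
  apply: eq_integral => w _; rewrite /= !indicE in_setX/= in_setI.
  by congr ((_ && _)%:R)%:E; apply/idP/idP; rewrite !inE.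
Qed.

End disintegration.

(** * The functional equation for the density *)

Section real_calculus.
Context (R : realType).
Implicit Types (f g h : R -> R).

Lemma is_derive_affine (k l t : R) : is_derive t 1 (fun u : R => k * u + l) k.
Proof.
have h := is_deriveD (is_deriveM (is_derive_cst k t 1) (is_derive_id t 1))
  (is_derive_cst l t 1).
by apply: is_derive_eq; rewrite /GRing.scale/=; ring.
Qed.

(** The arguments of [f] in [joint3] are Moebius functions of [x], and so are the curves along which
    [theta3] is differentiated later. *)
Lemma is_derive_mobius (p q r s t : R) : r * t + s != 0 ->
  is_derive t 1 (fun u : R => (p * u + q) / (r * u + s))
    ((p * s - q * r) / (r * t + s) ^+ 2).
Proof.
move=> rs0.
have h := is_deriveM (is_derive_affine p q t)
  (@is_deriveV _ (fun u => r * u + s) t _ _ rs0 (is_derive_affine r s t)).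
by apply: is_derive_eq; rewrite /GRing.scale/=; field.
Qed.

Lemma is_derive_unique f (t d1 d2 : R) :
  is_derive t 1 f d1 -> is_derive t 1 f d2 -> d1 = d2.
Proof. by move=> [_ <-] [_ <-]. Qed.

Lemma is_derive_continuous f (t d : R) : is_derive t 1 f d ->
  {for t, continuous f}.
Proof. by move=> [df _]; exact/differentiable_continuous/derivable1_diffP. Qed.

Lemma is_derive0_itv f (l r : R) :
  (forall t, l < t < r -> is_derive t 1 f 0) ->
  forall s t, l < s < r -> l < t < r -> f s = f t.
Proof.
move=> df s t; wlog st : s t / s <= t.
  move=> H hs ht; have [st|/ltW ts] := leP s t; first exact: H.
  by apply/esym/H.
move=> /andP[ls sr] /andP[lt tr].
have [x|x|c _] := @MVT_segment _ f (fun=> 0) s t st.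
- by rewrite in_itv/= => /andP[sx xt]; apply: df; rewrite (lt_trans ls)// (lt_trans xt).
- apply: derivable_within_continuous => u; rewrite in_itv/= => /andP[su ut].
  by case: (df u _) => //; rewrite (lt_le_trans ls)// (le_lt_trans ut).
- by rewrite mul0r => /eqP; rewrite subr_eq0 => /eqP.
Qed.

Lemma primitive_itv h (l r : R) : l < r ->
  (forall t, l <= t <= r -> {for t, continuous h}) ->
  exists H : R -> R, forall t, l < t < r -> is_derive t 1 H (h t).
Proof.
move=> lr ch; exists (fun x => \int[lebesgue_measure]_(t in `[l, x]) h t)%R.
move=> t /andP[lt tr].
have hi : lebesgue_measure.-integrable `[l, r] (EFin \o h).
  apply: continuous_compact_integrable; first exact: segment_compact.
  by apply: continuous_in_subspaceT => x; rewrite inE/= in_itv/=; exact: ch.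
have [|dH HE] := continuous_FTC1_closed tr hi lt.
  by apply: ch; rewrite !ltW.
by apply: DeriveDef => //; rewrite -HE derive1E.
Qed.

End real_calculus.

(** * From the product identity for [joint3] to the explicit form of [f] *)

Section functional_equation.
Context (R : realType) (f : R -> R).

Definition theta (t : R) : R := t ^+ 2 * (derive1 f t / f t).

Definition theta3 (a b c : R) : R :=
  (b * c) ^+ 2 * theta a + c ^+ 2 * theta b + theta c.

(* Up to the factor [1 / (y z)], the density of [(X_3, Z_3, Z_2)] at
   [(x, y, z)]; the three arguments of [f] are the values of [gamma_0],
   [gamma_1] and [gamma_2]. *)
Definition joint3 (x y z : R) : R :=
  f ((x * z + 1 + y) / (y * z)) * f (z * (x * z + 1) / (x * z + 1 + y)) *
  f (x * y / (x * z + 1)).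

Hypothesis derivable_f : forall t, 0 < t -> derivable f t 1.
Hypothesis continuous_f' : forall t, 0 < t -> {for t, continuous (derive1 f)}.
Hypothesis f_ge0 : forall t, 0 <= f t.
Hypothesis joint3_mul : forall x x' y z z', 0 < x -> 0 < x' -> 0 < y ->
  0 < z -> 0 < z' ->
  joint3 x y z * joint3 x' y z' = joint3 x' y z * joint3 x y z'.

Let is_derive_f (t : R) : 0 < t -> is_derive t 1 f (derive1 f t).
Proof. by move=> /derivable_f df; rewrite derive1E; exact: derivableP. Qed.

(** The coordinates are the values [a], [b], [c] of the three variables. The arguments of [f] then
    have [x]-derivatives [1 / y], [1 / (a ^+ 2 * y)] and [1 / ((a * b) ^+ 2 * y)]; multiplied by
    [x ^+ 2 * y], with [x = a * b * c], the logarithmic derivative is [theta3 a b c]. *)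
Lemma is_derive_joint3 (a b c : R) : 0 < a -> 0 < b -> 0 < c ->
  0 < f a -> 0 < f b -> 0 < f c ->
  let x := a * b * c in let z := b + a^-1 in let y := c * z + (a * b)^-1 in
  joint3 x y z = f a * f b * f c /\
  is_derive x 1 (fun t => joint3 t y z)
    (f a * f b * f c * (theta3 a b c / (x ^+ 2 * y))).
Proof.
move=> a0 b0 c0 fa0 fb0 fc0 x z y.
have z0 : 0 < z by rewrite addr_gt0// invr_gt0.
have y0 : 0 < y by rewrite addr_gt0 ?mulr_gt0// invr_gt0 mulr_gt0.
have [[aN bN] [zN yN]] : (a != 0 /\ b != 0) /\ (z != 0 /\ y != 0).
  by rewrite !gt_eqF.
have [cN [fa [fb fc]]] : c != 0 /\ f a != 0 /\ f b != 0 /\ f c != 0.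
  by rewrite !gt_eqF.
have az : a * z = a * b + 1 by rewrite /z; field.
have h1 : x * z + 1 = a * b * y.
  by rewrite /y /x; field; rewrite aN bN.
have h0 : x * z + 1 + y = a * z * y by rewrite h1 az; ring.
have e0 : (x * z + 1 + y) / (y * z) = a by rewrite h0; field; rewrite zN yN.
have e1 : z * (x * z + 1) / (x * z + 1 + y) = b.
  by rewrite h0 h1; field; rewrite aN zN yN.
have e2 : x * y / (x * z + 1) = c by rewrite h1 /x; field; rewrite aN bN yN.
split; first by rewrite /joint3 e0 e1 e2.
have n0 : 0 * x + y * z != 0 by rewrite mul0r add0r mulf_neq0.
have n1 : z * x + (1 + y) != 0.
  by rewrite (mulrC z) addrA h0 !mulf_neq0.
have n2 : z * x + 1 != 0 by rewrite (mulrC z) h1 !mulf_neq0.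
have D0 : is_derive x 1 (fun t => f ((t * z + 1 + y) / (y * z))) (derive1 f a * y^-1).
  have -> : (fun t => f ((t * z + 1 + y) / (y * z))) =
      f \o (fun t => (z * t + (1 + y)) / (0 * t + y * z)).
    by apply/funext => t /=; congr (f (_ / _)); ring.
  have -> : y^-1 = (z * (y * z) - (1 + y) * 0) / (0 * x + y * z) ^+ 2.
    by rewrite mul0r add0r mulr0 subr0; field; rewrite zN yN.
  apply: is_derive1_comp; last exact: is_derive_mobius.
  rewrite (_ : (_ / _) = a); first exact: is_derive_f.
  by rewrite -[RHS]e0; congr (_ / _); ring.
have D1 : is_derive x 1 (fun t => f (z * (t * z + 1) / (t * z + 1 + y)))
    (derive1 f b * (a ^+ 2 * y)^-1).
  have -> : (fun t => f (z * (t * z + 1) / (t * z + 1 + y))) =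
      f \o (fun t => (z * z * t + z) / (z * t + (1 + y))).
    by apply/funext => t /=; congr (f (_ / _)); ring.
  have -> : (a ^+ 2 * y)^-1 =
      (z * z * (1 + y) - z * z) / (z * x + (1 + y)) ^+ 2.
    rewrite (_ : z * x + (1 + y) = a * z * y); last by rewrite -h0; ring.
    by field; rewrite aN zN yN.
  apply: is_derive1_comp; last exact: is_derive_mobius.
  rewrite (_ : (_ / _) = b); first exact: is_derive_f.
  by rewrite -[RHS]e1; congr (_ / _); ring.
have D2 : is_derive x 1 (fun t => f (t * y / (t * z + 1)))
    (derive1 f c * ((a * b) ^+ 2 * y)^-1).
  have -> : (fun t => f (t * y / (t * z + 1))) =
      f \o (fun t => (y * t + 0) / (z * t + 1)).
    by apply/funext => t /=; congr (f (_ / _)); ring.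
  have -> : ((a * b) ^+ 2 * y)^-1 = (y * 1 - 0 * z) / (z * x + 1) ^+ 2.
    by rewrite (mulrC z x) h1; field; rewrite aN bN yN.
  apply: is_derive1_comp; last exact: is_derive_mobius.
  rewrite (_ : (_ / _) = c); first exact: is_derive_f.
  by rewrite -[RHS]e2; congr (_ / _); ring.
have h := is_deriveM (is_deriveM D0 D1) D2.
apply: is_derive_eq; rewrite fctE e0 e1 e2 /GRing.scale/= /theta3 /theta /x.
by field; rewrite aN bN cN fa fb fc yN.
Qed.

(** By [joint3_mul] the functions [joint3 t y z] and [joint3 t y z'] of [t] are proportional, so
    their logarithmic derivatives at [x] agree; the common factor [x ^+ 2 * y] then cancels. *)
Lemma theta3_invariant (a b c a' b' c' : R) :
  0 < a -> 0 < b -> 0 < c -> 0 < a' -> 0 < b' -> 0 < c' ->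
  0 < f a -> 0 < f b -> 0 < f c -> 0 < f a' -> 0 < f b' -> 0 < f c' ->
  a * b * c = a' * b' * c' ->
  c * (b + a^-1) + (a * b)^-1 = c' * (b' + a'^-1) + (a' * b')^-1 ->
  theta3 a b c = theta3 a' b' c'.
Proof.
move=> a0 b0 c0 a'0 b'0 c'0 fa fb fc fa' fb' fc' ex ey.
have [Q1 D1] := is_derive_joint3 a0 b0 c0 fa fb fc.
have [Q2 D2] := is_derive_joint3 a'0 b'0 c'0 fa' fb' fc'.
rewrite -ex -ey in Q2 D2.
move: Q1 D1 Q2 D2.
set x := a * b * c; set z := b + a^-1; set z' := b' + a'^-1.
set y := c * z + _ => Q1 D1 Q2 D2.
have x0 : 0 < x by rewrite !mulr_gt0.
have z0 : 0 < z by rewrite addr_gt0// invr_gt0.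
have z'0 : 0 < z' by rewrite addr_gt0// invr_gt0.
have y0 : 0 < y by rewrite addr_gt0 ?mulr_gt0// invr_gt0 mulr_gt0.
have E1 := is_deriveM D1 (is_derive_cst (joint3 x y z') x 1).
have E2 := is_deriveM (is_derive_cst (joint3 x y z) x 1) D2.
have E : \forall t \near x, ((fun t => joint3 t y z) * cst (joint3 x y z')) t =
    (cst (joint3 x y z) * (fun t => joint3 t y z')) t.
  near=> t; apply: joint3_mul => //; near: t; exact: lt_nbhsr.
have := is_derive_unique (near_eq_is_derive E E1) E2.
rewrite /GRing.scale/= !(mulr0, addr0, add0r) Q1 Q2 => H.
have {}H : theta3 a b c / (x ^+ 2 * y) = theta3 a' b' c' / (x ^+ 2 * y).
  have Q0 : f a * f b * f c != 0 by rewrite !mulf_neq0 ?gt_eqF.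
  have Q0' : f a' * f b' * f c' != 0 by rewrite !mulf_neq0 ?gt_eqF.
  apply: (mulfI (mulf_neq0 Q0 Q0')); move: H.
  set u := theta3 a b c / _; set v := theta3 a' b' c' / _ => H.
  transitivity (f a' * f b' * f c' * (f a * f b * f c * u)); first by ring.
  by rewrite H; ring.
apply: (mulIf _ H); rewrite invr_eq0 mulf_neq0 ?expf_neq0// gt_eqF//.
Unshelve. all: by end_near. Qed.

Lemma near_pos (t : R) : 0 < t -> 0 < f t ->
  \forall s \near t, 0 < s /\ 0 < f s.
Proof.
move=> t0 ft0.
have cf := is_derive_continuous (is_derive_f t0).
near=> s; split; near: s; first exact: lt_nbhsr.
exact: (cvgr_gt _ cf).
Unshelve. all: by end_near. Qed.

Lemma continuous_theta (t : R) : 0 < t -> 0 < f t -> {for t, continuous theta}.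
Proof.
move=> t0 ft0; apply: cvgM; first exact: exprn_continuous.
apply: cvgM; first exact: continuous_f'.
apply: cvgV; first by rewrite gt_eqF.
exact: is_derive_continuous (is_derive_f t0).
Qed.

(* Integrating over [p = 1 / a] the invariance of [theta3], with [x] and [c]
   fixed, expresses [theta c] through primitives of continuous functions. *)
Lemma derivable_theta (t : R) : 0 < t -> 0 < f t -> derivable theta t 1.
Proof.
move=> t0 ft0; have tN : t != 0 by rewrite gt_eqF.
have [e /= e0 eU] := near_pos t0 ft0.
pose l := t - e / 2; pose r := t + e / 2.
have lU s : l <= s <= r -> 0 < s /\ 0 < f s.
  move=> /andP[ls sr]; apply: eU; rewrite /= ltr_distlC; apply/andP.
  by rewrite /l /r in ls sr; split; lra.
have lr : l < r by rewrite /l /r; lra.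
have lt' : l < t by rewrite /l; lra.
have tr : t < r by rewrite /r; lra.
have l0 : 0 < l by case: (lU l) => //; rewrite lexx ltW.
have r0 : 0 < r := lt_trans l0 lr.
have itvU s : s \in `]l, r[ -> 0 < s /\ 0 < f s.
  by rewrite in_itv/= => /andP[/ltW ls /ltW sr]; apply: lU; rewrite ls sr.
(* The base point is [a = b = c = t], with product [t ^+ 3]. Along [a * b * c = x] and with
   [p = 1 / a] one has [b * c = x * p] and [b = x * p / c], so the first term of [theta3] is
   [h p]. *)
pose x := t ^+ 3.
have x0 : 0 < x by rewrite exprn_gt0.
have xN : x != 0 by rewrite gt_eqF.
pose h p := (x * p) ^+ 2 * theta p^-1.
have [Th dTh] : exists Th : R -> R,
    forall s, s \in `]l, r[ -> is_derive s 1 Th (theta s).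
  have [Th dTh] := @primitive_itv _ theta l r lr
    (fun s hs => let: conj s0 fs0 := lU s hs in continuous_theta s0 fs0).
  by exists Th => s; rewrite in_itv; exact: dTh.
have [K dK] : exists K : R -> R,
    forall p, p^-1 \in `]l, r[ -> is_derive p 1 K (h p).
  have lr' : r^-1 < l^-1 by rewrite ltf_pV2.
  have [p hp|K dK] := @primitive_itv _ h _ _ lr'.
    have p0 : 0 < p by case/andP: hp => + _; apply: lt_le_trans; rewrite invr_gt0.
    have [p'0 fp'0] : 0 < p^-1 /\ 0 < f p^-1.
      apply: lU; case/andP: hp => h1 h2.
      by rewrite -[l]invrK -[r]invrK !lef_pV2 ?posrE ?invr_gt0// h1 h2.
    have cV : {for p, continuous (@GRing.inv R)} by apply: inv_continuous; rewrite gt_eqF.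
    apply: cvgM.
      apply: cvgM; (apply: cvgM; [exact: cvg_cst|exact: cvg_id]).
    exact: (continuous_comp cV (continuous_theta p'0 fp'0)).
  exists K => p hp; apply: dK; have [p'0 _] := itvU _ hp.
  move: hp; rewrite in_itv/= => /andP[h1 h2].
  rewrite -[p]invrK !ltf_pV2 ?posrE//; first by rewrite h1 h2.
(* In these coordinates the second invariant is [(p + 1 / x) * (c + x) - 1]. Hence [p' p c] is the
   value of [1 / a] for which third coordinate [t] gives the same invariants as [p] and [c]: it
   solves [(p' + 1 / x) * (t + x) = (p + 1 / x) * (c + x)]. *)
pose n := (t + x)^-1.
have tx0 : 0 < t + x by rewrite addr_gt0.
have n0 : 0 < n by rewrite invr_gt0.
have nE : n * t + n * x = 1 by rewrite -mulrDr mulVf// gt_eqF.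
pose p' (p c : R) := (n * p + n / x) * c + (n * x * p + (n * x - 1) / x).
pose p0 := t^-1.
have p'E p : p' p t = p.
  rewrite /p'; transitivity ((n * t + n * x) * p + (n * t + n * x - 1) / x).
    by field.
  by rewrite nE subrr mul0r mul1r addr0.
have [V /= [/nbhs_ballP[e1 /= e10 V1] /nbhs_ballP[e2 /= e20 V2]] Hd] :
    \forall z \near (p0, t), [/\ z.1^-1 \in `]l, r[,
    x * z.1 / z.2 \in `]l, r[, z.2 \in `]l, r[, (p' z.1 z.2)^-1 \in `]l, r[ &
    x * p' z.1 z.2 / t \in `]l, r[].
  have tI : t \in `]l, r[ by rewrite in_itv/= lt' tr.
  have c1 : z.1 @[z --> (p0, t)] --> p0 by exact: cvg_fst.
  have c2 : z.2 @[z --> (p0, t)] --> t by exact: cvg_snd.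
  have cp : p' z.1 z.2 @[z --> (p0, t)] --> p0.
    rewrite -[X in _ --> X](p'E p0); apply: cvgD.
      apply: cvgM => //; apply: cvgD; last exact: cvg_cst.
      by apply: cvgM => //; exact: cvg_cst.
    apply: cvgD; last exact: cvg_cst.
    by apply: cvgM => //; exact: cvg_cst.
  have p0N : p0 != 0 by rewrite invr_eq0.
  have cV (g : R * R -> R) : g z @[z --> (p0, t)] --> p0 ->
      (g z)^-1 @[z --> (p0, t)] --> t.
    by move=> cg; rewrite -[X in _ --> X]invrK; exact: cvgV.
  have xp : x * p0 / t = t by rewrite /x /p0; field.
  have d1 := cV _ c1.
  have d4 := cV _ cp.
  have d2 : x * z.1 / z.2 @[z --> (p0, t)] --> t.
    rewrite -[X in _ --> X]xp; apply: cvgM; last exact: cvgV.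
    by apply: cvgM => //; exact: cvg_cst.
  have d5 : x * p' z.1 z.2 / t @[z --> (p0, t)] --> t.
    rewrite -[X in _ --> X]xp; apply: cvgM; last exact: cvg_cst.
    by apply: cvgM => //; exact: cvg_cst.
  near=> z; split; near: z.
  - exact: (d1 _ (near_in_itvoo tI)).
  - exact: (d2 _ (near_in_itvoo tI)).
  - exact: (c2 _ (near_in_itvoo tI)).
  - exact: (d4 _ (near_in_itvoo tI)).
  - exact: (d5 _ (near_in_itvoo tI)).
pose dl := Num.min e1 e2.
have {}Hd p c : `|p0 - p| < dl -> `|t - c| < dl -> [/\ p^-1 \in `]l, r[,
    x * p / c \in `]l, r[, c \in `]l, r[, (p' p c)^-1 \in `]l, r[ &
    x * p' p c / t \in `]l, r[].
  rewrite /dl lt_min lt_min => /andP[hp _] /andP[_ hc].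
  by apply: (Hd (p, c)); split; [exact: V1|exact: V2].
have dl0 : 0 < dl by rewrite /dl lt_min e10 e20.
(* A primitive in [p] of all the terms of the invariance other than [theta c] and [theta t]. It
   depends on [c] only through explicit functions and the primitives [K] and [Th], hence is
   derivable in [c] although [theta] is not yet known to be. *)
pose St p c := (n * c + n * x)^-1 * K (p' p c) +
  (t ^+ 3 / x * (n * c + n * x)^-1) * Th (x * p' p c / t) - K p -
  c ^+ 3 / x * Th (x * p / c).
have dSt p : `|p0 - p| < dl -> derivable (St p) t 1.
  move=> hp; have [hp1 hp2 _ hp4 hp5] : [/\ p^-1 \in `]l, r[,
    x * p / t \in `]l, r[, t \in `]l, r[, (p' p t)^-1 \in `]l, r[ &
    x * p' p t / t \in `]l, r[] by apply: Hd => //; rewrite subrr normr0.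
  have m0 : n * t + n * x != 0 by rewrite nE oner_neq0.
  have dm := is_derive_affine n (n * x) t.
  have dp' : is_derive t 1 (p' p) _ := is_derive_affine _ _ t.
  have dxp' : is_derive t 1 (fun c => x * p' p c / t) _ :=
    is_deriveM (is_deriveM (is_derive_cst x t 1) dp') (is_derive_cst t^-1 t 1).
  have dV := @is_deriveV _ (fun c => n * c + n * x) t _ _ m0 dm.
  have dKp := @is_derive1_comp _ K (p' p) t _ _ (dK _ hp4) dp'.
  have dTp := @is_derive1_comp _ Th (fun c => x * p' p c / t) t _ _
    (dTh _ hp5) dxp'.
  have dxpc : is_derive t 1 (fun c => x * p / c) _ :=
    is_deriveM (is_derive_cst (x * p) t 1)
      (@is_deriveV _ id t _ _ tN (is_derive_id t 1)).
  have dTx := @is_derive1_comp _ Th (fun c => x * p / c) t _ _ (dTh _ hp2) dxpc.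
  have D := is_deriveB (is_deriveB (is_deriveD (is_deriveM dV dKp)
    (is_deriveM (is_deriveM (is_derive_cst (t ^+ 3 / x) t 1) dV) dTp))
      (is_derive_cst (K p) t 1))
    (is_deriveM (is_deriveM (is_deriveX 3 (is_derive_id t 1))
      (is_derive_cst x^-1 t 1)) dTx).
  case: D => D _; apply: near_eq_derivable D.
  by near=> c; rewrite /St !fctE.
pose p1 := p0 + dl / 2.
have hp0 : `|p0 - p0| < dl by rewrite subrr normr0.
have hp1 : `|p0 - p1| < dl.
  by rewrite /p1 opprD addNKr normrN ger0_norm; lra.
have dRHS : derivable (fun c => theta t + (St p1 c - St p0 c) / (p1 - p0)) t 1.
  apply: derivableD; first exact: derivable_cst.
  by apply: derivableM; [apply: derivableB; exact: dSt|exact: derivable_cst].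
apply: near_eq_derivable dRHS.
near=> c.
have hc : `|t - c| < dl by near: c; exact: (nbhsx_ballx t dl dl0).
pose m := n * c + n * x.
have [_ _ /itvU[c0 fc0] _ _] := Hd p0 c hp0 hc.
have cN : c != 0 by rewrite gt_eqF.
have m0 : m != 0 by rewrite gt_eqF// addr_gt0// mulr_gt0.
have p'm p : p' p c = m * p + (m - 1) / x by rewrite /p' /m; field.
(* The invariance says that the derivative of [S] in [p] is 0. Comparing [p0] and [p1] then solves
   for [theta c]. *)
pose S p := St p c - (theta c - theta t) * p.
have dS p : p0 - dl < p < p0 + dl -> is_derive p 1 S 0.
  move=> hp; have hp' : `|p0 - p| < dl by rewrite ltr_distlC.
  have [hp1' hp2 hp3 hp4 hp5] := Hd p c hp' hc.
  have dp' : is_derive p 1 (p'^~ c) m.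
    rewrite (_ : p'^~ c = fun p => m * p + (m - 1) / x); last exact/funext.
    exact: is_derive_affine.
  have dxp' : is_derive p 1 (fun p => x * p' p c / t) _ :=
    is_deriveM (is_deriveM (is_derive_cst x p 1) dp') (is_derive_cst t^-1 p 1).
  have dKp := @is_derive1_comp _ K (p'^~ c) p _ _ (dK _ hp4) dp'.
  have dTp := @is_derive1_comp _ Th (fun p => x * p' p c / t) p _ _
    (dTh _ hp5) dxp'.
  have dxpc : is_derive p 1 (fun p => x * p / c) _ :=
    is_deriveM (is_deriveM (is_derive_cst x p 1) (is_derive_id p 1))
      (is_derive_cst c^-1 p 1).
  have dTx := @is_derive1_comp _ Th (fun p => x * p / c) p _ _ (dTh _ hp2) dxpc.
  have D := is_deriveB (is_deriveB (is_deriveB (is_deriveD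
    (is_deriveM (is_derive_cst m^-1 p 1) dKp)
    (is_deriveM (is_derive_cst (t ^+ 3 / x * m^-1) p 1) dTp)) (dK _ hp1'))
    (is_deriveM (is_derive_cst (c ^+ 3 / x) p 1) dTx))
    (is_deriveM (is_derive_cst (theta c - theta t) p 1) (is_derive_id p 1)).
  suff E : h (p' p c) + t ^+ 2 * theta (x * p' p c / t) + theta t =
      h p + c ^+ 2 * theta (x * p / c) + theta c.
    apply: (is_derive_eq D); rewrite /GRing.scale/= !fctE.
    have -> : theta c = h (p' p c) + t ^+ 2 * theta (x * p' p c / t) + theta t
      - h p - c ^+ 2 * theta (x * p / c) by rewrite E; ring.
    by field; rewrite ?tN ?cN ?xN ?m0.
  have [a0 fa] := itvU _ hp1'; have [b0 fb] := itvU _ hp2.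
  have [a'0 fa'] := itvU _ hp4; have [b'0 fb'] := itvU _ hp5.
  have pN : p != 0 by rewrite -invr_eq0 gt_eqF.
  have p'N : p' p c != 0 by rewrite -invr_eq0 gt_eqF.
  have mE : m * (t + x) = c + x by rewrite /m /n; field; rewrite gt_eqF.
  have := @theta3_invariant (p' p c)^-1 (x * p' p c / t) t p^-1 (x * p / c) c.
  rewrite /theta3 /h.
  have -> : x * p' p c / t * t = x * p' p c by field.
  have -> : x * p / c * c = x * p by field.
  apply => //; rewrite ?invrK.
  - by field; rewrite ?tN ?cN ?pN ?p'N.
  - suff : (p' p c + x^-1) * (t + x) - 1 = (p + x^-1) * (c + x) - 1.
      move=> H; apply: etrans (etrans H _).
        by field; rewrite ?tN ?xN ?p'N.
      by field; rewrite ?cN ?xN ?pN.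
    rewrite p'm -mE; field.
    exact: xN.
have : S p0 = S p1.
  apply: (is_derive0_itv dS); rewrite /p1; apply/andP; split; lra.
rewrite /S => H.
have p10 : p1 - p0 != 0 by rewrite /p1 addrC addKr gt_eqF// divr_gt0.
have -> : St p1 c - St p0 c = (theta c - theta t) * (p1 - p0).
  by apply/eqP; rewrite -subr_eq0; apply/eqP; move/eqP: H;
     rewrite -subr_eq0 => /eqP H; rewrite -[RHS]oppr0 -[in RHS]H; ring.
by rewrite mulfK// addrC subrK.
Unshelve. all: by end_near. Qed.

Let is_derive_theta (t : R) : 0 < t -> 0 < f t ->
  is_derive t 1 theta (derive1 theta t).
Proof.
by move=> t0 ft0; rewrite derive1E; exact: derivableP (derivable_theta t0 ft0).
Qed.

(* The derivative of [theta3] along a curve where it is constant. *)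
Lemma theta_ode (a b c : R) : 0 < a -> 0 < b -> 0 < c ->
  0 < f a -> 0 < f b -> 0 < f c ->
  b * (b * c + 1) * (a * derive1 theta a - 2 * theta a) +
  2 * c * (a * b + 1) * theta b -
  (2 * b * c + 1 + a * b ^+ 2 * c) * derive1 theta b +
  (a * b + 1) * derive1 theta c = 0.
Proof.
move=> a0 b0 c0 fa fb fc.
have [aN [bN cN]] : a != 0 /\ b != 0 /\ c != 0 by rewrite !gt_eqF.
have ab1 : a * b + 1 != 0 by rewrite gt_eqF// addr_gt0// mulr_gt0.
pose x := a * b * c; pose y := b * c + c / a + (a * b)^-1.
have x0 : 0 < x by rewrite !mulr_gt0.
have xN : x != 0 by rewrite gt_eqF.
have xcE : x + c = c * (a * b + 1) by rewrite /x; ring.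
have xycE : x * y - c = b * c ^+ 2 * (a * b + 1).
  by rewrite /x /y; field; rewrite aN bN.
have xy1 : x * (1 + y) = c * (a * b + 1) * (1 + b * c).
  by rewrite /x /y; field; rewrite aN bN.
(* The curve keeps [x] and [y] fixed and is parametrised by the third coordinate [s]; [A s] is the
   product of the last two coordinates, obtained by solving [A + s * A / x + s / x = y], and then
   [a' = x / A] and [b' = A / s]. *)
pose A s := (-1 * s + x * y) / (1 * s + x).
pose a' s := (x * s + x * x) / (-1 * s + x * y).
pose b' s := A s / s.
have n1 : 1 * c + x != 0 by rewrite mul1r addrC xcE mulf_neq0.
have n2 : -1 * c + x * y != 0.
  by rewrite mulN1r addrC xycE !mulf_neq0// expf_neq0.
have Ac : A c = b * c.
  rewrite /A mulN1r mul1r addrC xycE [c + x]addrC xcE.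
  by field; rewrite cN ab1.
have ac : a' c = a.
  rewrite /a' mulN1r [- c + _]addrC xycE -mulrDr [c + x]addrC xcE /x.
  by field; rewrite bN cN ab1.
have bc : b' c = b by rewrite /b' Ac mulfK.
have dA : is_derive c 1 A (- (b * c + 1) / (c * (a * b + 1))).
  have D := @is_derive_mobius _ (-1) (x * y) 1 x c n1.
  apply: is_derive_eq; rewrite mul1r [c + x]addrC xcE mulr1 mulN1r -opprD.
  by rewrite -{1}[x]mulr1 -mulrDr xy1; field; rewrite cN ab1.
have da : is_derive c 1 a' (a * (b * c + 1) / (b * c ^+ 2 * (a * b + 1))).
  have D := @is_derive_mobius _ x (x * x) (-1) (x * y) c n2.
  apply: is_derive_eq; rewrite mulN1r [- c + _]addrC xycE.
  rewrite (_ : _ - _ = x * (x * (1 + y))); last by ring.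
  by rewrite xy1 /x; field; rewrite bN cN ab1.
have db : is_derive c 1 b' _ := is_deriveM dA
  (@is_deriveV _ id c _ _ cN (is_derive_id c 1)).
have ta : is_derive (a' c) 1 theta (derive1 theta a).
  by rewrite ac; exact: is_derive_theta.
have tb : is_derive (b' c) 1 theta (derive1 theta b).
  by rewrite bc; exact: is_derive_theta.
have dta := @is_derive1_comp _ theta a' c _ _ ta da.
have dtb := @is_derive1_comp _ theta b' c _ _ tb db.
have D := is_deriveD (is_deriveD (is_deriveM (is_deriveX 2 dA) dta)
  (is_deriveM (is_deriveX 2 (is_derive_id c 1)) dtb)) (is_derive_theta c0 fc).
have : \forall s \near c, theta3 a b c =
    (A ^+ 2 * (theta \o a') + id ^+ 2 * (theta \o b') + theta) s.
  have ca : a' s @[s --> c] --> a.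
    by rewrite -[X in _ --> X]ac; exact: (is_derive_continuous da).
  have cb : b' s @[s --> c] --> b.
    by rewrite -[X in _ --> X]bc; exact: (is_derive_continuous db).
  have cA : A s @[s --> c] --> b * c.
    by rewrite -[X in _ --> X]Ac; exact: (is_derive_continuous dA).
  have bc0 : 0 < b * c by rewrite mulr_gt0.
  near=> s.
  have [s0 fs] : 0 < s /\ 0 < f s by near: s; exact: near_pos.
  have [as0 fas] : 0 < a' s /\ 0 < f (a' s).
    by near: s; exact: (ca _ (near_pos a0 fa)).
  have [bs0 fbs] : 0 < b' s /\ 0 < f (b' s).
    by near: s; exact: (cb _ (near_pos b0 fb)).
  have As0 : 0 < A s by near: s; exact: (cvgr_gt _ cA).
  have sN : s != 0 by rewrite gt_eqF.
  have AN : A s != 0 by rewrite gt_eqF.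
  have sx : s + x != 0 by rewrite gt_eqF// addr_gt0.
  have aA : a' s = x / A s.
    have n3 : -1 * s + x * y != 0.
      by apply: contraNneq AN => E; rewrite /A E mul0r.
    by rewrite /a' /A; field; rewrite !(mul1r, mulN1r, sx, n3)// -mulN1r n3.
  have -> : theta3 a b c = theta3 (a' s) (b' s) s.
    apply: theta3_invariant => //.
      by rewrite aA /b' -/x; field; rewrite sN AN.
    rewrite aA /b'; transitivity y; first by rewrite /y; field; rewrite aN bN.
    have AE : A s * (s + x) = x * y - s.
      by rewrite /A mul1r divfK// mulN1r addrC.
    apply: (mulIf xN); rewrite mulrC -[LHS](subrK s) -AE.
    by field; rewrite sN AN xN.
  rewrite /theta3 !fctE /b' divfK//.
move=> /near_eq_is_derive /(_ (is_derive_cst (theta3 a b c) c 1)).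
move=> /is_derive_unique /(_ D).
rewrite /GRing.scale/= !fctE ac bc Ac => H.
apply: (etrans _ (etrans (congr1 (fun u => (a * b + 1) * u) (esym H))
  (mulr0 _))).
field.
by rewrite bN cN ab1.
Unshelve. all: by end_near. Qed.

(** The constants are computed from [theta] and its derivative at [m] alone, hence are chosen before
    the interval. This uniformity lets the intervals grow later without changing the solution. *)
Lemma local_solution (m : R) : 0 < m -> 0 < f m ->
  exists k al C : R, 0 < C /\
    forall l r, 0 <= l -> l < m -> m < r ->
      (forall t, l < t < r -> 0 < f t) ->
      forall t, l < t < r -> f t = C * expR (k * (t + t^-1) - al * ln t).
Proof.
move=> m0 fm; have mN : m != 0 by rewrite gt_eqF.
have m1 : m ^+ 2 + 1 != 0 by rewrite gt_eqF// ltr_wpDl// sqr_ge0.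
pose th' := derive1 theta m.
pose be := (2 * m ^+ 2 * th' - 2 * m * theta m) / (m * (m ^+ 2 + 1)).
pose al := ((m ^+ 3 - m) * th' - 2 * m ^+ 2 * theta m) / (m * (m ^+ 2 + 1)).
pose k := be / 2.
pose phi t := k * (t + t^-1) - al * ln t.
exists k, al, (f m * expR (- phi m)); split; first by rewrite mulr_gt0// expR_gt0.
move=> l r l0 lm mr fpos.
have tpos t : l < t < r -> 0 < t by move=> /andP[lt _]; exact: le_lt_trans lt.
have mI : l < m < r by rewrite lm mr.
(* In [theta_ode] with [b = c = m] and [a = t], the terms other than [t * theta' - 2 * theta] are
   affine in [t]; [al] and [be] are the resulting coefficients. *)
have omega t : l < t < r -> t * derive1 theta t - 2 * theta t = al * t + be.
  move=> ht; have := theta_ode (tpos _ ht) m0 m0 (fpos _ ht) fm fm.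
  rewrite -/th' => H; apply: (mulfI mN); apply: (mulfI m1).
  apply/eqP; rewrite -subr_eq0; apply/eqP; rewrite -[RHS]H /al /be.
  by field; rewrite mN m1.
(* Dividing by [t ^+ 2] is the integrating factor: [G] is constant exactly when [theta] solves
   [omega]. *)
pose G t := theta t / t ^+ 2 + al / t + be / 2 / t ^+ 2.
have dG t : l < t < r -> is_derive t 1 G 0.
  move=> ht; have t0 := tpos _ ht; have tN : t != 0 by rewrite gt_eqF.
  have dt := is_derive_theta t0 (fpos _ ht).
  have dV := @is_deriveV _ id t _ _ tN (is_derive_id t 1).
  have t2N : t ^+ 2 != 0 by rewrite expf_neq0.
  have dV2 := @is_deriveV _ (fun t => t ^+ 2) t _ _ t2N (is_deriveX 2 (is_derive_id t 1)).
  have D : is_derive t 1 G _ := is_deriveD (is_deriveD (is_deriveM dt dV2)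
    (is_deriveM (is_derive_cst al t 1) dV))
    (is_deriveM (is_derive_cst (be / 2) t 1) dV2).
  apply: (is_derive_eq D); rewrite /GRing.scale/=.
  have -> : derive1 theta t = (al * t + be + 2 * theta t) / t.
    by rewrite -(omega _ ht) addrNK mulrC mulKf.
  by field.
have thE t : l < t < r -> theta t = G m * t ^+ 2 - al * t - be / 2.
  move=> ht; rewrite (is_derive0_itv dG mI ht) /G; field.
  by rewrite gt_eqF// (tpos _ ht).
have th'E t : l < t < r -> derive1 theta t = 2 * G m * t - al.
  move=> ht; have tN : t != 0 by rewrite gt_eqF// (tpos _ ht).
  apply: (mulfI tN); rewrite -[LHS](subrK (2 * theta t)) (omega _ ht) (thE _ ht).
  by field.
(* So far the leading coefficient of [theta] is free. The equation with [a = b = m] and a third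
   coordinate [s] different from [m] ties it to the constant term. *)
have Gk : G m = k.
  pose s := (m + r) / 2.
  have sI : l < s < r by rewrite /s; apply/andP; split; lra.
  have s0 := tpos _ sI.
  have := theta_ode m0 m0 s0 fm fm (fpos _ sI).
  rewrite !thE// !th'E// => H.
  have sm : s - m != 0 by rewrite gt_eqF// subr_gt0 /s; lra.
  apply: (mulIf sm); apply/eqP; rewrite -subr_eq0; apply/eqP.
  by rewrite /k -[RHS](mul0r 2^-1) -[in RHS]H; field.
(* The logarithmic derivative of [f] is [theta t / t ^+ 2 = k * (1 - t ^- 2) - al / t], which is the
   derivative of [phi]. *)
pose H t := f t * expR (- phi t).
have dH t : l < t < r -> is_derive t 1 H 0.
  move=> ht; have t0 := tpos _ ht; have tN : t != 0 by rewrite gt_eqF.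
  have dV := @is_deriveV _ id t _ _ tN (is_derive_id t 1).
  have dphi := is_deriveN (is_deriveB (is_deriveM (is_derive_cst k t 1)
    (is_deriveD (is_derive_id t 1) dV))
    (is_deriveM (is_derive_cst al t 1) (is_derive1_ln t0))).
  have dE := @is_derive1_comp _ expR (fun t => - phi t) t _ _
    (is_derive_expR (- phi t)) dphi.
  have D : is_derive t 1 H _ := is_deriveM (is_derive_f t0) dE.
  apply: (is_derive_eq D); rewrite /GRing.scale/=.
  have ft : f t != 0 by rewrite gt_eqF// fpos.
  have -> : derive1 f t = f t * (theta t / t ^+ 2) by rewrite /theta; field; rewrite ft tN.
  by rewrite (thE _ ht) Gk /k; field.
move=> t ht; have := is_derive0_itv dH mI ht.
by rewrite /H => ->; rewrite -mulrA -expRD addNr expR0 mulr1.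
Qed.

(** Inside the interval [f] equals an explicit function that is continuous and positive on the whole
    open half-line; the one-sided limits at an end identify the two values there. The end 0 is
    excluded, since [f] may be singular at it. *)
Lemma itv_boundary_pos (l r : R) : 0 <= l -> l < r ->
  (forall t, l < t < r -> 0 < f t) -> 0 < f r /\ (0 < l -> 0 < f l).
Proof.
move=> l0 lr fpos; pose m := (l + r) / 2.
have mI : l < m < r by rewrite /m; apply/andP; split; lra.
have [lm mr] := andP mI.
have m0 : 0 < m := le_lt_trans l0 lm.
have [k [al [C [C0 fE]]]] := local_solution m0 (fpos _ mI).
pose g t := C * expR (k * (t + t^-1) - al * ln t).
have gpos t : 0 < g t by rewrite mulr_gt0// expR_gt0.
have cg t : 0 < t -> {for t, continuous g}.
  move=> t0; apply: cvgM; first exact: cvg_cst.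
  apply: continuous_comp; last exact: continuous_expR.
  apply: cvgB; apply: cvgM; try exact: cvg_cst.
    apply: cvgD; first exact: cvg_id.
    by apply: cvgV; [rewrite gt_eqF|exact: cvg_id].
  exact: continuous_ln.
have fg t : l < t < r -> f t = g t by move=> ht; exact: (fE l r).
have cf t : 0 < t -> {for t, continuous f}.
  by move=> t0; exact: is_derive_continuous (is_derive_f t0).
have r0 : 0 < r := le_lt_trans l0 lr.
split.
  have cg' := cvg_at_left_filter (cg _ r0).
  have cf' : g t @[t --> r^'-] --> f r.
    apply: cvg_trans (cvg_at_left_filter (cf _ r0)); apply: near_eq_cvg.
    near=> t; apply: fg; apply/andP; split; near: t.
      exact: nbhs_left_gt.
    exact: nbhs_left_lt.
  by rewrite -(cvg_lim (@Rhausdorff R) cf') (cvg_lim (@Rhausdorff R) cg').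
move=> lpos.
have cg' := cvg_at_right_filter (cg _ lpos).
have cf' : g t @[t --> l^'+] --> f l.
  apply: cvg_trans (cvg_at_right_filter (cf _ lpos)); apply: near_eq_cvg.
  near=> t; apply: fg; apply/andP; split; near: t.
    exact: nbhs_right_gt.
  exact: nbhs_right_lt.
by rewrite -(cvg_lim (@Rhausdorff R) cf') (cvg_lim (@Rhausdorff R) cg').
Unshelve. all: by end_near. Qed.

(** Among the zeros between [t] and [m], take the one nearest to [m], a zero by continuity. It
    bounds an interval of positivity, which contradicts [itv_boundary_pos]. *)
Lemma f_pos_everywhere (m t : R) : 0 < m -> 0 < f m -> 0 < t -> 0 < f t.
Proof.
move=> m0 fm t0; rewrite lt_neqAle f_ge0 andbT eq_sym; apply/eqP => ft.
have tm : t != m by apply: contraTneq fm => <-; rewrite ft ltxx.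
have fneq u : 0 < f u -> f u = 0 -> False by move=> + E; rewrite E ltxx.
have [tltm|mltt|E] := ltgtP t m; last by rewrite E eqxx in tm.
- pose A := [set u | t <= u <= m /\ f u = 0].
  have At : A t by split => //; rewrite lexx ltW.
  have supA : has_sup A.
    by split; [exists t|exists m => u [/andP[]]].
  pose s := sup A.
  have ts : t <= s by apply: sup_upper_bound.
  have sm : s <= m by apply: ge_sup => [|u [/andP[]]]; first by exists t.
  have s0 : 0 < s := lt_le_trans t0 ts.
  have fs : f s = 0.
    apply/eqP; apply: contraT => fsN.
    have fs : 0 < f s by rewrite lt_neqAle f_ge0 andbT eq_sym.
    have [e /= e0 He] := near_pos s0 fs.
    have [u Au su] := sup_adherent e0 supA.
    have us : u <= s by apply: sup_upper_bound.
    exfalso; have [] := He u.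
      by rewrite /= ger0_norm ?subr_ge0// ltrBlDr addrC -ltrBlDr.
    by case: Au => _ fu _ /fneq; apply.
  have slm : s < m.
    by rewrite lt_neqAle sm andbT; apply: contraTneq fm => <-; rewrite fs ltxx.
  have [|_] := @itv_boundary_pos s m (ltW s0) slm.
    move=> u /andP[su um]; rewrite lt_neqAle f_ge0 andbT eq_sym.
    apply/eqP => fu; suff : u <= s by rewrite leNgt su.
    apply: sup_upper_bound => //; split => //.
    by rewrite (le_trans ts) ltW.
  by move=> /(_ s0) /fneq; apply.
- pose A := [set u | m <= u <= t /\ f u = 0].
  have At : A t by split => //; rewrite lexx ltW.
  have infA : has_inf A.
    by split; [exists t|exists m => u [/andP[]]].
  pose s := inf A.
  have st : s <= t by apply: ge_inf => //; case: infA.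
  have ms : m <= s by apply: lb_le_inf => [|u [/andP[]]]; first by exists t.
  have s0 : 0 < s := lt_le_trans m0 ms.
  have fs : f s = 0.
    apply/eqP; apply: contraT => fsN.
    have fs : 0 < f s by rewrite lt_neqAle f_ge0 andbT eq_sym.
    have [e /= e0 He] := near_pos s0 fs.
    have [u Au us] := inf_adherent e0 infA.
    have su : s <= u by apply: ge_inf => //; case: infA.
    exfalso; have [] := He u.
      by rewrite /= distrC ger0_norm ?subr_ge0// ltrBlDr addrC.
    by case: Au => _ fu _ /fneq; apply.
  have msl : m < s.
    by rewrite lt_neqAle ms andbT; apply: contraTneq fm => ->; rewrite fs ltxx.
  have [|+ _] := @itv_boundary_pos m s (ltW m0) msl.
    move=> u /andP[mu us]; rewrite lt_neqAle f_ge0 andbT eq_sym.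
    apply/eqP => fu; suff : s <= u by rewrite leNgt us.
    apply: ge_inf; first by case: infA.
    by split => //; rewrite ltW//= (le_trans _ st)// ltW.
  by move=> /fneq; move/(_ fs).
Qed.

Lemma functional_equation_solution (m : R) : 0 < m -> 0 < f m ->
  exists k al C : R, 0 < C /\
    forall t, 0 < t -> f t = C * expR (k * (t + t^-1) - al * ln t).
Proof.
move=> m0 fm; have [k [al [C [C0 H]]]] := local_solution m0 fm.
(* The interval from 0 to [m + t + 1] contains both [m] and [t]. *)
exists k, al, C; split => // t t0; apply: (H 0 (m + t + 1)) => //; try lra.
by move=> u /andP[u0 _]; exact: (f_pos_everywhere m0 fm).
Qed.

End functional_equation.

(** * The recursion for [X_n] and [Z_n], and independence of the past *)

Lemma XprodS (T : Type) (R : realType) (g : nat -> T -> R) n w :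
  Xprod g n.+1 w = g n w * Xprod g n w.
Proof. by rewrite /Xprod big_nat_recr//= mulrC. Qed.

Lemma ZsumS (T : Type) (R : realType) (g : nat -> T -> R) n w :
  Zsum g n.+1 w = g n w * Zsum g n w + (Xprod g n w)^-1.
Proof.
rewrite /Zsum big_nat_recr//= [\prod_(n.+1 <= j < n.+1) _]big_geq// mulr1.
congr (_ + _); last by rewrite /Xprod prodfV.
rewrite mulr_sumr; apply: eq_big_nat => k /andP[_ kn].
by rewrite [X in _ * X = _]big_nat_recr//= mulrA mulrC.
Qed.

Lemma Zsum1 (T : Type) (R : realType) (g : nat -> T -> R) w : Zsum g 1 w = 1.
Proof. by rewrite /Zsum big_nat1 !big_geq// mulr1. Qed.

Section measurability.
Context d (T : measurableType d) (R : realType) (g : nat -> T -> R).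

Lemma measurable_Xprod n : (forall i, (i < n)%N -> measurable_fun setT (g i)) ->
  measurable_fun setT (Xprod g n).
Proof.
move=> mg; apply: (@measurable_prod _ _ _ _ _ (index_iota 0 n) g) => i.
by rewrite mem_index_iota => /andP[_]; exact: mg.
Qed.

Lemma measurable_Zsum n : (forall i, (i < n)%N -> measurable_fun setT (g i)) ->
  measurable_fun setT (Zsum g n).
Proof.
elim: n => [|n IH] mg.
  rewrite (_ : Zsum g 0 = cst 0)//.
  by apply/funext => w; rewrite /Zsum big_geq.
rewrite (_ : Zsum g n.+1 = fun w => g n w * Zsum g n w + (Xprod g n w)^-1).
  apply: measurable_funD.
    by apply: measurable_funM; [exact: mg|apply: IH => i /ltnW; exact: mg].
  by apply/measurable_funV/measurable_Xprod => i /ltnW; exact: mg.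
by apply/funext => w; exact: ZsumS.
Qed.

End measurability.

Lemma sub_gen_measurable d (T : measurableType d) (G : set (set T)) :
  G `<=` measurable -> <<s G >> `<=` measurable.
Proof. by move=> GT; exact: smallest_sub (@sigma_algebra_measurable _ T) GT. Qed.

Lemma measurable_fun_gen d d' (T : measurableType d) (S : measurableType d')
    (G : set (set T)) (h : T -> S) :
  G `<=` measurable ->
  measurable_fun setT (h : g_sigma_algebraType G -> S) -> measurable_fun setT h.
Proof.
move=> GT mh _ B mB; apply: (sub_gen_measurable GT).
exact: (mh measurableT B mB).
Qed.

Section independence.
Context d (T : measurableType d) (R : realType) (P : probability T R).
Variable gamma : nat -> {RV P >-> R}.

Definition past (n : nat) : set (set T) :=
  \bigcup_(i in [set i | (i < n)%N])
    preimage_set_system setT (gamma i) measurable.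

Lemma past_measurable n : past n `<=` measurable.
Proof.
by move=> _ [i _ [B mB <-]]; exact: measurable_funP.
Qed.

Lemma measurable_gamma_past n i : (i < n)%N ->
  measurable_fun setT (gamma i : g_sigma_algebraType (past n) -> R).
Proof.
by move=> ilt _ B mB; apply: sub_sigma_algebra; exists i => //; exists B.
Qed.

Lemma measurable_Xprod_past n :
  measurable_fun setT (Xprod gamma n : g_sigma_algebraType (past n) -> R).
Proof.
by apply: (@measurable_Xprod _ (g_sigma_algebraType (past n))) => i;
  exact: measurable_gamma_past.
Qed.

Lemma measurable_Zsum_past n k : (k <= n)%N ->
  measurable_fun setT (Zsum gamma k : g_sigma_algebraType (past n) -> R).
Proof.
move=> kn; apply: (@measurable_Zsum _ (g_sigma_algebraType (past n))) => i ik.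
exact: measurable_gamma_past (leq_trans ik kn).
Qed.

Lemma sigma_gen_past n : <<s sigma_gen (Zsum gamma) n >> `<=` <<s past n >>.
Proof.
apply: smallest_sub; first exact: smallest_sigma_algebra.
move=> _ [i /= /andP[_ ilen] [B mB <-]].
exact: (measurable_Zsum_past ilen measurableT mB).
Qed.

Hypothesis indep : mutually_independent gamma.

(** Both sides are finite measures in [E], so they need only agree on the pi-system of cylinders in
    the first [n] variables, which generates the past. *)
Lemma past_indep n (E : set T) (B : set R) : <<s past n >> E -> measurable B ->
  P (E `&` gamma n @^-1` B) = (P E * P (gamma n @^-1` B))%E.
Proof.
move=> pE mB.
pose cyl (C : nat -> set R) := \bigcap_(i in [set` iota 0 n]) gamma i @^-1` C i.
have mg i (C : set R) : measurable C -> measurable (gamma i @^-1` C).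
  by move=> mC; rewrite -[X in measurable X]setTI; exact: measurable_funP.
pose G : set (set T) :=
  [set E | exists2 C : nat -> set R, (forall i, measurable (C i)) & E = cyl C].
have mgB := mg n B mB.
pose m1 := mrestr P mgB.
pose m2 := mscale (NngNum (fine_ge0 (measure_ge0 P (gamma n @^-1` B)))) P.
have Gm : G `<=` measurable.
  move=> _ [C mC ->]; rewrite /cyl bigcap_seq; apply: bigsetI_measurable => i _.
  exact: mg.
have GT : G setT.
  exists (fun=> setT) => //; apply/esym; rewrite -subTset => w _ i _ //.
have PfE (A : set T) : measurable A -> ((fine (P A))%:E = P A)%E.
  by move=> mA; rewrite fineK// fin_num_measure.
have -> : (P E * P (gamma n @^-1` B) = m2 E)%E.
  by rewrite /m2/= /mscale/= PfE// muleC.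
rewrite -[LHS]/(m1 E).
apply: (@g_sigma_algebra_measure_unique _ _ _ G Gm (fun=> setT)) => //.
- by rewrite bigcup_const.
- move=> _ _ [C1 mC1 ->] [C2 mC2 ->]; exists (fun i => C1 i `&` C2 i).
    by move=> i; exact: measurableI.
  by rewrite /cyl -bigcapI; apply: eq_bigcapr => i _; rewrite preimage_setI.
- move=> _ [C mC ->]; rewrite /m1 /m2/= /mrestr /mscale/= PfE//.
  (* Independence is applied twice, to the first [n + 1] variables with [B] in the last place and to
     the first [n] alone. *)
  pose C' i := if i == n then B else C i.
  have mC' i : measurable (C' i) by rewrite /C'; case: ifP.
  have cE : \big[setI/setT]_(i <- iota 0 n) (gamma i @^-1` C' i) = cyl C.
    rewrite /cyl bigcap_seq; apply: eq_big_seq => i.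
    by rewrite mem_iota add0n /= /C' => /ltn_eqF ->.
  have C'n : C' n = B by rewrite /C' eqxx.
  have un : uniq (iota 0 n.+1) by exact: iota_uniq.
  have := indep un mC'; rewrite -addn1 iotaD add0n big_cat big_seq1/= cE C'n => ->.
  rewrite big_cat big_seq1/= C'n muleC; congr (_ * _)%E.
  by rewrite -cE indep// iota_uniq.
- move=> k; rewrite /m1/= /mrestr setTI.
  by rewrite (le_lt_trans (probability_le1 P mgB))// ltry.
- apply: (@smallest_sub _ _ _ _ _ _ _ pE); first exact: smallest_sigma_algebra.
  move=> _ [i /= ilt [A mA <-]]; apply: sub_sigma_algebra.
  exists (fun j => if j == i then A else setT).
    by move=> j; case: ifP.
  rewrite setTI /cyl; apply/seteqP; split => w /=.
    by move=> Aw j _ /=; case: eqP => [->|].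
  by move=> /(_ i); rewrite eqxx; apply; rewrite /= mem_iota.
Qed.

End independence.

Section one_step.
Local Open Scope ereal_scope.
Context d (T : measurableType d) (R : realType) (P : probability T R).
Variables (gamma : nat -> {RV P >-> R}) (p : R -> R).
Notation mu := (@lebesgue_measure R).
Notation D := (`]0%R, +oo[%classic : set R).
Hypothesis indep : mutually_independent gamma.
Hypothesis dens : forall n, has_density (gamma n) p.
Hypothesis p_pos : forall x, (x <= 0)%R -> p x = 0%R.

Lemma integral_gamma n (F : R -> \bar R) : (forall x, 0 <= F x) ->
  measurable_fun setT F ->
  \int[P]_w F (gamma n w) = \int[mu]_(x in D) (F x * (p x)%:E).
Proof.
move=> F0 mF; have [mp p0 pE] := dens n.
have mgn : measurable_fun setT (gamma n : T -> measurableTypeR R).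
  have h := @measurable_funP _ _ _ _ setT (gamma n).
  exact h.
have -> : \int[mu]_(x in D) (F x * (p x)%:E) = \int[mu]_x (F x * (p x)%:E).
  rewrite integral_mkcond; apply: eq_integral => x _; rewrite patchE.
  case: ifPn => //; rewrite notin_setE/= in_itv/= andbT => /negP.
  by rewrite -leNgt => /p_pos ->; rewrite mule0.
apply: (eq_monotone_functional_measurable (monotone_functional_comp
  (monotone_functional_integral P measurableT) mgn)
  (monotone_functional_density mu p0 mp)) => // A mA.
transitivity (distribution P (gamma n) A).
  have mgA : measurable (gamma n @^-1` A).
    by rewrite -[X in measurable X]setTI; exact: mgn.
  transitivity (\int[P]_w (\1_(gamma n @^-1` A) w)%:E).
    apply: eq_integral => w _; rewrite /= !indicE.
    by congr ((nat_of_bool _)%:R%:E); apply/idP/idP; rewrite !inE.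
  by rewrite integral_indic// setIT.
rewrite pE// [LHS]integral_mkcond; apply: eq_integral => x _ /=.
by rewrite patchE indicE; case: (x \in A); rewrite ?mul1e ?mul0e.
Qed.

(** Since [gamma n] is independent of the past, its conditional law given [W] is its own law: this
    is the disintegration along a constant kernel. *)
Lemma integral_one_step d' (S : measurableType d') n (W : T -> S) (E : set T)
    (F : S -> R -> \bar R) :
  measurable_fun setT (W : g_sigma_algebraType (past gamma n) -> S) ->
  <<s past gamma n >> E ->
  (forall s x, 0 <= F s x) ->
  measurable_fun setT (fun z : S * R => F z.1 z.2) ->
  \int[P]_(w in E) F (W w) (gamma n w) =
  \int[P]_(w in E) \int[mu]_(g in D) (F (W w) g * (p g)%:E).
Proof.
move=> mW pE F0 mF.
have mE := sub_gen_measurable (@past_measurable _ _ _ _ gamma n) pE.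
have mW' := measurable_fun_gen (@past_measurable _ _ _ _ gamma n) mW.
have mgn : measurable_fun setT (gamma n : T -> measurableTypeR R).
  have h := @measurable_funP _ _ _ _ setT (gamma n).
  exact h.
pose gn : {mfun T >-> measurableTypeR R} :=
  HB.pack (gamma n : T -> measurableTypeR R) (isMeasurableFun.Build _ _ _ _ _ mgn).
pose L : R.-pker S ~> measurableTypeR R := kprobability (@measurable_cst _ _ S
  (pprobability (measurableTypeR R) R) setT (distribution P gn)).
rewrite (@disintegration _ _ _ T S (measurableTypeR R) R P L W (gamma n) mW' mgn E
  (fun z => F z.1 z.2))//.
- apply: eq_integral => w _.
  have mFw : measurable_fun setT (F (W w)).
    exact: (measurableT_comp mF (measurable_fun_pair (measurable_cst (W w))
      (@measurable_id _ R setT))).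
  rewrite -(integral_gamma n)//.
  exact: ge0_integral_distribution.
- move=> B A mB mA; rewrite setIA past_indep//.
    have mEB : measurable (E `&` W @^-1` B).
      by apply: measurableI => //; rewrite -[X in measurable X]setTI; exact: mW'.
    by rewrite integral_cst// muleC.
  apply: (@measurableI _ (g_sigma_algebraType (past gamma n))) => //.
  by rewrite -[X in measurable X]setTI; exact: mW.
Qed.

End one_step.

(** * Laws of [(X_2, Z_2)] and [(X_3, Z_3, Z_2)] *)

Section parametric_integral.
Local Open Scope ereal_scope.
Context d (S : measurableType d) (R : realType).
Notation mu := (@lebesgue_measure R).
Notation D := (`]0%R, +oo[%classic : set R).

Lemma measurable_integral_pos (G : S -> R -> \bar R) :
  (forall s x, 0 <= G s x) ->
  measurable_fun setT (fun z : S * R => G z.1 z.2) ->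
  measurable_fun setT (fun s => \int[mu]_(x in D) G s x).
Proof.
move=> G0 mG.
pose H := (fun z : S * measurableTypeR R => G z.1 z.2) \_ (setT `*` D).
have mSD : measurable (setT `*` D : set (S * measurableTypeR R)).
  exact: measurableX.
have mH : measurable_fun setT H.
  by apply/(measurable_restrictT _ mSD); exact: measurable_funTS.
have H0 z : 0 <= H z by apply: erestrict_ge0.
have := @measurable_fun_fubini_tonelli_F _ _ S (measurableTypeR R) R mu H mH H0.
apply: eq_measurable_fun => s _; rewrite /fubini_F [RHS]integral_mkcond.
apply: eq_integral => x _; rewrite /H !patchE.
by rewrite in_setX /= in_setT.
Qed.

End parametric_integral.

Section le_integral_pos2.
Local Open Scope ereal_scope.
Context (R : realType).
Notation mu := (@lebesgue_measure R).
Notation D := (`]0%R, +oo[%classic : set R).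

Lemma le_integral_pos2 (F G : R -> R -> \bar R) :
  (forall w v, 0 <= F w v) -> (forall w v, 0 <= G w v) ->
  measurable_fun setT (fun z : R * R => F z.1 z.2) ->
  measurable_fun setT (fun z : R * R => G z.1 z.2) ->
  (forall w v, F w v <= G w v) ->
  \int[mu]_(w in D) \int[mu]_(v in D) F w v <=
  \int[mu]_(w in D) \int[mu]_(v in D) G w v.
Proof.
move=> F0 G0 mF mG FG.
have mcst (H : R -> R -> \bar R) w :
    measurable_fun setT (fun z : R * R => H z.1 z.2) -> measurable_fun setT (H w).
  move=> mH; exact: (@measurable_uncurry R _ R H (cst w) id mH
    (measurable_cst _) (@measurable_id _ R setT)).
have mI (H : R -> R -> \bar R) : (forall w v, 0 <= H w v) ->
    measurable_fun setT (fun z : R * R => H z.1 z.2) ->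
    measurable_fun D (fun w => \int[mu]_(v in D) H w v).
  move=> H0 mH; apply: measurable_funTS.
  exact: (@measurable_integral_pos _ R R H).
apply: ge0_le_integral.
- exact: measurable_itv.
- by move=> w _; apply: integral_ge0 => v _; exact: F0.
- exact: mI.
- exact: mI.
- move=> w _; apply: ge0_le_integral.
  + exact: measurable_itv.
  + by move=> v _; exact: F0.
  + by apply: measurable_funTS; exact: mcst.
  + by apply: measurable_funTS; exact: mcst.
  + by move=> v _; exact: FG.
Qed.

End le_integral_pos2.

Section necessity.
Local Open Scope ereal_scope.
Context d (T : measurableType d) (R : realType) (P : probability T R).
Variables (gamma : nat -> {RV P >-> R}) (p : R -> R).
Notation mu := (@lebesgue_measure R).
Notation D := (`]0%R, +oo[%classic : set R).
Hypothesis indep : mutually_independent gamma.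
Hypothesis dens : forall n, has_density (gamma n) p.
Hypothesis p_pos : forall x, (x <= 0)%R -> p x = 0%R.

Let mp : measurable_fun setT p. Proof. by have [] := dens 0%N. Qed.
Let p0 x : (0 <= p x)%R. Proof. by have [_ + _] := dens 0%N; exact. Qed.

Let mpc d' (S : measurableType d') (h : S -> R) :
  measurable_fun setT h -> measurable_fun setT (fun s => p (h s)).
Proof. exact: measurableT_comp. Qed.

Let mnc d' (S : measurableType d') (h : S -> R) :
  measurable_fun setT h -> measurable_fun setT (fun s => `|h s|%R).
Proof. exact: measurableT_comp. Qed.

Local Ltac mfun := repeat first
  [ assumption | exact: measurable_cst | exact: measurable_id
  | exact: measurable_fst | exact: measurable_snd
  | apply: mpc | apply: mnc | apply: measurable_funV
  | apply: measurable_funM | apply: measurable_funD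
  | apply: measurable_fun_pair
  | apply: (measurableT_comp measurable_fst)
  | apply: (measurableT_comp measurable_snd) ].

(* The densities of [(X_2, Z_2)] and [(X_3, Z_3, Z_2)] on the positive
   quadrant and octant; the absolute values only make them nonnegative
   everywhere. *)
Definition density2 (u z : R) : R :=
  (p ((u + 1) / z) * p (u * z / (u + 1)) * `|z^-1|)%R.

Definition density3 (x y z : R) : R := (joint3 p x y z * `|y^-1| * `|z^-1|)%R.

Let density2_ge0 u z : (0 <= density2 u z)%R.
Proof. by rewrite !mulr_ge0. Qed.

Let density3_ge0 x y z : (0 <= density3 x y z)%R.
Proof. by rewrite !mulr_ge0. Qed.

Let Xprod1 w : Xprod gamma 1 w = gamma 0%N w.
Proof. by rewrite XprodS /Xprod big_geq// mulr1. Qed.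

(** The pair of the first two variables has a product density, and [integral_pos_subst] carries it
    over, with its parameter [z] equal to 1 because Z_1 = 1. *)
Lemma law_X2_Z2 (F : R -> R -> \bar R) : (forall u z, 0 <= F u z) ->
  measurable_fun setT (fun v : R * R => F v.1 v.2) ->
  \int[P]_w F (Xprod gamma 2 w) (Zsum gamma 2 w) =
  \int[mu]_(z in D) \int[mu]_(u in D) (F u z * (density2 u z)%:E).
Proof.
move=> F0 mF.
pose G (s g : R) := F (g * s)%R (g + s^-1)%R.
have mG : measurable_fun setT (fun v : R * R => G v.1 v.2).
  apply: (@measurable_uncurry R _ (R * R)%type F (fun v => v.2 * v.1)%R
    (fun v => v.2 + v.1^-1)%R mF); mfun.
transitivity (\int[P]_w G (gamma 0%N w) (gamma 1%N w)).
  apply: eq_integral => w _.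
  by rewrite XprodS ZsumS Zsum1 Xprod1 mulr1.
have GE0 s g : 0 <= G s g * (p g)%:E by rewrite mule_ge0// ?lee_fin// F0.
have mGp : measurable_fun setT (fun v : R * R => G v.1 v.2 * (p v.2)%:E).
  by apply: emeasurable_funM => //; apply/measurable_EFinP; mfun.
rewrite (integral_one_step (W := gamma 0%N) indep dens p_pos)//; last 3 first.
- exact: measurable_gamma_past.
- exact: (@measurableT _ (g_sigma_algebraType (past gamma 1))).
- by move=> s x; exact: F0.
rewrite (@integral_gamma _ _ _ _ _ _ dens p_pos 0%N
  (fun s => \int[mu]_(g in D) (G s g * (p g)%:E))); last 2 first.
- by move=> s; exact: integral_ge0.
- exact: measurable_integral_pos.
pose H (s g : R) := G s g * (p g * p s)%:E.
have H0 s g : 0 <= H s g by rewrite mule_ge0 ?F0// lee_fin mulr_ge0.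
have mH : measurable_fun setT (fun v : R * R => H v.1 v.2).
  by apply: emeasurable_funM => //; apply/measurable_EFinP; mfun.
transitivity (\int[mu]_(s in D) \int[mu]_(g in D) H s g).
  apply: eq_integral => s _; rewrite -ge0_integralZr//.
  + by apply: eq_integral => g _; rewrite /H (EFinM (p g)) muleA.
  + apply: measurable_funTS.
    exact: (@measurable_uncurry R _ R (fun s g => G s g * (p g)%:E) (cst s) id
      mGp (measurable_cst _) (@measurable_id _ R setT)).
  + by rewrite lee_fin.
rewrite (integral_pos_subst ltr01 H0 mH).
rewrite -(tonelli_pos (F := fun x y => F x y * (density2 x y)%:E)).
- apply: eq_integral => x; rewrite inE/= in_itv/= andbT => x0.
  apply: eq_integral => y; rewrite inE/= in_itv/= andbT => y0.
  have x1 : (x + 1 != 0)%R by rewrite gt_eqF// addr_gt0.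
  have yN : (y != 0)%R by rewrite gt_eqF.
  rewrite /H /G mulr1 -muleA -EFinM; congr (F _ _ * _%:E).
  + by field; rewrite x1 yN.
  + by field; rewrite x1 yN.
  + by rewrite /density2 ger0_norm ?invr_ge0 ?ltW// [(p _ * p _)%R]mulrC.
- by move=> x y; rewrite mule_ge0// lee_fin.
- apply: emeasurable_funM => //; apply/measurable_EFinP.
  by rewrite /density2; mfun.
Qed.

Lemma measurable_density3 : measurable_fun setT
  (fun v : R * R * R => density3 v.2 v.1.2 v.1.1).
Proof. by rewrite /density3 /joint3; mfun. Qed.

(** At [y], the density of Z_3 on the event that X_3 lies in [A] and Z_2 in [C]; a box in [x] and
    [z] is integrated out while [y] stays pointwise. *)
Definition box_density (A C : set R) (y : R) : \bar R :=
  \int[mu]_(z in D) \int[mu]_(x in D) (\1_A x * \1_C z * density3 x y z)%:E.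

Lemma box_density_ge0 A C y : 0 <= box_density A C y.
Proof.
apply: integral_ge0 => z _; apply: integral_ge0 => x _.
by rewrite lee_fin !mulr_ge0.
Qed.

Let m3 (A C : set R) : measurable A -> measurable C ->
  measurable_fun setT (fun v : R * R * R =>
    (\1_A v.2 * \1_C v.1.1 * density3 v.2 v.1.2 v.1.1)%:E : \bar R).
Proof.
move=> mA mC; apply/measurable_EFinP; apply: measurable_funM.
  by apply: measurable_funM; apply: measurableT_comp; mfun;
    exact: measurable_indic.
exact: measurable_density3.
Qed.

Let m2 (A C : set R) : measurable A -> measurable C ->
  measurable_fun setT (fun v : R * R => \int[mu]_(x in D)
    (\1_A x * \1_C v.1 * density3 x v.2 v.1)%:E).
Proof.
move=> mA mC.
apply: (@measurable_integral_pos _ (R * R)%type R (fun v x =>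
    (\1_A x * \1_C v.1 * density3 x v.2 v.1)%:E)).
  by move=> v x; rewrite lee_fin !mulr_ge0.
exact: m3.
Qed.

Lemma measurable_box_density A C : measurable A -> measurable C ->
  measurable_fun setT (box_density A C).
Proof.
move=> mA mC.
apply: (@measurable_integral_pos _ R R (fun y z => \int[mu]_(x in D)
    (\1_A x * \1_C z * density3 x y z)%:E)).
  by move=> y z; apply: integral_ge0 => x _; rewrite lee_fin !mulr_ge0.
apply: (measurableT_comp (m2 mA mC) (g := fun v : R * R => (v.2, v.1))).
by mfun.
Qed.

(** The third variable is integrated out given (X_2, Z_2), and [integral_pos_subst] is applied at
    fixed [z]. The test function [K] is arbitrary so that it can later contain [L y A]. *)
Lemma law_X3_Z3_Z2 (A C : set R) (K : R -> \bar R) :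
  measurable A -> measurable C -> (forall y, 0 <= K y) ->
  measurable_fun setT K ->
  \int[P]_w (K (Zsum gamma 3 w) *
    (\1_A (Xprod gamma 3 w) * \1_C (Zsum gamma 2 w))%:E) =
  \int[mu]_(y in D) (K y * box_density A C y).
Proof.
move=> mA mC K0 mK.
have m1A : measurable_fun setT (\1_A : R -> R) by exact: measurable_indic.
have m1C : measurable_fun setT (\1_C : R -> R) by exact: measurable_indic.
have mcomp d' (S : measurableType d') (F : R -> \bar R) (h : S -> R) :
    measurable_fun setT F -> measurable_fun setT h ->
    measurable_fun setT (fun s => F (h s)) by exact: measurableT_comp.
have mcompr d' (S : measurableType d') (F : R -> R) (h : S -> R) :
    measurable_fun setT F -> measurable_fun setT h ->
    measurable_fun setT (fun s => F (h s)) by exact: measurableT_comp.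
pose Phi x y z := K y * (\1_A x * \1_C z)%:E.
have Phi0 x y z : 0 <= Phi x y z by rewrite mule_ge0// lee_fin mulr_ge0.
have mPhi d' (S : measurableType d') (a b c : S -> R) :
    measurable_fun setT a -> measurable_fun setT b -> measurable_fun setT c ->
    measurable_fun setT (fun s => Phi (a s) (b s) (c s)).
  move=> ma mb mc; apply: emeasurable_funM; first exact: mcomp.
  by apply/measurable_EFinP; apply: measurable_funM; exact: mcompr.
pose F (s : R * R) (g : R) := Phi (g * s.1)%R (g * s.2 + s.1^-1)%R s.2.
have mF : measurable_fun setT (fun v : (R * R) * R => F v.1 v.2).
  by apply: mPhi; mfun.
have mFp : measurable_fun setT
    (fun v : (R * R) * R => F v.1 v.2 * (p v.2)%:E).
  by apply: emeasurable_funM => //; apply/measurable_EFinP; mfun.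
transitivity (\int[P]_w F (Xprod gamma 2 w, Zsum gamma 2 w) (gamma 2%N w)).
  by apply: eq_integral => w _; rewrite [Zsum gamma 3 w]ZsumS [Xprod gamma 3 w]XprodS.
rewrite (integral_one_step (W := fun w => (Xprod gamma 2 w, Zsum gamma 2 w))
  indep dens p_pos)//; last 3 first.
- have mX := @measurable_Xprod_past _ T R P gamma 2.
  have mZ := @measurable_Zsum_past _ T R P gamma 2 2 (leqnn 2).
  exact: (measurable_fun_pair mX mZ).
- exact: (@measurableT _ (g_sigma_algebraType (past gamma 2))).
- by move=> s x; exact: Phi0.
rewrite (law_X2_Z2 (F := fun u z => \int[mu]_(g in D) (F (u, z) g * (p g)%:E)));
  last 2 first.
- by move=> u z; apply: integral_ge0 => g _; rewrite mule_ge0// ?Phi0// lee_fin.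
- apply: (@measurable_integral_pos _ (R * R)%type R
    (fun v g => F (v.1, v.2) g * (p g)%:E)).
    by move=> s x; rewrite mule_ge0 ?Phi0// lee_fin.
  by under eq_fun do rewrite -surjective_pairing; exact: mFp.
transitivity (\int[mu]_(z in D) \int[mu]_(y in D) \int[mu]_(x in D)
    (Phi x y z * (density3 x y z)%:E)).
  apply: eq_integral => z; rewrite inE/= in_itv/= andbT => z0.
  pose H u g := F (u, z) g * (p g * density2 u z)%:E.
  have H0 u g : 0 <= H u g by rewrite mule_ge0 ?Phi0// lee_fin mulr_ge0.
  have mH : measurable_fun setT (fun v : R * R => H v.1 v.2).
    apply: emeasurable_funM; first by apply: mPhi; mfun.
    by apply/measurable_EFinP; rewrite /density2; mfun.
  transitivity (\int[mu]_(u in D) \int[mu]_(g in D) H u g).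
    apply: eq_integral => u _; rewrite -ge0_integralZr//.
    + by apply: eq_integral => g _; rewrite /H (EFinM (p g)) muleA.
    + apply: measurable_funTS; apply: emeasurable_funM.
        by apply: mPhi; mfun.
      by apply/measurable_EFinP.
    + by move=> g _; rewrite mule_ge0 ?Phi0// lee_fin.
    + by rewrite lee_fin.
  rewrite (integral_pos_subst z0 H0 mH).
  rewrite -(tonelli_pos (F := fun x y => Phi x y z * (density3 x y z)%:E)).
  + apply: eq_integral => x; rewrite inE/= in_itv/= andbT => x0.
    apply: eq_integral => y; rewrite inE/= in_itv/= andbT => y0.
    have xz : (0 < x * z)%R by rewrite mulr_gt0.
    have xz1 : (x * z + 1 != 0)%R by rewrite gt_eqF// addr_gt0.
    have xzy : (x * z + 1 + y != 0)%R by rewrite gt_eqF// !addr_gt0.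
    have [yN zN] : (y != 0 /\ z != 0)%R by rewrite !gt_eqF.
    rewrite /H /F /= -muleA -EFinM; congr (Phi _ _ _ * _%:E).
    * by field; rewrite xz1 yN.
    * by field; rewrite xz1 yN.
    * rewrite /density2 /density3 /joint3.
      rewrite (_ : ((x * z + 1) / y + 1) / z = (x * z + 1 + y) / (y * z))%R;
        last by field; rewrite yN zN.
      rewrite (_ : (x * z + 1) / y * z / ((x * z + 1) / y + 1) =
        z * (x * z + 1) / (x * z + 1 + y))%R; last by field; rewrite yN xzy.
      have -> : (`|y^-1| = y^-1)%R by rewrite ger0_norm// invr_ge0 ltW.
      by ring.
  + by move=> x y; rewrite mule_ge0 ?Phi0// lee_fin.
  + apply: emeasurable_funM; first by apply: mPhi; mfun.
    by apply/measurable_EFinP; rewrite /density3 /joint3; mfun.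
transitivity (\int[mu]_(z in D) \int[mu]_(y in D) (K y * \int[mu]_(x in D)
    (\1_A x * \1_C z * density3 x y z)%:E)).
  apply: eq_integral => z _; apply: eq_integral => y _.
  rewrite -ge0_integralZl//.
  - by apply: eq_integral => x _; rewrite /Phi -muleA -EFinM.
  - apply: measurable_funTS.
    by apply: (measurableT_comp (m3 mA mC) (g := fun x : R => ((z, y), x))); mfun.
  - by move=> x _; rewrite lee_fin !mulr_ge0.
rewrite (tonelli_pos (F := fun z y => K y * \int[mu]_(x in D)
    (\1_A x * \1_C z * density3 x y z)%:E)).
- apply: eq_integral => y _; rewrite ge0_integralZl//.
  + apply: measurable_funTS.
    by apply: (measurableT_comp (m2 mA mC) (g := fun z : R => (z, y))); mfun.
  + by move=> z _; apply: integral_ge0 => x _; rewrite lee_fin !mulr_ge0.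
- move=> z y; rewrite mule_ge0//; apply: integral_ge0 => x _.
  by rewrite lee_fin !mulr_ge0.
- by apply: emeasurable_funM; [apply: mcomp; mfun|exact: m2].
Qed.

(** * From the kernel to the pointwise product identity *)

Let indicp (h : T -> R) (E : set R) w : \1_E (h w) = \1_(h @^-1` E) w :> R.
Proof. by rewrite !indicE; congr (_%:R); congr nat_of_bool; apply/idP/idP; rewrite !inE. Qed.

Let mXZ n : measurable_fun setT (Xprod gamma n) /\ measurable_fun setT (Zsum gamma n).
Proof.
have mg i : measurable_fun setT (gamma i) by exact: measurable_funP.
by split; [exact: measurable_Xprod|exact: measurable_Zsum].
Qed.

Let mpre (h : T -> R) (E : set R) : measurable_fun setT h -> measurable E ->
  measurable (h @^-1` E).
Proof. by move=> mh mE; rewrite -[X in measurable X]setTI; exact: mh. Qed.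

(** Events that constrain Z_3 and Z_2 belong to the conditioning sigma-algebra. Tested on them, the
    conditional probability gives both sides the same integral over every measurable [E] in the
    half-line. *)
Lemma ae_box_density (L : R.-pker (measurableTypeR R) ~> (measurableTypeR R))
    (A C : set R) :
  is_cond_prob P (sigma_gen (Zsum gamma) 3) (Xprod gamma 3 @^-1` A)
    (fun w => L (Zsum gamma 3 w) A) ->
  measurable A -> measurable C ->
  ae_eq mu D (box_density A C) (fun y => L y A * box_density setT C y).
Proof.
move=> [_ HL] mA mC.
have [mX3 mZ3] := mXZ 3; have [_ mZ2] := mXZ 2.
have mLA : measurable_fun setT (fun y : R => L y A).
  exact: (measurable_kernel L A mA).
have mQA := measurable_box_density mA mC.
have mQT := measurable_box_density (@measurableT _ R) mC.
have indic_law (E : set R) : measurable E ->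
    \int[mu]_(y in D) ((\1_E y)%:E * box_density A C y) =
    P (Xprod gamma 3 @^-1` A `&` (Zsum gamma 3 @^-1` E `&` Zsum gamma 2 @^-1` C)).
  move=> mE; have mI : measurable_fun setT (fun y : R => (\1_E y)%:E : \bar R).
    by apply/measurable_EFinP; exact: measurable_indic.
  rewrite -(law_X3_Z3_Z2 (K := fun y => (\1_E y)%:E))//.
  transitivity (\int[P]_w (\1_(Xprod gamma 3 @^-1` A `&`
      (Zsum gamma 3 @^-1` E `&` Zsum gamma 2 @^-1` C)) w)%:E).
    apply: eq_integral => w _; rewrite -EFinM !indicp !indicI; congr EFin.
    by rewrite /=; ring.
  rewrite integral_indic ?setIT//.
  by apply: measurableI; [exact: mpre|apply: measurableI; exact: mpre].
have intE (F : R -> \bar R) (E : set R) : E `<=` D ->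
    \int[mu]_(y in E) F y = \int[mu]_(y in D) ((\1_E y)%:E * F y).
  move=> ED; rewrite integral_mkcond [RHS]integral_mkcond.
  apply: eq_integral => y _; rewrite !patchE indicE.
  have [yE|yE] := boolP (y \in E).
    by rewrite mem_set ?mul1e//; apply: ED; rewrite inE in yE.
  by rewrite mul0e if_same.
apply: integral_ae_eq => //.
- apply/integrableP; split; first exact: (measurable_funTS mQA).
  under eq_integral do rewrite gee0_abs ?box_density_ge0//.
  rewrite (intE (box_density A C) D (@subset_refl _ D)) indic_law//.
  rewrite (le_lt_trans (probability_le1 P _)) ?ltry//.
  by apply: measurableI; [exact: mpre|apply: measurableI; exact: mpre].
- by apply: measurable_funTS; exact: emeasurable_funM.
- move=> E ED mE; rewrite (intE (box_density A C) E ED) indic_law//.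
  rewrite (intE (fun y => L y A * box_density setT C y) E ED).
  pose B := Zsum gamma 3 @^-1` E `&` Zsum gamma 2 @^-1` C.
  transitivity (\int[P]_(w in B) L (Zsum gamma 3 w) A).
    rewrite HL//; apply: (@measurableI _ (g_sigma_algebraType _)).
      apply: sub_sigma_algebra; exists 3%N => //; exists E => //.
      by rewrite setTI.
    apply: sub_sigma_algebra; exists 2%N => //; exists C => //.
    by rewrite setTI.
  transitivity (\int[mu]_(y in D) (((\1_E y)%:E * L y A) * box_density setT C y));
    last by apply: eq_integral => y _; rewrite muleA.
  rewrite -(law_X3_Z3_Z2 (K := fun y => (\1_E y)%:E * L y A))//.
  + rewrite integral_mkcond; apply: eq_integral => w _.
    rewrite patchE indicT mul1r !indicp muleAC -EFinM.
    have -> : (\1_(Zsum gamma 3 @^-1` E) w * \1_(Zsum gamma 2 @^-1` C) w =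
        \1_B w :> R)%R by rewrite /B indicI.
    by rewrite indicE; case: (w \in B); rewrite ?mul1e ?mul0e.
  by apply: emeasurable_funM => //; apply/measurable_EFinP; exact: measurable_indic.
Qed.

Let int_box (x r z : R) (m : R) : (0 < r)%R -> (r <= x)%R -> (r <= z)%R ->
  (0 <= m)%R ->
  \int[mu]_(w in D) \int[mu]_(v in D)
    (\1_(`](x - r), (x + r)[%classic) v * \1_(`](z - r), (z + r)[%classic) w * m)%:E
  = (m * (2 * r) ^+ 2)%:E.
Proof.
move=> r0 rx rz m0.
have I1 (c k : R) : (r <= c)%R -> (0 <= k)%R ->
    \int[mu]_(v in D) (\1_(`](c - r), (c + r)[%classic) v * k)%:E = (k * (2 * r))%:E.
  move=> rc k0.
  under eq_integral do rewrite EFinM.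
  rewrite ge0_integralZr//; last first.
    by apply/measurable_EFinP; exact: measurable_indic.
  rewrite integral_indic//.
  have -> : `](c - r)%R, (c + r)%R[%classic `&` D = `](c - r)%R, (c + r)%R[%classic.
    apply/seteqP; split => v /=; rewrite !in_itv/= andbT; first by case.
    by move=> /andP[h1 h2]; split; [rewrite h1 h2|rewrite (le_lt_trans _ h1)// subr_ge0].
  have mI : mu `](c - r)%R, (c + r)%R[%classic = (2 * r)%:E.
    rewrite lebesgue_measure_itv/= lte_fin ifT; last by lra.
    by rewrite -EFinB; congr EFin; ring.
  by rewrite [X in X * _]mI -EFinM mulrC.
transitivity (\int[mu]_(w in D)
  (\1_(`](z - r), (z + r)[%classic) w * (m * (2 * r)))%:E).
  apply: eq_integral => w _.
  transitivity (\int[mu]_(v in D)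
    (\1_(`](x - r), (x + r)[%classic) v * (\1_(`](z - r), (z + r)[%classic) w * m))%:E).
    by apply: eq_integral => v _; rewrite mulrA.
  rewrite I1//; last by rewrite mulr_ge0.
  by congr EFin; ring.
by rewrite I1 ?mulr_ge0 ?(ltW r0)//; congr EFin; ring.
Qed.

Let mq (y : R) : measurable_fun setT (fun t : R * R => density3 t.2 y t.1).
Proof.
apply: (measurableT_comp measurable_density3
  (g := fun t : R * R => ((t.1, y), t.2))).
by mfun.
Qed.

Lemma product_gap (a b c e : R) : (0 <= a)%R -> (0 <= b)%R -> (0 <= c)%R ->
  (0 <= e)%R -> (c * e < a * b)%R ->
  exists s : R, [/\ 0 < s, 0 < a - s, 0 < b - s &
    (c + s) * (e + s) < (a - s) * (b - s)]%R.
Proof.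
move=> a0 b0 c0 e0 h.
have ab0 : (0 < a * b)%R by apply: le_lt_trans h; rewrite mulr_ge0.
have a1 : (0 < a)%R.
  by rewrite lt_neqAle a0 andbT; apply: contraTneq ab0 => <-; rewrite mul0r ltxx.
have b1 : (0 < b)%R.
  by rewrite lt_neqAle b0 andbT; apply: contraTneq ab0 => <-; rewrite mulr0 ltxx.
pose S := (a + b + c + e)%R.
have S0 : (0 < S)%R by rewrite /S; lra.
pose s1 := ((a * b - c * e) / (2 * S))%R.
have s10 : (0 < s1)%R by rewrite divr_gt0// ?subr_gt0// mulr_gt0.
(* The gap after moving by [s] is exactly [a * b - c * e - s * S]; [s1] uses up half of it, and the
   other two bounds keep [a - s] and [b - s] positive. *)
exists (Num.min (a / 2) (Num.min (b / 2) s1))%R.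
set s := Num.min _ _.
have sa : (s <= a / 2)%R by rewrite /s ge_min lexx.
have sb : (s <= b / 2)%R by rewrite /s !ge_min lexx orbT.
have ss : (s <= s1)%R by rewrite /s !ge_min lexx !orbT.
have s0 : (0 < s)%R by rewrite /s !lt_min s10 !divr_gt0.
split => //; [lra|lra|].
have E : (s1 * (2 * S) = a * b - c * e)%R by rewrite divfK// gt_eqF// mulr_gt0.
have : (s * S <= s1 * S)%R by rewrite ler_pM2r.
have : (0 < s1 * S)%R by rewrite mulr_gt0.
rewrite /S in E *; nra.
Qed.

Hypothesis cp : forall t : R, (0 < t)%R -> {for t, continuous p}.

Lemma near_density3 (x y z l u : R) : (0 < x)%R -> (0 < y)%R -> (0 < z)%R ->
  (l < density3 x y z)%R -> (density3 x y z < u)%R ->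
  exists2 r : R, (0 < r)%R & forall x' y' z', (`|x - x'| < r)%R ->
    (`|y - y'| < r)%R -> (`|z - z'| < r)%R ->
    (l < density3 x' y' z' < u)%R.
Proof.
move=> x0 y0 z0 lq qu.
pose F := nbhs (x, (y, z)).
have c1 : v.1 @[v --> F] --> x by exact: cvg_fst.
have c23 : v.2 @[v --> F] --> (y, z) by exact: cvg_snd.
have c2 : v.2.1 @[v --> F] --> y by apply: cvg_comp c23 _; exact: cvg_fst.
have c3 : v.2.2 @[v --> F] --> z by apply: cvg_comp c23 _; exact: cvg_snd.
have xz : (0 < x * z)%R by rewrite mulr_gt0.
have k0 : (0 < x * z + 1)%R by rewrite addr_gt0.
have k1 : (0 < x * z + 1 + y)%R by rewrite addr_gt0.
have yz : (0 < y * z)%R by rewrite mulr_gt0.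
have ck : (v.1 * v.2.2 + 1)%R @[v --> F] --> (x * z + 1)%R.
  by apply: cvgD; [exact: cvgM|exact: cvg_cst].
have cky : (v.1 * v.2.2 + 1 + v.2.1)%R @[v --> F] --> (x * z + 1 + y)%R.
  exact: cvgD.
have cV (g : R * (R * R) -> R) (a : R) : (0 < a)%R -> g v @[v --> F] --> a ->
    (g v)^-1%R @[v --> F] --> a^-1%R.
  by move=> a0; apply: cvgV; rewrite gt_eqF.
have cP (g : R * (R * R) -> R) (a : R) : (0 < a)%R -> g v @[v --> F] --> a ->
    p (g v) @[v --> F] --> p a.
  by move=> a0 ga; apply: cvg_comp ga _; exact: cp.
have cq : density3 v.1 v.2.1 v.2.2 @[v --> F] --> density3 x y z.
  apply: cvgM; last by apply: cvg_norm; exact: cV.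
  apply: cvgM; last by apply: cvg_norm; exact: cV.
  apply: cvgM; first apply: cvgM.
  - apply: cP; first by rewrite divr_gt0.
    by apply: cvgM => //; apply: cV => //; exact: cvgM.
  - apply: cP; first by rewrite divr_gt0// mulr_gt0.
    by apply: cvgM; [exact: cvgM|exact: cV].
  - apply: cP; first by rewrite divr_gt0// mulr_gt0.
    by apply: cvgM; [exact: cvgM|exact: cV].
have : \forall v \near F, (l < density3 v.1 v.2.1 v.2.2 < u)%R.
  near=> v; apply/andP; split; near: v; first exact: (cvgr_gt _ cq).
  exact: (cvgr_lt _ cq).
move=> [V [/= /nbhs_ballP[r1 /= r10 V1]]].
move=> [V' [/= /nbhs_ballP[r2 /= r20 V2] /nbhs_ballP[r3 /= r30 V3]] V'2] VF.
exists (Num.min r1 (Num.min r2 r3)); first by rewrite !lt_min r10 r20 r30.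
move=> x' y' z'; rewrite !lt_min => /and3P[hx _ _] /and3P[_ hy _] /and3P[_ _ hz].
apply: (VF (x', (y', z'))); split; first exact: V1.
by apply: V'2; split; [exact: V2|exact: V3].
Unshelve. all: by end_near. Qed.

Let sq2_gt0 (r : R) : (0 < r)%R -> (0 < (2 * r) ^+ 2)%R.
Proof. by move=> r0; rewrite exprn_gt0// mulr_gt0. Qed.

Let mu_ball_gt0 (c r : R) : (0 < r)%R ->
  0 < mu `](c - r)%R, (c + r)%R[%classic.
Proof.
move=> r0; rewrite lebesgue_measure_itv/= lte_fin ifT; last by lra.
by rewrite -EFinB lte_fin; lra.
Qed.

(** For boxes, the factor [L y A] depends on [A] only and the other factor on [C] only, so the
    product identity holds for [box_density] at almost every [y]. A strict inequality between the
    pointwise products would persist on small boxes and contradict it. *)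
Lemma density3_mul (L : R.-pker (measurableTypeR R) ~> (measurableTypeR R)) :
  (forall A, measurable A ->
    is_cond_prob P (sigma_gen (Zsum gamma) 3) (Xprod gamma 3 @^-1` A)
      (fun w => L (Zsum gamma 3 w) A)) ->
  forall x x' y z z', (0 < x)%R -> (0 < x')%R -> (0 < y)%R -> (0 < z)%R ->
    (0 < z')%R ->
  (density3 x y z * density3 x' y z' = density3 x' y z * density3 x y z')%R.
Proof.
move=> HL.
(* Exchanging [x] and [x'] exchanges the two sides, so one inequality is enough. *)
suff H x x' y z z' : (0 < x)%R -> (0 < x')%R -> (0 < y)%R -> (0 < z)%R ->
    (0 < z')%R ->
    (density3 x y z * density3 x' y z' <= density3 x' y z * density3 x y z')%R.
  by move=> x x' y z z' *; apply/eqP; rewrite eq_le !H.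
move=> x0 x'0 y0 z0 z'0; rewrite leNgt; apply/negP => hlt.
have [s [s0 s1 s2 hs]] := product_gap (density3_ge0 x y z)
  (density3_ge0 x' y z') (density3_ge0 x' y z) (density3_ge0 x y z') hlt.
have N v w : (0 < v)%R -> (0 < w)%R -> exists2 r : R, (0 < r)%R &
    forall x2 y2 z2, (`|v - x2| < r)%R -> (`|y - y2| < r)%R ->
    (`|w - z2| < r)%R -> (density3 v y w - s < density3 x2 y2 z2 <
      density3 v y w + s)%R.
  by move=> v0 w0; apply: near_density3; rewrite ?ltrBlDr ?ltrDl.
have [r1 r10 N1] := N x z x0 z0; have [r2 r20 N2] := N x' z' x'0 z'0.
have [r3 r30 N3] := N x' z x'0 z0; have [r4 r40 N4] := N x z' x0 z'0.
pose r := Num.min (Num.min (Num.min r1 r2) (Num.min r3 r4))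
  (Num.min y (Num.min (Num.min x x') (Num.min z z'))).
have r0 : (0 < r)%R.
  by rewrite /r !lt_min r10 r20 r30 r40 y0 x0 x'0 z0 z'0.
(* Unfolding the second occurrence only yields all the upper bounds on [r] at once. *)
have : (r <= r)%R by [].
rewrite {2}/r !le_min.
move=> /and3P[/andP[/andP[rr1 rr2] /andP[rr3 rr4]] ry].
move=> /andP[/andP[rx rx'] /andP[rz rz']].
clearbody r.
pose I c := (`](c - r)%R, (c + r)%R[%classic : set R).
have mI c : measurable (I c) by exact: measurable_itv.
have Ir c v t : (r <= t)%R -> (v \in I c) -> (`|c - v| < t)%R.
  move=> rt; rewrite inE /I /= in_itv/= => hv.
  by apply: lt_le_trans rt; rewrite ltr_distlC.
have mE (A : set R) d' (S : measurableType d') (h : S -> R) : measurable A ->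
    measurable_fun setT h -> measurable_fun setT (fun s => \1_A (h s) : R).
  by move=> mA mh; apply: (measurableT_comp _ mh); exact: measurable_indic.
have mbox v w (h : R * R -> R) : measurable_fun setT h ->
    measurable_fun setT (fun t : R * R =>
      (\1_(I v) t.2 * \1_(I w) t.1 * h t)%:E : \bar R).
  move=> mh; apply/measurable_EFinP; apply: measurable_funM => //.
  by apply: measurable_funM; apply: mE; mfun.
have lower v w y' (m : R) : (r <= v)%R -> (r <= w)%R -> (0 <= m)%R ->
    (forall v' w', v' \in I v -> w' \in I w -> (m <= density3 v' y' w')%R) ->
    (m * (2 * r) ^+ 2)%:E <= box_density (I v) (I w) y'.
  move=> rv rw m0 hm; rewrite -(int_box r0 rv rw m0).
  apply: (le_integral_pos2
    (F := fun w' v' => (\1_(I v) v' * \1_(I w) w' * m)%:E)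
    (G := fun w' v' => (\1_(I v) v' * \1_(I w) w' * density3 v' y' w')%:E)).
  - by move=> w' v'; rewrite lee_fin !mulr_ge0.
  - by move=> w' v'; rewrite lee_fin !mulr_ge0.
  - exact: (mbox v w (cst m) (measurable_cst m)).
  - exact: (mbox v w (fun t => density3 t.2 y' t.1) (mq y')).
  - move=> w' v'; rewrite lee_fin !indicE.
    have [hv|_] := boolP (v' \in I v); last by rewrite !mul0r.
    have [hw|_] := boolP (w' \in I w); last by rewrite mulr0 !mul0r.
    by rewrite !mul1r; exact: hm.
have upper v w y' (m : R) : (r <= v)%R -> (r <= w)%R -> (0 <= m)%R ->
    (forall v' w', v' \in I v -> w' \in I w -> (density3 v' y' w' <= m)%R) ->
    box_density (I v) (I w) y' <= (m * (2 * r) ^+ 2)%:E.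
  move=> rv rw m0 hm; rewrite -(int_box r0 rv rw m0).
  apply: (le_integral_pos2
    (F := fun w' v' => (\1_(I v) v' * \1_(I w) w' * density3 v' y' w')%:E)
    (G := fun w' v' => (\1_(I v) v' * \1_(I w) w' * m)%:E)).
  - by move=> w' v'; rewrite lee_fin !mulr_ge0.
  - by move=> w' v'; rewrite lee_fin !mulr_ge0.
  - exact: (mbox v w (fun t => density3 t.2 y' t.1) (mq y')).
  - exact: (mbox v w (cst m) (measurable_cst m)).
  - move=> w' v'; rewrite lee_fin !indicE.
    have [hv|_] := boolP (v' \in I v); last by rewrite !mul0r.
    have [hw|_] := boolP (w' \in I w); last by rewrite mulr0 !mul0r.
    by rewrite !mul1r; exact: hm.
have ae v w := ae_box_density (HL _ (mI v)) (mI v) (mI w).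
(* Four almost-everywhere identities hold together off a null set, which cannot cover the ball [I y]
   of positive measure. *)
have [y' [y'I e1 e2 e3 e4]] : exists y', [/\ y' \in I y,
    box_density (I x) (I z) y' = L y' (I x) * box_density setT (I z) y',
    box_density (I x') (I z') y' = L y' (I x') * box_density setT (I z') y',
    box_density (I x') (I z) y' = L y' (I x') * box_density setT (I z) y' &
    box_density (I x) (I z') y' = L y' (I x) * box_density setT (I z') y'].
  apply: contrapT => hno.
  have ae4 : {ae mu, forall y', D y' -> y' \notin I y}.
    have h1 := ae x z; have h2 := ae x' z'; have h3 := ae x' z; have h4 := ae x z'.
    have aeF : Filter (almost_everywhere mu) by exact: ae_filter_ringOfSetsType.
    apply: filterS (filterI (filterI h1 h2) (filterI h3 h4)) => y' [[{}h1 {}h2] [{}h3 {}h4]] Dy.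
    apply/negP => yI; apply: hno; exists y'; split => //;
      [exact: h1|exact: h2|exact: h3|exact: h4].
  have [B [mB B0 IB]] := ae4.
  have IyB : I y `<=` B.
    move=> y' yI; apply: IB => /= h.
    have Dy : y' \in `]0%R, +oo[.
      move: yI; rewrite /I /= !in_itv/= andbT => /andP[+ _].
      by apply: le_lt_trans; rewrite subr_ge0.
    by move: (h Dy); rewrite mem_set.
  have : mu (I y) <= mu B.
    by apply: (le_measure mu) IyB; rewrite inE//; exact: mI.
  by rewrite B0 leNgt (mu_ball_gt0 y r0).
(* Both products consist of the same four factors. *)
have E : box_density (I x) (I z) y' * box_density (I x') (I z') y' =
    box_density (I x') (I z) y' * box_density (I x) (I z') y'.
  by rewrite e1 e2 e3 e4 muleACA [in RHS]muleACA [in RHS](muleC (L y' (I x'))).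
have b1 : ((density3 x y z - s) * (2 * r) ^+ 2)%:E <= box_density (I x) (I z) y'.
  apply: (lower x z y' _ rx rz (ltW s1)).
  by move=> v' w' hv hw; have /andP[/ltW] := N1 v' y' w' (Ir _ _ _ rr1 hv)
    (Ir _ _ _ rr1 y'I) (Ir _ _ _ rr1 hw).
have b2 : ((density3 x' y z' - s) * (2 * r) ^+ 2)%:E <= box_density (I x') (I z') y'.
  apply: (lower x' z' y' _ rx' rz' (ltW s2)).
  by move=> v' w' hv hw; have /andP[/ltW] := N2 v' y' w' (Ir _ _ _ rr2 hv)
    (Ir _ _ _ rr2 y'I) (Ir _ _ _ rr2 hw).
have b3 : box_density (I x') (I z) y' <= ((density3 x' y z + s) * (2 * r) ^+ 2)%:E.
  apply: (upper x' z y' _ rx' rz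
    (addr_ge0 (density3_ge0 x' y z) (ltW s0))).
  by move=> v' w' hv hw; have /andP[_ /ltW] := N3 v' y' w' (Ir _ _ _ rr3 hv)
    (Ir _ _ _ rr3 y'I) (Ir _ _ _ rr3 hw).
have b4 : box_density (I x) (I z') y' <= ((density3 x y z' + s) * (2 * r) ^+ 2)%:E.
  apply: (upper x z' y' _ rx rz'
    (addr_ge0 (density3_ge0 x y z') (ltW s0))).
  by move=> v' w' hv hw; have /andP[_ /ltW] := N4 v' y' w' (Ir _ _ _ rr4 hv)
    (Ir _ _ _ rr4 y'I) (Ir _ _ _ rr4 hw).
have r2' := sq2_gt0 r0.
have low : ((density3 x y z - s) * (2 * r) ^+ 2)%:E *
    ((density3 x' y z' - s) * (2 * r) ^+ 2)%:E <=
    box_density (I x) (I z) y' * box_density (I x') (I z') y'.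
  apply: lee_pmul b1 b2; rewrite lee_fin.
    exact: mulr_ge0 (ltW s1) (ltW r2').
  exact: mulr_ge0 (ltW s2) (ltW r2').
have up : box_density (I x') (I z) y' * box_density (I x) (I z') y' <=
    ((density3 x' y z + s) * (2 * r) ^+ 2)%:E *
    ((density3 x y z' + s) * (2 * r) ^+ 2)%:E.
  by apply: lee_pmul b3 b4; exact: box_density_ge0.
have := le_trans low (le_trans (eq_ind_r (fun u => u <= _) (lexx _) E) up).
rewrite -!EFinM lee_fin leNgt => /negP; apply.
rewrite mulrACA [ltRHS]mulrACA ltr_pM2r; first exact: hs.
exact: (mulr_gt0 r2' r2').
Qed.

End necessity.

(** * Necessity of the GIG law *)

Section density_modification.
Local Open Scope ereal_scope.
Context d (T : measurableType d) (R : realType) (P : probability T R).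
Notation mu := (@lebesgue_measure R).
Notation D := (`]0%R, +oo[%classic : set R).

Lemma has_density_eq (X : {RV P >-> R}) (f g : R -> R) :
  has_density X f -> measurable_fun setT g -> (forall x, (0 <= g x)%R) ->
  (forall x, x != 0%R -> f x = g x) -> has_density X g.
Proof.
move=> [mf f0 fE] mg g0 fg; split => // A mA; rewrite fE//.
apply: ae_eq_integral => //.
- by apply: measurable_funTS; exact/measurable_EFinP.
- by apply: measurable_funTS; exact/measurable_EFinP.
- exists [set 0%R]; split => //; first exact: lebesgue_measure_set1.
  move=> x /= H; apply: contrapT => /eqP x0; apply: H => _.
  by rewrite fg.
Qed.

(** The support condition leaves the value at 0 open; the indicator makes it 0, a change at one
    point only. *)
Lemma has_density_pos (X : {RV P >-> R}) (f : R -> R) :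
  has_density X f -> (forall x, (x < 0)%R -> f x = 0%R) ->
  has_density X (fun x => f x * \1_D x)%R.
Proof.
move=> Xf fN; have [mf f0 _] := Xf.
apply: (has_density_eq Xf).
- by apply: measurable_funM => //; exact: measurable_indic.
- by move=> x; rewrite mulr_ge0.
- move=> x; rewrite indicE neq_lt => /orP[x0|x0].
    by rewrite fN// mul0r.
  by rewrite mem_set ?mulr1//= in_itv/= x0.
Qed.

Lemma has_density_total (X : {RV P >-> R}) (f : R -> R) :
  has_density X f -> (forall x, (x <= 0)%R -> f x = 0%R) ->
  \int[mu]_(x in D) (f x)%:E = 1.
Proof.
move=> [mf f0 fE] fN.
have : distribution P X setT = 1.
  by rewrite /distribution /pushforward preimage_setT probability_setT.
rewrite fE// => <-; rewrite integral_mkcond; apply: eq_integral => x _.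
rewrite patchE; case: ifPn => //; rewrite notin_setE/= in_itv/= andbT => /negP.
by rewrite -leNgt => /fN ->.
Qed.

End density_modification.

Section inverse_not_integrable.
Local Open Scope ereal_scope.
Context (R : realType).
Notation mu := (@lebesgue_measure R).
Notation D := (`]0%R, +oo[%classic : set R).

(* The integral of [1 / x] over [[1, +oo[] is unchanged when the domain is
   shrunk to [[2, +oo[], by scaling. *)
Lemma integral_inv_infty (q : R -> R) : measurable_fun setT q ->
  (forall x, (0 <= q x)%R) -> (forall x, (1 <= x)%R -> (x^-1 <= q x)%R) ->
  \int[mu]_(x in D) (q x)%:E = +oo.
Proof.
move=> mq q0 qx.
pose h (c x : R) := (\1_(`[c, +oo[%classic : set R) x * `|x^-1|)%R.
have h0 c x : (0 <= h c x)%R by rewrite mulr_ge0.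
have mh c : measurable_fun setT (h c).
  apply: measurable_funM; first exact: measurable_indic.
  by apply: measurableT_comp => //; exact: measurable_funV.
have mhE c : measurable_fun setT (fun x : measurableTypeR R => (h c x)%:E).
  by apply/measurable_EFinP; exact: mh.
have mqE : measurable_fun setT (fun x : measurableTypeR R => (q x)%:E).
  exact/measurable_EFinP.
pose J := \int[mu]_(x in D) (h 1%R x)%:E.
have JE : J = \int[mu]_(x in D) (h 2 x)%:E.
  rewrite /J (@integral_pos_scale _ 2 (fun x => (h 1%R x)%:E))//; last 2 first.
  - by move=> x; rewrite lee_fin.
  - exact: mhE.
  apply: eq_integral => x; rewrite inE/= in_itv/= andbT => x0.
  rewrite -EFinM /h !indicE; congr EFin.
  have -> : ((x / 2)%R \in `[1%R, +oo[%classic) = (x \in `[2%R, +oo[%classic).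
    by apply/idP/idP; rewrite !inE/= !in_itv/= !andbT => h1; lra.
  rewrite -mulrA; congr (_ * _)%R.
  rewrite !ger0_norm ?invr_ge0 ?divr_ge0 ?ltW//.
  by field; rewrite gt_eqF.
have Jq : J <= \int[mu]_(x in D) (q x)%:E.
  apply: ge0_le_integral => //.
  - by move=> x _; rewrite lee_fin.
  - by apply: measurable_funTS; exact: mhE.
  - by apply: measurable_funTS; exact: mqE.
  - move=> x _; rewrite lee_fin /h indicE.
    have [|_] := boolP (x \in _); last by rewrite mul0r.
    rewrite inE/= in_itv/= andbT => x1; rewrite mul1r ger0_norm; first exact: qx.
    by rewrite invr_ge0 (le_trans _ x1).
(* On [[1, 2[] the function [1 / x] is at least [1 / 2], and this piece has been lost in passing
   from [h 1] to [h 2]. So [J] exceeds itself by [1 / 2], unless it is infinite. *)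
have Jge : J + (2^-1)%:E <= J.
  rewrite {1}JE.
  have mI : measurable (`[1%R, 2%R[%classic : set R) by exact: measurable_itv.
  have <- : \int[mu]_(x in D) (\1_(`[1%R, 2%R[%classic : set R) x * 2^-1)%:E =
      (2^-1)%:E.
    under eq_integral do rewrite EFinM.
    rewrite ge0_integralZr//; last first.
      by apply/measurable_EFinP; exact: measurable_indic.
    rewrite integral_indic//.
    have -> : `[1%R, 2%R[%classic `&` D = `[1%R, 2%R[%classic.
      apply/seteqP; split => v /=; rewrite !in_itv/= andbT; first by case.
      by move=> /andP[h1 h2]; split; [rewrite h1 h2|rewrite (lt_le_trans _ h1)].
    have mu1 : mu (`[1%R, 2%R[%classic : set R) = 1.
      rewrite lebesgue_measure_itv/= lte_fin ifT; last by lra.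
      by rewrite -EFinB; congr EFin; ring.
    by rewrite [X in X * _]mu1 mul1e.
  rewrite -ge0_integralD//; last 3 first.
  - by move=> x _; rewrite lee_fin.
  - by apply: measurable_funTS; exact: mhE.
  - apply: measurable_funTS; apply/measurable_EFinP.
    by apply: measurable_funM => //; exact: measurable_indic.
  apply: ge0_le_integral => //.
  - by move=> x _; rewrite -EFinD lee_fin addr_ge0// mulr_ge0.
  - apply: measurable_funTS; apply: emeasurable_funD; first exact: mhE.
    by apply/measurable_EFinP; apply: measurable_funM => //; exact: measurable_indic.
  - by apply: measurable_funTS; exact: mhE.
  - move=> x; rewrite /= in_itv/= andbT => x0; rewrite -EFinD lee_fin /h !indicE.
    rewrite ger0_norm ?invr_ge0 ?(ltW x0)//.
    have Ey c : (x \in `[c, +oo[%classic) = (c <= x)%R.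
      by apply/idP/idP; rewrite inE/= in_itv/= andbT.
    have E2 : (x \in `[1%R, 2%R[%classic) = (1 <= x < 2)%R.
      by apply/idP/idP; rewrite inE/= in_itv.
    rewrite !{}Ey {}E2.
    have [x2|x2] := leP 2%R (x : R).
      by rewrite andbF mul0r addr0 (le_trans _ x2)// ler1n.
    rewrite mul0r add0r andbT.
    have [x1|x1] := leP 1%R (x : R); last by rewrite !mul0r.
    by rewrite !mul1r lef_pV2 ?posrE// ltW.
have J0 : 0 <= J by apply: integral_ge0 => x _; rewrite lee_fin.
have : J = +oo.
  apply/eqP; apply: contraT => Jfin.
  have Jf : J \is a fin_num by rewrite ge0_fin_numE// ltey.
  move: Jge; rewrite -leeBrDl// subee// lee_fin leNgt.
  by rewrite invr_gt0 ltr0n.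
by move=> JE'; apply/eqP; rewrite -leye_eq -JE'.
Qed.

End inverse_not_integrable.

Lemma gig_of_kernel d (T : measurableType d) (R : realType)
    (P : probability T R) (gamma : nat -> {RV P >-> R}) (f : R -> R)
    (L : R.-pker (measurableTypeR R) ~> (measurableTypeR R)) :
  mutually_independent gamma -> (forall n, has_density (gamma n) f) ->
  C1_supported_on_Rplus f ->
  (forall A, measurable A ->
    is_cond_prob P (sigma_gen (Zsum gamma) 3) (Xprod gamma 3 @^-1` A)
      (fun w => L (Zsum gamma 3 w) A)) ->
  exists a lambda : R, 0 < a /\
    forall n, has_density (gamma n) (gig_pdf lambda a).
Proof.
move=> indep dens [fN fd fc] HL.
set D := (`]0, +oo[%classic : set R).
have mD : measurable (D : set (measurableTypeR R)) by exact: measurable_itv.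
pose p x := f x * \1_D x.
have densp n : has_density (gamma n) p by exact: has_density_pos.
have pP x : 0 < x -> p x = f x.
  by move=> x0; rewrite /p indicE mem_set ?mulr1//= /D /= in_itv/= x0.
have p_pos x : x <= 0 -> p x = 0.
  by move=> x0; rewrite /p indicE memNset ?mulr0// /D /= in_itv/= andbT ltNge x0.
have f0 x : 0 <= f x by have [_ + _] := dens 0%N; exact.
have fd' t : 0 < t -> derivable f t 1.
  by move=> t0; apply: fd; rewrite in_itv/= t0.
have fc' t : 0 < t -> {for t, continuous (derive1 f)}.
  by move=> t0; apply: fc; rewrite in_itv/= t0.
have cp t : 0 < t -> {for t, continuous p}.
  move=> t0; have cf : {for t, continuous f}.
    exact/differentiable_continuous/derivable1_diffP/fd'.
  change (p x @[x --> t] --> p t); rewrite (pP t t0); apply: cvg_trans cf; apply: near_eq_cvg.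
  by near=> s; rewrite pP//; near: s; exact: lt_nbhsr.
have mul3 x x' y z z' : 0 < x -> 0 < x' -> 0 < y -> 0 < z -> 0 < z' ->
    joint3 f x y z * joint3 f x' y z' = joint3 f x' y z * joint3 f x y z'.
  move=> x0 x'0 y0 z0 z'0.
  have E v w : 0 < v -> 0 < w ->
      density3 p v y w = joint3 f v y w * (`|y^-1| * `|w^-1|).
    move=> v0 w0; have vw : 0 < v * w by rewrite mulr_gt0.
    rewrite /density3 -mulrA /joint3 !pP//.
    - by rewrite divr_gt0 ?mulr_gt0 ?addr_gt0.
    - by rewrite divr_gt0 ?mulr_gt0 ?addr_gt0.
    - by rewrite divr_gt0 ?mulr_gt0 ?addr_gt0.
  have := density3_mul indep densp p_pos cp HL x0 x'0 y0 z0 z'0.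
  rewrite !E// mulrACA [RHS]mulrACA; apply: mulIf.
  by rewrite !mulf_neq0// normr_eq0 invr_eq0 gt_eqF.
have [m [m0 fm]] : exists m, 0 < m /\ 0 < f m.
  apply: contrapT => H; have := has_density_total (densp 0%N) p_pos.
  rewrite integral0_eq => [/eqP|x Dx]; first by rewrite eq_sym onee_eq0.
  congr EFin; apply/eqP; apply: contraT => px; case: H.
  move: Dx; rewrite /= in_itv/= andbT => x0; exists x; split => //.
  by rewrite lt_neqAle f0 andbT eq_sym -(pP x x0).
have [k [al [C [C0 fE]]]] := functional_equation_solution fd' fc' f0 mul3 m0 fm.
have tot := has_density_total (densp 0%N) p_pos.
have mp : measurable_fun setT p by have [] := densp 0%N.
have p0 x : 0 <= p x by have [_ + _] := densp 0%N; exact.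
(* If [k >= 0], then [f x >= C * x ^ (- al)]. For [al <= 1] this is not integrable at infinity; for
   [al > 1] it is not integrable at 0, which the inversion [x = 1 / y] moves to infinity. *)
have k0 : k < 0.
  rewrite ltNge; apply/negP => k0.
  have lower x : 0 < x -> C * expR (- al * ln x) <= p x.
    move=> x0; rewrite pP// fE// ler_pM2l// ler_expR mulNr lerDr.
    by rewrite mulr_ge0// addr_ge0 ?invr_ge0// ltW.
  have expln (x : R) : 0 < x -> expR (- ln x) = x^-1.
    by move=> x0; rewrite expRN lnK.
  have [al1|al1] := leP al 1.
    have : (\int[@lebesgue_measure R]_(x in D) (C^-1 * p x)%:E = +oo)%E.
      apply: integral_inv_infty.
      - by apply: measurable_funM.
      - by move=> x; rewrite mulr_ge0// invr_ge0 ltW.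
      - move=> x x1; have x0 : 0 < x := lt_le_trans ltr01 x1.
        rewrite -ler_pdivrMl ?invr_gt0// invrK (le_trans _ (lower x x0))//.
        rewrite ler_pM2l// -expln// ler_expR mulNr lerN2.
        by rewrite ler_piMl// ln_ge0.
    under eq_integral do rewrite EFinM.
    rewrite ge0_integralZl//; last 3 first.
    - by apply: measurable_funTS; exact/measurable_EFinP.
    - by move=> x _; rewrite lee_fin.
    - by rewrite lee_fin invr_ge0 ltW.
    by rewrite tot mule1.
  have : (\int[@lebesgue_measure R]_(y in D) (C^-1 * (p (1 / y) * (1 / y ^+ 2)))%:E = +oo)%E.
    apply: integral_inv_infty.
    - apply: measurable_funM => //; apply: measurable_funM.
        by apply: measurableT_comp => //; apply: measurable_funM => //; exact: measurable_funV.
      by apply: measurable_funM => //; apply: measurable_funV; exact: measurable_funX.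
    - by move=> y; rewrite !mulr_ge0// ?invr_ge0 ?sqr_ge0// ltW.
    - move=> y y1; have y0 : 0 < y := lt_le_trans ltr01 y1.
      have y'0 : 0 < 1 / y by rewrite divr_gt0.
      rewrite -ler_pdivrMl ?invr_gt0// invrK.
      apply: le_trans (ler_wpM2r _ (lower _ y'0)); last first.
        by rewrite divr_ge0// sqr_ge0.
      rewrite -mulrA ler_pM2l// div1r lnV ?posrE// mulrNN.
      rewrite -ler_pdivrMr ?divr_gt0 ?exprn_gt0//.
      rewrite (_ : y^-1 / (1 / y ^+ 2) = y); last by field; rewrite gt_eqF.
      rewrite -[leLHS]lnK ?posrE// ler_expR.
      by apply: ler_peMl; [exact: ln_ge0|exact: ltW].
  under eq_integral do rewrite EFinM.
  rewrite ge0_integralZl//; last 3 first.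
  - apply: measurable_funTS; apply/measurable_EFinP; apply: measurable_funM.
      by apply: measurableT_comp => //; apply: measurable_funM => //; exact: measurable_funV.
    by apply: measurable_funM => //; apply: measurable_funV; exact: measurable_funX.
  - by move=> x _; rewrite lee_fin mulr_ge0// divr_ge0// sqr_ge0.
  - by rewrite lee_fin invr_ge0 ltW.
  have := @integral_pos_inv R 1 (fun x => (p x)%:E) ltr01.
  move=> /(_ (fun x => p0 x)) => E.
  under eq_integral do rewrite EFinM.
  rewrite -E; last exact/measurable_EFinP.
  by rewrite tot mule1.
(* Matching exponents: [a ^+ 2 / 2 = - k] and [lambda - 1 = - al]. *)
have a2 : Num.sqrt (- k * 2) ^+ 2 / 2 = - k.
  by rewrite sqr_sqrtr; [field|rewrite mulr_ge0// oppr_ge0 ltW].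
exists (Num.sqrt (- k * 2)), (1 - al); split.
  by rewrite sqrtr_gt0 mulr_gt0// oppr_gt0.
set a := Num.sqrt _ in a2 *.
pose w x := x `^ (1 - al - 1) * expR (- (a ^+ 2 / 2) * (x + x^-1)).
have fw x : 0 < x -> f x = C * w x.
  move=> x0; rewrite fE// /w a2 opprK /powR gt_eqF//.
  by rewrite -expRD; congr (C * expR _); ring.
(* Total mass 1 makes the inverse of [C] the integral of [w], which is twice the Macdonald
   function. *)
have CM : C = (2 * macdonald (1 - al) (a ^+ 2))^-1.
  rewrite /macdonald mulrA mulfV// mul1r /Rintegral.
  have <- : (C^-1%:E = \int[@lebesgue_measure R]_(x in D) (w x)%:E)%E.
    rewrite -[LHS]mule1 -tot -ge0_integralZl//; last 3 first.
    - by apply: measurable_funTS; exact/measurable_EFinP.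
    - by move=> x _; rewrite lee_fin.
    - by rewrite lee_fin invr_ge0 ltW.
    apply: eq_integral => x; rewrite inE/= in_itv/= andbT => x0.
    by rewrite -EFinM pP// fw// mulKf// gt_eqF.
  by rewrite /= invrK.
move=> n; suff -> : gig_pdf (1 - al) a = p by [].
apply/funext => x; rewrite /gig_pdf; case: ltP => x0; last by rewrite p_pos.
by rewrite pP// fw// -CM mulrA.
Unshelve. all: by end_near. Qed.

(** * Sufficiency of the GIG law *)

Lemma density_kernel d d' (S : measurableType d) (Y : measurableType d')
    (R : realType) (m : {sigma_finite_measure set Y -> \bar R})
    (w : S -> Y -> R) :
  (forall s x, 0 <= w s x) ->
  measurable_fun setT (fun v : S * Y => w v.1 v.2) ->
  exists K : R.-ker S ~> Y, forall s A, measurable A ->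
    K s A = (\int[m]_(x in A) (w s x)%:E)%E.
Proof.
move=> w0 mw.
have mws s : measurable_fun setT (fun x => (w s x)%:E).
  apply/measurable_EFinP.
  exact: (measurableT_comp mw (measurable_fun_pair (measurable_cst s)
    (@measurable_id _ Y setT))).
have w0s s x : (0 <= (w s x)%:E)%E by rewrite lee_fin.
pose k s (A : set Y) : \bar R := (\int[m]_(x in A) (w s x)%:E)%E.
have k0 s : k s set0 = 0%E by rewrite /k integral_set0.
have k_ge0 s A : (0 <= k s A)%E by apply: integral_ge0.
have k_sigma s : semi_sigma_additive (k s).
  have h := @semi_sigma_additive_nng_induced _ _ _ m _ (mws s) (w0s s).
  exact: h.
pose K0 s : {measure set Y -> \bar R} :=
  HB.pack (k s) (isMeasure.Build _ _ _ (k s) (k0 s) (k_ge0 s) (@k_sigma s)).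
have mK A : measurable A -> measurable_fun setT (K0 ^~ A).
  move=> mA.
  pose H := (fun z : S * Y => (w z.1 z.2)%:E) \_ (setT `*` A).
  have mSA : measurable (setT `*` A : set (S * Y)) by exact: measurableX.
  have mH : measurable_fun setT H.
    apply/(measurable_restrictT _ mSA); apply: measurable_funTS.
    exact/measurable_EFinP.
  have H0 z : (0 <= H z)%E by apply: erestrict_ge0.
  have := @measurable_fun_fubini_tonelli_F _ _ S Y R m H mH H0.
  apply: eq_measurable_fun => s _; rewrite /fubini_F [RHS]integral_mkcond.
  apply: eq_integral => x _; rewrite /H !patchE.
  by rewrite in_setX /= in_setT.
pose K : R.-ker S ~> Y := HB.pack K0 (isKernel.Build _ _ _ _ _ K0 mK).
by exists K.
Qed.

(** * The weight of the candidate kernel and its normalisation *)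

Section gig_weight.
Context (R : realType) (b l : R).
Hypothesis b0 : 0 < b.
Notation mu := (@lebesgue_measure R).
Notation D := (`]0%R, +oo[%classic : set R).

(** At [z = 1] and [b = a ^+ 2 / 2] this is the unnormalised density of GIG(l, a, a); the indicator
    lets integrals run over the whole line. *)
Definition gig_weight (z x : R) : R :=
  \1_D x * x `^ (l - 1) * expR (- (b / z) * (x + x^-1)).

Lemma gig_weight_ge0 z x : 0 <= gig_weight z x.
Proof. by rewrite !mulr_ge0 ?powR_ge0 ?expR_ge0. Qed.

Lemma gig_weight_pos z x : 0 < x ->
  gig_weight z x = x `^ (l - 1) * expR (- (b / z) * (x + x^-1)).
Proof. by move=> x0; rewrite /gig_weight indicE mem_set ?mul1r//= in_itv/= x0. Qed.

Lemma gig_weight_neg z x : x <= 0 -> gig_weight z x = 0.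
Proof. by move=> x0; rewrite /gig_weight indicE memNset ?mul0r//= in_itv/= andbT ltNge x0. Qed.

Lemma measurable_gig_weight d (T : measurableType d) (a c : T -> R) :
  measurable_fun setT a -> measurable_fun setT c ->
  measurable_fun setT (fun t => gig_weight (a t) (c t)).
Proof.
move=> ma mc; apply: measurable_funM; first apply: measurable_funM.
- by apply: measurableT_comp => //; exact: measurable_indic.
- by apply: (measurableT_comp (f := fun x => x `^ (l - 1))) => //; exact: measurable_powR.
- apply: measurableT_comp => //; apply: measurable_funM.
    apply: measurableT_comp => //; apply: measurable_funM => //.
    exact: measurable_funV.
  by apply: measurable_funD => //; exact: measurable_funV.
Qed.

(* [gig_weight z] is the unnormalised density of [X_n] given [Z_n = z]; the
   exponential factor on the right does not depend on [x]. *)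
Lemma gig_weightM z x y : 0 < z -> 0 < x -> 0 < y ->
  gig_weight z ((x * z + 1) / y) * gig_weight 1 (x * y / (x * z + 1)) =
  gig_weight y x * expR (- b * (y / z + (z + z^-1) / y)).
Proof.
move=> z0 x0 y0; have xz : 0 < x * z + 1 by rewrite addr_gt0// mulr_gt0.
have u0 : 0 < (x * z + 1) / y by rewrite divr_gt0.
have g0 : 0 < x * y / (x * z + 1) by rewrite divr_gt0// mulr_gt0.
rewrite !gig_weight_pos// mulrACA -powRM ?ltW// -expRD -[RHS]mulrA -expRD.
have -> : (x * z + 1) / y * (x * y / (x * z + 1)) = x.
  by field; rewrite !gt_eqF.
congr (_ * expR _); field.
by rewrite !gt_eqF// mulr_gt0.
Qed.

(** Half of the exponential decay in [t = x + 1 / x] absorbs the power of [x], because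
    [|ln x| <= ln t]; the other half dominates. This covers both signs of [l - 1] and both ends of
    the half-line. *)
Lemma gig_weight_le z : 0 < z -> exists2 C, 0 <= C & forall x, 0 < x ->
  gig_weight z x <= C * expR (- (b / z / 2) * x).
Proof.
move=> z0; pose s := l - 1; pose c := b / z / 2.
have c0 : 0 < c by rewrite !divr_gt0.
(* Chosen so that [|s| * e <= c]; the added 1 avoids division by 0. The constant comes from
   [ln t <= e * t - ln e], which is [ln u <= u] at [u = e * t]. *)
pose e := c / (`|s| + 1).
have s1 : 0 < `|s| + 1 by rewrite ltr_wpDl.
have e0 : 0 < e by rewrite divr_gt0.
exists (expR (`|s| * - ln e)); first exact: expR_ge0.
move=> x x0; rewrite gig_weight_pos// /powR gt_eqF// -!expRD ler_expR -/s.
set t := x + x^-1.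
have x'0 : 0 < x^-1 by rewrite invr_gt0.
have t0 : 0 < t by rewrite addr_gt0.
have lx : `|ln x| <= ln t.
  rewrite ler_norml; apply/andP; split.
    by rewrite lerNl -lnV ?posrE// ler_ln ?posrE// lerDr ltW.
  by rewrite ler_ln ?posrE// lerDl ltW.
have lt : ln t <= e * t - ln e.
  have := ln_sublinear (mulr_gt0 e0 t0).
  by rewrite lnM ?posrE// => h; lra.
have sl : s * ln x <= `|s| * (e * t - ln e).
  rewrite (le_trans (ler_norm _))// normrM ler_wpM2l//.
  exact: le_trans lx lt.
have se : `|s| * e <= c.
  by rewrite /e mulrCA ler_piMr ?(ltW c0)// ler_pdivrMr// mul1r lerDl ler01.
have set_ : `|s| * e * t <= c * t by rewrite ler_wpM2r// ltW.
have cx : c * x <= c * t by rewrite ler_wpM2l ?ltW// /t; lra.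
rewrite (_ : b / z = c * 2); last by rewrite /c; field; rewrite gt_eqF.
by rewrite -/c; move: sl set_ cx; rewrite mulrBr mulrA; lra.
Qed.

(** Finite by comparison with a multiple of the exponential density of rate [c]; nonzero because the
    weight is positive on a set of positive measure. *)
Lemma gig_weight_mass z : 0 < z -> exists2 N : R, 0 < N &
  (\int[mu]_x (gig_weight z x)%:E = N%:E)%E.
Proof.
move=> z0; pose c := b / z / 2.
have c0 : 0 < c by rewrite !divr_gt0.
have mg : measurable_fun setT (fun x : measurableTypeR R => (gig_weight z x)%:E).
  apply/measurable_EFinP.
  have h := measurable_gig_weight (measurable_cst z) (@measurable_id _ R setT).
  exact: h.
have [C C0 gC] := gig_weight_le z0.
have mexp : measurable_fun setT (fun x : measurableTypeR R => (exponential_pdf c x)%:E).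
  apply/measurable_EFinP; have h := @measurable_exponential_pdf R c; exact: h.
have Cc : 0 <= C / c by rewrite divr_ge0// ltW.
have fin : (\int[mu]_x (gig_weight z x)%:E <= (C / c)%:E)%E.
  have -> : ((C / c)%:E = \int[mu]_x ((C / c)%:E * (exponential_pdf c x)%:E))%E.
    rewrite ge0_integralZl// ?integral_exponential_pdf ?mule1//.
    by move=> x _; rewrite lee_fin exponential_pdf_ge0// ltW.
  apply: ge0_le_integral => //.
  - by move=> x _; rewrite lee_fin gig_weight_ge0.
  - exact: measurable_funeM.
  - move=> x _; rewrite -EFinM lee_fin.
    have [x0|x0] := leP x 0.
      by rewrite gig_weight_neg// mulr_ge0// exponential_pdf_ge0// ltW.
    apply: le_trans (gC x x0) _.
    rewrite /exponential_pdf patchE mem_set/=; last by rewrite in_itv/= ltW.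
    by rewrite mulrA divfK// gt_eqF.
have pos : (\int[mu]_x (gig_weight z x)%:E != 0)%E.
  apply/eqP => H.
  have : ae_eq mu setT (fun x => (gig_weight z x)%:E) (cst 0%E).
    apply/(ae_eq_integral_abs _ measurableT mg).
    rewrite -H; apply: eq_integral => x _.
    by rewrite gee0_abs// lee_fin gig_weight_ge0.
  move=> [N [mN N0 sub]].
  have : (mu (D : set R) <= 0)%E.
    rewrite -N0; apply: le_measure; rewrite ?inE//.
    move=> x; rewrite /= in_itv/= andbT => x0; apply: sub => /= /(_ Logic.I).
    rewrite gig_weight_pos// => -[] /eqP; apply/negP.
    by rewrite gt_eqF// mulr_gt0 ?expR_gt0// powR_gt0.
  by rewrite lebesgue_measure_itv/= ltry.
have g0 : (0 <= \int[mu]_x (gig_weight z x)%:E)%E.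
  by apply: integral_ge0 => x _; rewrite lee_fin gig_weight_ge0.
have fn : (\int[mu]_x (gig_weight z x)%:E)%E \is a fin_num.
  by rewrite ge0_fin_numE// (le_lt_trans fin)// ltry.
exists (fine (\int[mu]_x (gig_weight z x)%:E)%E); last by rewrite fineK.
by rewrite -lte_fin fineK// lt_neqAle eq_sym pos.
Qed.

Lemma gig_kernel : exists (L : R.-pker measurableTypeR R ~> measurableTypeR R)
  (N : R -> R), forall z, 0 < z -> 0 < N z /\
    forall A, measurable A ->
      L z A = (\int[mu]_(x in A) (gig_weight z x / N z)%:E)%E.
Proof.
have mg : measurable_fun setT
    (fun v : measurableTypeR R * measurableTypeR R => gig_weight v.1 v.2).
  have h := measurable_gig_weight (@measurable_fst _ _ R R) (@measurable_snd _ _ R R).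
  exact: h.
have [K KE] := @density_kernel _ _ (measurableTypeR R) (measurableTypeR R) R mu
  gig_weight gig_weight_ge0 mg.
(* The Dirac mass at 1 is the default of the normalisation when the mass is zero or infinite, which
   does not occur for [z > 0]. *)
exists (knormalize K \d_(1%R : measurableTypeR R)).
exists (fun z => fine (\int[mu]_x (gig_weight z x)%:E)%E) => z z0.
have [N N0 NE] := gig_weight_mass z0; rewrite NE/=; split => // A mA.
rewrite /knormalize /mnormalize/= KE// NE ifF/=; last by rewrite eqe gt_eqF.
have h := measurable_gig_weight (measurable_cst z) (@measurable_id _ R setT).
under [RHS]eq_integral do rewrite EFinM.
rewrite KE// ge0_integralZr//.
- by apply: measurable_funTS; apply/measurable_EFinP; exact: h.
- by move=> x _; rewrite lee_fin gig_weight_ge0.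
- by rewrite lee_fin invr_ge0 ltW.
Qed.

End gig_weight.

(** * Intertwining of the kernel with one step of the recursion *)

Section gig_intertwining.
Local Open Scope ereal_scope.
Context (R : realType) (b l c : R).
Hypothesis c0 : (0 <= c)%R.
Notation mu := (@lebesgue_measure R).
Notation D := (`]0%R, +oo[%classic : set R).
Variables (L : R.-pker (measurableTypeR R) ~> (measurableTypeR R)) (N : R -> R).
Hypothesis LN : forall z, (0 < z)%R -> (0 < N z)%R /\
  forall A, measurable A ->
    L z A = \int[mu]_(x in A) (gig_weight b l z x / N z)%:E.

Let mgw d (T : measurableType d) (a e : T -> R) :=
  @measurable_gig_weight R b l d T a e.

Let w0 z x : (0 <= gig_weight b l z x)%R. Proof. exact: gig_weight_ge0. Qed.

Local Ltac mfun := repeat first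
  [ assumption | exact: measurable_cst | exact: measurable_id
  | exact: measurable_fst | exact: measurable_snd
  | apply: mgw | apply: measurable_funV
  | apply: measurable_funM | apply: measurable_funD
  | apply: measurable_fun_pair
  | apply: (measurableT_comp measurable_fst)
  | apply: (measurableT_comp measurable_snd) ].

Lemma integral_gig_kernel z (F : R -> \bar R) : (0 < z)%R ->
  (forall x, 0 <= F x) -> measurable_fun setT F ->
  \int[L z]_x F x = \int[mu]_(x in D) (F x * (gig_weight b l z x / N z)%:E).
Proof.
move=> z0 F0 mF; have [N0 LE] := LN z0.
have mw : measurable_fun setT (fun x : measurableTypeR R => (gig_weight b l z x / N z)%R).
  have h : measurable_fun setT (fun x : R => (gig_weight b l z x / N z)%R) by mfun.
  exact: h.
rewrite (@integral_density _ (measurableTypeR R) R mu (L z)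
  (fun x => (gig_weight b l z x / N z)%R))//; last first.
  by move=> x; rewrite divr_ge0 ?(ltW N0)// w0.
rewrite [RHS]integral_mkcond; apply: eq_integral => x _; rewrite patchE.
case: ifPn => //; rewrite notin_setE/= in_itv/= andbT => /negP.
by rewrite -leNgt => x0; rewrite gig_weight_neg// mul0r mule0.
Qed.

(* By [gig_weightM], the density at [(x, y)] of [(g u, g z + 1 / u)], where [u]
   has law [L z] and [g] is a GIG variable, is [gig_weight y x] times a function
   of [y] alone. *)
Lemma gig_kernel_step z (F : R -> R -> \bar R) : (0 < z)%R ->
  (forall x y, 0 <= F x y) ->
  measurable_fun setT (fun v : R * R => F v.1 v.2) ->
  \int[L z]_u \int[mu]_(g in D)
    (F (g * u)%R (g * z + u^-1)%R * (c * gig_weight b l 1 g)%:E) =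
  \int[mu]_(y in D) ((c / N z / y * expR (- b * (y / z + (z + z^-1) / y)))%:E *
    \int[mu]_(x in D) (F x y * (gig_weight b l y x)%:E)).
Proof.
move=> z0 F0 mF; have [N0 LE] := LN z0.
have mFc d (T : measurableType d) (a e : T -> R) : measurable_fun setT a ->
    measurable_fun setT e -> measurable_fun setT (fun t => F (a t) (e t)).
  exact: measurable_uncurry.
pose G u g := F (g * u)%R (g * z + u^-1)%R * (c * gig_weight b l 1 g)%:E.
have G0 u g : 0 <= G u g by rewrite mule_ge0// lee_fin mulr_ge0.
have mG : measurable_fun setT (fun v : R * R => G v.1 v.2).
  apply: emeasurable_funM; first by apply: mFc; mfun.
  by apply/measurable_EFinP; mfun.
have mGu u : measurable_fun setT (G u).
  by apply: (measurable_uncurry mG); mfun.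
rewrite -[LHS]/(\int[L z]_u \int[mu]_(g in D) G u g).
rewrite integral_gig_kernel//; last 2 first.
- by move=> u; apply: integral_ge0.
- exact: measurable_integral_pos.
pose H u g := G u g * (gig_weight b l z u / N z)%:E.
have H0 u g : 0 <= H u g by rewrite mule_ge0// lee_fin divr_ge0// ltW.
have mH : measurable_fun setT (fun v : R * R => H v.1 v.2).
  by apply: emeasurable_funM => //; apply/measurable_EFinP; mfun.
transitivity (\int[mu]_(u in D) \int[mu]_(g in D) H u g).
  apply: eq_integral => u _; rewrite ge0_integralZr//.
  - by apply: measurable_funTS; exact: mGu.
  - by rewrite lee_fin divr_ge0// ltW.
rewrite (integral_pos_subst z0)//.
pose e y := (c / N z / y * expR (- b * (y / z + (z + z^-1) / y)))%R.
have e0 y : (0 < y)%R -> (0 <= e y)%R.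
  by move=> y0; rewrite mulr_ge0 ?expR_ge0// !divr_ge0// ltW.
(* [e] is known to be nonnegative for [y > 0] only; the absolute value makes [K] nonnegative
   everywhere, as [tonelli_pos] asks. *)
pose K x y := F x y * (gig_weight b l y x * `|e y|)%:E.
have me : measurable_fun setT e.
  apply: measurable_funM; first by mfun.
  by apply: measurableT_comp => //; mfun.
have mne : measurable_fun setT (fun y => `|e y|%R) by exact: measurableT_comp.
have K0 x y : 0 <= K x y by rewrite mule_ge0// lee_fin mulr_ge0.
have mK : measurable_fun setT (fun v : R * R => K v.1 v.2).
  apply: emeasurable_funM => //; apply/measurable_EFinP.
  apply: measurable_funM; first by mfun.
  exact: (measurableT_comp mne (@measurable_snd _ _ R R)).
transitivity (\int[mu]_(x in D) \int[mu]_(y in D) K x y).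
  apply: eq_integral => x; rewrite inE/= in_itv/= andbT => x0.
  apply: eq_integral => y; rewrite inE/= in_itv/= andbT => y0.
  have xz : (0 < x * z + 1)%R by rewrite addr_gt0// mulr_gt0.
  rewrite /H /G /K -!muleA -!EFinM.
  have -> : (x * y / (x * z + 1) * ((x * z + 1) / y) = x)%R.
    by field; rewrite !gt_eqF.
  have -> : (x * y / (x * z + 1) * z + ((x * z + 1) / y)^-1 = y)%R.
    by field; rewrite !gt_eqF.
  congr (_ * _%:E); rewrite ger0_norm ?e0// /e.
  rewrite [RHS](_ : _ = gig_weight b l y x *
    expR (- b * (y / z + (z + z^-1) / y)) * (c / N z / y))%R; last by ring.
  by rewrite -gig_weightM//; ring.
rewrite tonelli_pos//; apply: eq_integral => y; rewrite inE/= in_itv/= andbT => y0.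
rewrite -ge0_integralZl//.
- apply: eq_integral => x _; rewrite /K ger0_norm ?e0// mulrC EFinM.
  by rewrite muleCA.
- apply: measurable_funTS; apply: emeasurable_funM; first by apply: mFc; mfun.
  by apply/measurable_EFinP; mfun.
- by move=> x _; rewrite mule_ge0// lee_fin.
- by rewrite lee_fin e0.
Qed.

(** By [gig_kernel_step] both sides are integrals over [y] with the same outer factor, and both
    inner integrals equal [\1_C y * L y A * N y]: the left one by the definition of [L y], the right
    one because [L y] has total mass 1. *)
Lemma gig_kernel_intertwining z (A C : set R) : (0 < z)%R ->
  measurable A -> measurable C ->
  \int[L z]_u \int[mu]_(g in D)
    ((\1_A (g * u) * \1_C (g * z + u^-1))%:E * (c * gig_weight b l 1 g)%:E) =
  \int[L z]_u \int[mu]_(g in D)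
    ((\1_C (g * z + u^-1))%:E * L (g * z + u^-1)%R A *
       (c * gig_weight b l 1 g)%:E).
Proof.
move=> z0 mA mC.
have mLA : measurable_fun setT (fun y : R => L y A).
  exact: (measurable_kernel L A mA).
have mI (E : set R) : measurable E -> measurable_fun setT (\1_E : R -> R).
  by move=> mE; exact: measurable_indic.
rewrite (@gig_kernel_step z (fun x y => (\1_A x * \1_C y)%:E))//; last first.
  apply/measurable_EFinP; apply: measurable_funM.
    exact: (measurableT_comp (mI _ mA) (@measurable_fst _ _ R R)).
  exact: (measurableT_comp (mI _ mC) (@measurable_snd _ _ R R)).
rewrite (@gig_kernel_step z (fun x y => (\1_C y)%:E * L y A))//; last first.
  apply: emeasurable_funM.
    apply/measurable_EFinP.
    exact: (measurableT_comp (mI _ mC) (@measurable_snd _ _ R R)).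
  exact: (measurableT_comp mLA (@measurable_snd _ _ R R)).
apply: eq_integral => y; rewrite inE/= in_itv/= andbT => y0; congr (_ * _).
have [N0 LE] := LN y0.
have mw : measurable_fun D (fun x : measurableTypeR R => (gig_weight b l y x)%:E).
  have h : measurable_fun setT (fun x : R => gig_weight b l y x) by mfun.
  by apply: measurable_funTS; apply/measurable_EFinP; exact: h.
have mwI : measurable_fun D (fun x : measurableTypeR R =>
    (\1_A x * gig_weight b l y x)%:E).
  have h : measurable_fun setT (fun x : R => \1_A x * gig_weight b l y x)%R.
    by apply: measurable_funM; [exact: mI|mfun].
  by apply: measurable_funTS; apply/measurable_EFinP; exact: h.
have LD (E : set R) : measurable E ->
    \int[mu]_(x in D) (\1_E x * gig_weight b l y x)%:E = (N y)%:E * L y E.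
  move=> mE.
  transitivity (\int[L y]_x ((N y)%:E * (\1_E x)%:E)).
    rewrite integral_gig_kernel//; last 2 first.
    - by move=> x; rewrite -EFinM lee_fin mulr_ge0// ltW.
    - by apply: measurable_funeM; apply/measurable_EFinP; exact: mI.
    apply: eq_integral => x _; rewrite -!EFinM; congr EFin.
    by field; rewrite gt_eqF.
  rewrite ge0_integralZl//; last 2 first.
  - by apply/measurable_EFinP; have h := mI _ mE; exact: h.
  - by rewrite lee_fin ltW.
  by rewrite integral_indic// setIT.
transitivity ((\1_C y)%:E * \int[mu]_(x in D) (\1_A x * gig_weight b l y x)%:E).
  rewrite -ge0_integralZl//.
  - by apply: eq_integral => x _; rewrite -!EFinM; congr EFin; ring.
  - by move=> x _; rewrite lee_fin mulr_ge0.
transitivity ((\1_C y)%:E * L y A *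
    \int[mu]_(x in D) (\1_setT x * gig_weight b l y x)%:E).
  have L1 : L y setT = 1 by exact: prob_kernel.
  by rewrite (LD A mA) (LD setT measurableT) L1 mule1 -muleA [L y A * _]muleC.
under eq_integral do rewrite indicT mul1r.
rewrite -ge0_integralZl// ?mule_ge0//.
by move=> x _; rewrite lee_fin.
Qed.

End gig_intertwining.

(** * The conditional law by induction on [n] *)

Section gig_sufficiency.
Local Open Scope ereal_scope.
Context d (T : measurableType d) (R : realType) (P : probability T R).
Variables (gamma : nat -> {RV P >-> R}) (b l c : R).
Hypothesis c0 : (0 <= c)%R.
Notation mu := (@lebesgue_measure R).
Notation D := (`]0%R, +oo[%classic : set R).
Variables (L : R.-pker (measurableTypeR R) ~> (measurableTypeR R)) (N : R -> R).
Hypothesis LN : forall z, (0 < z)%R -> (0 < N z)%R /\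
  forall A, measurable A ->
    L z A = \int[mu]_(x in A) (gig_weight b l z x / N z)%:E.
Let p (x : R) : R := (c * gig_weight b l 1 x)%R.
Hypothesis indep : mutually_independent gamma.
Hypothesis dens : forall n, has_density (gamma n) p.

Let p_pos x : (x <= 0)%R -> p x = 0%R.
Proof. by move=> x0; rewrite /p gig_weight_neg// mulr0. Qed.

Let p0 x : (0 <= p x)%R. Proof. by have [_ + _] := dens 0%N; exact. Qed.

Let mp : measurable_fun setT p. Proof. by have [] := dens 0%N. Qed.

Let mg n : measurable_fun setT (gamma n : T -> R).
Proof. exact: measurable_funP. Qed.

Let mX n : measurable_fun setT (Xprod gamma n : T -> R).
Proof. exact: measurable_Xprod. Qed.

Let mZ n : measurable_fun setT (Zsum gamma n : T -> R).
Proof. exact: measurable_Zsum. Qed.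

Let mpre (h : T -> R) (E : set R) : measurable_fun setT h -> measurable E ->
  measurable (h @^-1` E).
Proof. by move=> mh mE; rewrite -[X in measurable X]setTI; exact: mh. Qed.

Let sub n : <<s sigma_gen (Zsum gamma) n >> `<=` measurable.
Proof.
move=> B /sigma_gen_past; apply: sub_gen_measurable.
exact: past_measurable.
Qed.

Lemma measurable_Zsum_sigma_gen n k : (1 <= k <= n)%N ->
  measurable_fun setT
    (Zsum gamma k : g_sigma_algebraType (sigma_gen (Zsum gamma) n) -> R).
Proof.
by move=> kn _ B mB; apply: sub_sigma_algebra; exists k => //; exists B.
Qed.

(** [L z] is described only for [z > 0], so the induction needs Z_n to be positive almost surely. *)
Lemma ae_gamma_pos : \forall w \ae P, forall n, (0 < gamma n w)%R.
Proof.
apply: ae_foralln => n; exists (gamma n @^-1` `]-oo, 0%R]%classic).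
have mI : measurable (`]-oo, 0%R]%classic : set R) by exact: measurable_itv.
split.
- by apply: mpre.
- have [_ _ /(_ _ mI)] := dens n; rewrite /distribution/= /pushforward => ->.
  apply: integral0_eq => x; rewrite /= in_itv/= => x0.
  by rewrite p_pos.
- by move=> w /= /negP; rewrite -leNgt in_itv.
Qed.

(** The index of [Zsum] is shifted because Z_0 is the empty sum 0. *)
Lemma Xprod_Zsum_gt0 n w : (forall i, (0 < gamma i w)%R) ->
  (0 < Xprod gamma n w)%R /\ (0 < Zsum gamma n.+1 w)%R.
Proof.
move=> g0; elim: n => [|n [IHX IHZ]].
  by rewrite Zsum1 /Xprod big_geq.
have X0 : (0 < Xprod gamma n.+1 w)%R by rewrite XprodS mulr_gt0.
by split => //; rewrite ZsumS addr_gt0 ?invr_gt0// mulr_gt0.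
Qed.

Definition conditional_law n := forall A B, measurable A ->
  <<s sigma_gen (Zsum gamma) n >> B ->
  P (B `&` Xprod gamma n @^-1` A) = \int[P]_(w in B) L (Zsum gamma n w) A.

(* [Z_1 = 1], so [sigma(Z_1)] is contained in the sigma-algebra generated by no
   variable at all, and independence of [gamma_0] suffices. *)
Lemma conditional_law1 : conditional_law 1.
Proof.
move=> A B mA sB.
have pB : <<s past gamma 0 >> B.
  apply: smallest_sub sB; first exact: smallest_sigma_algebra.
  move=> _ [i /= i1 [C mC <-]].
  have -> : i = 1%N by apply/eqP; rewrite eqn_leq andbC.
  rewrite setTI (_ : Zsum gamma 1 = cst 1%R); last by apply/funext => w; rewrite Zsum1.
  have h := @measurable_cst _ _ (g_sigma_algebraType (past gamma 0)) R setT 1%R.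
  by have := h measurableT C mC; rewrite setTI.
have -> : Xprod gamma 1 = gamma 0%N.
  by apply/funext => w; rewrite XprodS /Xprod big_geq// mulr1.
rewrite past_indep//.
have [N0 LE] := LN ltr01.
have pE (E : set R) : measurable E ->
    P (gamma 0%N @^-1` E) = (c * N 1)%:E * L 1%R E.
  move=> mE; have [_ _ /(_ _ mE)] := dens 0%N.
  rewrite /distribution/= /pushforward => ->; rewrite LE//.
  rewrite -ge0_integralZl//.
  - apply: eq_integral => x _; rewrite -EFinM; congr EFin; rewrite /p.
    by field; rewrite gt_eqF.
  - apply: measurable_funTS; apply/measurable_EFinP.
    have h : measurable_fun setT (fun x : R => gig_weight b l 1 x / N 1)%R.
      by apply: measurable_funM => //; exact: measurable_gig_weight.
    exact: h.
  - by move=> x _; rewrite lee_fin divr_ge0 ?gig_weight_ge0// ltW.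
  - by rewrite lee_fin mulr_ge0// ltW.
(* The total mass of the law of [gamma 0] fixes the constant, so this law is [L 1]. *)
have cN : (c * N 1)%:E = 1.
  have := pE setT measurableT; rewrite preimage_setT probability_setT.
  have -> : L 1%R setT = 1 by exact: prob_kernel.
  by rewrite mule1.
rewrite pE// cN mul1e muleC.
have mB : measurable B by exact: sub sB.
rewrite -integral_cst//; apply: eq_integral => w _.
by rewrite Zsum1.
Qed.

(** [gamma n], independent of the past, is integrated out at fixed (Z_n, X_n); the induction
    hypothesis then replaces X_n by a point drawn from [L] at Z_n. *)
Lemma integral_Xprod_Zsum n (E : set T) (F : R -> R -> \bar R) : (0 < n)%N ->
  conditional_law n -> <<s sigma_gen (Zsum gamma) n >> E ->
  (forall x z, 0 <= F x z) ->
  measurable_fun setT (fun v : R * R => F v.1 v.2) ->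
  \int[P]_(w in E) F (Xprod gamma n.+1 w) (Zsum gamma n.+1 w) =
  \int[P]_(w in E) \int[L (Zsum gamma n w)]_u \int[mu]_(g in D)
    (F (g * u)%R (g * Zsum gamma n w + u^-1)%R * (p g)%:E).
Proof.
move=> n0 IH sE F0 mF.
pose G (s : R * R) (g : R) := F (g * s.2)%R (g * s.1 + s.2^-1)%R.
have mFc d' (S : measurableType d') (a e : S -> R) : measurable_fun setT a ->
    measurable_fun setT e -> measurable_fun setT (fun t => F (a t) (e t)).
  exact: measurable_uncurry.
have m11 : measurable_fun setT (fun v : R * R * R => v.1.1).
  exact: (measurableT_comp measurable_fst measurable_fst).
have m12 : measurable_fun setT (fun v : R * R * R => v.1.2).
  exact: (measurableT_comp measurable_snd measurable_fst).
have m2 : measurable_fun setT (fun v : R * R * R => v.2) by exact: measurable_snd.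
have mG : measurable_fun setT (fun v : R * R * R => G v.1 v.2).
  apply: mFc; first exact: measurable_funM.
  by apply: measurable_funD; [exact: measurable_funM|exact: measurable_funV].
have mZX : measurable_fun setT
    ((fun w => (Zsum gamma n w, Xprod gamma n w)) :
      g_sigma_algebraType (past gamma n) -> R * R).
  by apply: measurable_fun_pair; [exact: measurable_Zsum_past|exact: measurable_Xprod_past].
have pE : <<s past gamma n >> E by exact: sigma_gen_past.
transitivity (\int[P]_(w in E) G (Zsum gamma n w, Xprod gamma n w) (gamma n w)).
  by apply: eq_integral => w _; rewrite XprodS ZsumS.
rewrite (@integral_one_step _ _ _ _ gamma p indep dens p_pos _ (R * R)%type n
  (fun w => (Zsum gamma n w, Xprod gamma n w)) E G mZX pE)//; last first.
  by move=> s x; exact: F0.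
pose H (s : R * R) := \int[mu]_(g in D) (G s g * (p g)%:E).
have H0 s : 0 <= H s.
  by apply: integral_ge0 => g _; apply: mule_ge0; [exact: F0|rewrite lee_fin; exact: p0].
have mH : measurable_fun setT H.
  apply: (@measurable_integral_pos _ (R * R)%type R (fun s g => G s g * (p g)%:E)).
  - by move=> s g; apply: mule_ge0; [exact: F0|rewrite lee_fin; exact: p0].
  - apply: emeasurable_funM => //; apply/measurable_EFinP.
    exact: (measurableT_comp mp m2).
have mZn : measurable_fun setT (Zsum gamma n : T -> measurableTypeR R).
  have h := mZ n; exact: h.
have mXn : measurable_fun setT (Xprod gamma n : T -> measurableTypeR R).
  have h := mX n; exact: h.
apply: (@disintegration _ _ _ T (measurableTypeR R) (measurableTypeR R) R P L
  (Zsum gamma n) (Xprod gamma n) mZn mXn E H) => //.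
- exact: sub sE.
- move=> B A mB mA; rewrite setIA IH//.
  apply: (@measurableI _ (g_sigma_algebraType (sigma_gen (Zsum gamma) n))) => //.
  have h := @measurable_Zsum_sigma_gen n n.
  rewrite -[X in measurable X]setTI; apply: h => //.
  by rewrite n0 leqnn.
Qed.

(* Disintegrating along [(Z_n, X_n)], then along [gamma_n], reduces the claim to
   the intertwining. *)
Lemma conditional_law_box n (A C : set R) (B : set T) : (0 < n)%N ->
  conditional_law n -> measurable A -> measurable C ->
  <<s sigma_gen (Zsum gamma) n >> B ->
  P (B `&` Zsum gamma n.+1 @^-1` C `&` Xprod gamma n.+1 @^-1` A) =
  \int[P]_(w in B `&` Zsum gamma n.+1 @^-1` C) L (Zsum gamma n.+1 w) A.
Proof.
move=> n0 IH mA mC sB.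
have mB := sub sB.
have mLA : measurable_fun setT (fun y : R => L y A).
  exact: (measurable_kernel L A mA).
have mI (E : set R) : measurable E -> measurable_fun setT (\1_E : R -> R).
  by move=> mE; exact: measurable_indic.
pose F1 x y : \bar R := (\1_A x * \1_C y)%:E.
pose F2 (x y : R) : \bar R := (\1_C y)%:E * L y A.
have F10 x y : 0 <= F1 x y by rewrite lee_fin mulr_ge0.
have F20 x y : 0 <= F2 x y by rewrite mule_ge0.
have mF1 : measurable_fun setT (fun v : R * R => F1 v.1 v.2).
  apply/measurable_EFinP; apply: measurable_funM.
    exact: (measurableT_comp (mI _ mA) (@measurable_fst _ _ R R)).
  exact: (measurableT_comp (mI _ mC) (@measurable_snd _ _ R R)).
have mF2 : measurable_fun setT (fun v : R * R => F2 v.1 v.2).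
  apply: emeasurable_funM.
    apply/measurable_EFinP.
    exact: (measurableT_comp (mI _ mC) (@measurable_snd _ _ R R)).
  exact: (measurableT_comp mLA (@measurable_snd _ _ R R)).
have mstep (F : R -> R -> \bar R) : (forall x y, 0 <= F x y) ->
    measurable_fun setT (fun v : R * R => F v.1 v.2) ->
    measurable_fun B (fun w => \int[L (Zsum gamma n w)]_u \int[mu]_(g in D)
      (F (g * u)%R (g * Zsum gamma n w + u^-1)%R * (p g)%:E)).
  move=> F0 mF; apply: measurable_funTS.
  pose H (s : R * R) := \int[mu]_(g in D)
    (F (g * s.2)%R (g * s.1 + s.2^-1)%R * (p g)%:E).
  have m11 : measurable_fun setT (fun v : R * R * R => v.1.1).
    exact: (measurableT_comp measurable_fst measurable_fst).
  have m12 : measurable_fun setT (fun v : R * R * R => v.1.2).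
    exact: (measurableT_comp measurable_snd measurable_fst).
  have m2 : measurable_fun setT (fun v : R * R * R => v.2) by exact: measurable_snd.
  have mH : measurable_fun setT H.
    apply: (@measurable_integral_pos _ (R * R)%type R (fun s g =>
      F (g * s.2)%R (g * s.1 + s.2^-1)%R * (p g)%:E)).
    - by move=> s g; apply: mule_ge0; [exact: F0|rewrite lee_fin; exact: p0].
    - apply: emeasurable_funM; last first.
        by apply/measurable_EFinP; exact: (measurableT_comp mp m2).
      apply: (measurable_uncurry mF); first exact: measurable_funM.
      by apply: measurable_funD; [exact: measurable_funM|exact: measurable_funV].
  have mZn : measurable_fun setT (Zsum gamma n : T -> measurableTypeR R).
    have h := mZ n; exact: h.
  apply: (@measurable_integral_kernel _ _ _ T (measurableTypeR R)
    (measurableTypeR R) R L (Zsum gamma n) mZn H) => //.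
  by move=> s; apply: integral_ge0 => g _; apply: mule_ge0; [exact: F0|rewrite lee_fin; exact: p0].
have mZC : measurable (Zsum gamma n.+1 @^-1` C) by exact: mpre.
have mXA : measurable (Xprod gamma n.+1 @^-1` A) by exact: mpre.
have indicp (h : T -> R) (E : set R) w : \1_E (h w) = \1_(h @^-1` E) w :> R.
  by rewrite !indicE; congr (_%:R); congr nat_of_bool; apply/idP/idP; rewrite !inE.
transitivity (\int[P]_(w in B) F1 (Xprod gamma n.+1 w) (Zsum gamma n.+1 w)).
  rewrite [LHS](_ : _ =
    P ((Zsum gamma n.+1 @^-1` C `&` Xprod gamma n.+1 @^-1` A) `&` B)); last first.
    by rewrite -setIA setIC.
  rewrite -integral_indic//; last exact: measurableI.
  apply: eq_integral => w _.
  by rewrite /F1 !indicp indicI/= mulrC.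
rewrite (integral_Xprod_Zsum n0 IH sB F10 mF1).
transitivity (\int[P]_(w in B) F2 (Xprod gamma n.+1 w) (Zsum gamma n.+1 w));
    last first.
  rewrite [RHS]integral_mkcondr; apply: eq_integral => w _.
  rewrite patchE /F2 indicp indicE; case: ifPn => _; last by rewrite mul0e.
  by rewrite mul1e.
rewrite (integral_Xprod_Zsum n0 IH sB F20 mF2).
apply: ae_eq_integral => //; [exact: mstep|exact: mstep|].
apply: filterS ae_gamma_pos => w g0 _.
have [_ Z0] := Xprod_Zsum_gt0 n.-1 g0; rewrite prednK// in Z0.
have h := gig_kernel_intertwining c0 LN Z0 mA mC.
exact: h.
Qed.

(** Both sides are finite measures in [B]. They agree on intersections of an event known at time [n]
    with one that constrains Z_(n+1), and these form a pi-system generating the next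
    sigma-algebra. *)
Lemma conditional_lawS n : (0 < n)%N -> conditional_law n -> conditional_law n.+1.
Proof.
move=> n0 IH A B mA sB.
pose G : set (set T) := [set E | exists B' C, [/\ <<s sigma_gen (Zsum gamma) n >> B',
  measurable C & E = B' `&` Zsum gamma n.+1 @^-1` C]].
have GM : G `<=` measurable.
  by move=> _ [B' [C [sB' mC ->]]]; apply: measurableI; [exact: sub sB'|exact: mpre].
have mXA : measurable (Xprod gamma n.+1 @^-1` A) by exact: mpre.
have mLA : measurable_fun setT (fun w => L (Zsum gamma n.+1 w) A).
  have h := measurableT_comp (measurable_kernel L A mA) (mZ n.+1).
  exact: h.
pose k (E : set T) : \bar R := \int[P]_(w in E) L (Zsum gamma n.+1 w) A.
have k0 : k set0 = 0 by rewrite /k integral_set0.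
have k_ge0 E : 0 <= k E by apply: integral_ge0.
have k_sigma : semi_sigma_additive k.
  have h := @semi_sigma_additive_nng_induced _ _ _ P _ mLA
    (fun w => measure_ge0 (L (Zsum gamma n.+1 w)) A).
  exact: h.
pose m2 : {measure set T -> \bar R} :=
  HB.pack k (isMeasure.Build _ _ _ k k0 k_ge0 k_sigma).
apply: (@g_sigma_algebra_measure_unique _ _ _ G GM (fun=> setT) _ _
  (mrestr P mXA) m2) => //.
- move=> _; exists setT, setT; split => //.
    exact: (@measurableT _ (g_sigma_algebraType (sigma_gen (Zsum gamma) n))).
  by rewrite preimage_setT setIT.
- by rewrite bigcup_const.
- move=> _ _ [B1 [C1 [sB1 mC1 ->]]] [B2 [C2 [sB2 mC2 ->]]].
  exists (B1 `&` B2), (C1 `&` C2); split.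
  + exact: (@measurableI _ (g_sigma_algebraType (sigma_gen (Zsum gamma) n))).
  + exact: measurableI.
  + by rewrite preimage_setI setIACA.
- by move=> _ [B' [C [sB' mC ->]]]; exact: conditional_law_box.
- move=> _; rewrite /= /mrestr setTI.
  by rewrite (le_lt_trans (probability_le1 P mXA))// ltry.
- apply: smallest_sub sB; first exact: smallest_sigma_algebra.
  move=> _ [i /= /andP[i1 iltn] [C mC <-]]; apply: sub_sigma_algebra.
  move: iltn; rewrite leq_eqVlt => /orP[/eqP ->|iltn].
    exists setT, C; split => //.
    exact: (@measurableT _ (g_sigma_algebraType (sigma_gen (Zsum gamma) n))).
  exists (Zsum gamma i @^-1` C), setT; split => //.
    by apply: sub_sigma_algebra; exists i; [rewrite /= i1|exists C => //; rewrite setTI].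
  by rewrite preimage_setT setTI setIT.
Qed.

Lemma conditional_lawP n : (0 < n)%N -> conditional_law n.
Proof.
case: n => // n _; elim: n => [|n IH]; first exact: conditional_law1.
exact: conditional_lawS.
Qed.

Lemma gig_kernel_is_cond_prob n A : (1 <= n)%N -> measurable A ->
  is_cond_prob P (sigma_gen (Zsum gamma) n) (Xprod gamma n @^-1` A)
    (fun w => L (Zsum gamma n w) A).
Proof.
move=> n1 mA; split; last first.
  by move=> B sB; rewrite setIC conditional_lawP.
have mZn : measurable_fun setT
    (Zsum gamma n : g_sigma_algebraType (sigma_gen (Zsum gamma) n) -> R).
  by apply: measurable_Zsum_sigma_gen; rewrite n1 leqnn.
have h := measurableT_comp (measurable_kernel L A mA) mZn.
exact: h.
Qed.

End gig_sufficiency.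

Lemma gig_pdfE (R : realType) (lambda a x : R) : gig_pdf lambda a x =
  (2 * macdonald lambda (a ^+ 2))^-1 * gig_weight (a ^+ 2 / 2) lambda 1 x.
Proof.
rewrite /gig_pdf; case: ltP => x0; last by rewrite gig_weight_neg ?mulr0.
by rewrite gig_weight_pos// divr1 -mulrA.
Qed.

Theorem theorem4p2 (R : realType) (d : measure_display)
    (T : measurableType d) (P : probability T R)
    (gamma : nat -> {RV P >-> R}) (f : R -> R)
    (gamma_iid : iid gamma)
    (gamma_density : forall n : nat, has_density (gamma n) f)
    (f_C1 : C1_supported_on_Rplus f) :
  (exists L : R.-pker (measurableTypeR R) ~> (measurableTypeR R),
     kernel_on_pos L /\
     forall n : nat, (1 <= n)%N ->
     forall A : set R, measurable A ->
       is_cond_prob P (sigma_gen (Zsum gamma) n)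
         (Xprod gamma n @^-1` A)
         (fun w => L (Zsum gamma n w) A))
  <->
  (exists a lambda : R, 0 < a /\
     forall n : nat, has_density (gamma n) (gig_pdf lambda a)).
Proof.
have [indep _] := gamma_iid; split => [[L [_ HL]]|[a [lambda [a0 dens]]]].
  exact: (gig_of_kernel indep gamma_density f_C1 (HL 3%N isT)).
have b0 : 0 < a ^+ 2 / 2 by rewrite divr_gt0// exprn_gt0.
pose c := (2 * macdonald lambda (a ^+ 2))^-1.
have gE : gig_pdf lambda a = fun x => c * gig_weight (a ^+ 2 / 2) lambda 1 x.
  by apply/funext => x; exact: gig_pdfE.
(* The sign is read off the assumed density at 1, where the weight is positive; no estimate of the
   Macdonald function is involved. *)
have c0 : 0 <= c.
  have [_ /(_ 1) + _] := dens 0%N; rewrite gE pmulr_lge0//.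
  by rewrite gig_weight_pos// mulr_gt0 ?powR_gt0 ?expR_gt0.
have [L [N LN]] := gig_kernel lambda b0.
exists L; split => [z z0|n n1 A mA].
  have L1 : L z setT = 1%E by exact: prob_kernel.
  have [_ LE] := LN z z0; rewrite -L1 (LE _ (measurable_itv _)) (LE _ measurableT).
  rewrite integral_mkcond; apply: eq_integral => x _; rewrite patchE.
  case: ifPn => //; rewrite notin_setE/= in_itv/= andbT => /negP.
  by rewrite -leNgt => x0; rewrite gig_weight_neg// mul0r.
apply: (gig_kernel_is_cond_prob c0 LN indep) => // m.
by rewrite -gE.
Qed.
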